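(* Let $\mathcal{M}$ be an $m$-dimensional $C^\infty$ manifold in $\mathbb{R}^d$ with $1\le m\le d$, and let $\boldsymbol{X}$ be a random vector in $\mathbb{R}^d$ with $\boldsymbol{X}\in\mathcal{M}$ and law $\mu$. Assume that for every point $\boldsymbol{x}\in\mathcal{M}$ and every chart $(U,\psi)$ of $\mathcal{M}$ such that $U$ is a coordinate neighborhood of $\boldsymbol{x}$ and $\psi:U\to V\subset\mathbb{R}^m$, the pushforward $\psi_*\mu_U$ of the restriction $\mu_U$ of $\mu$ to $U$ is absolutely continuous with respect to Lebesgue measure on $V$. Let $\mathcal{G}_n$ be the directed nearest neighbor graph of $n$ independent copies $\boldsymbol{X}_1,\dots,\boldsymbol{X}_n$ of $\boldsymbol{X}$, with edge set $\mathcal{E}(\mathcal{G}_n)$. Then, as $n\to\infty$, $$\mathrm{E}\Big(\frac1n\,\#\big\{(i,j,k)\text{ distinct}:\ i\to k,\ j\to k\in\mathcal{E}(\mathcal{G}_n)\big\}\Big)\longrightarrow \mathfrak{o}_m .$$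
   Context: A $C^\infty$ manifold in $\mathbb{R}^d$ means a smooth embedded submanifold of $\mathbb{R}^d$. A chart on $\mathcal{M}$ is a pair $(U,\psi)$ with $U$ an open subset of $\mathcal{M}$ and $\psi:U\to V=\psi(U)$ a homeomorphism onto an open subset of $\mathbb{R}^m$, belonging to the smooth structure of $\mathcal{M}$ (so $\psi$ and $\psi^{-1}$ are $C^\infty$); $U$ is called a coordinate neighborhood of each of its points. The directed nearest neighbor graph $\mathcal{G}_n$ has vertex set $\{1,\dots,n\}$, and $i\to j$ is an edge if and only if $\boldsymbol{X}_j$ ($j\ne i$) is the nearest neighbor of $\boldsymbol{X}_i$ in Euclidean distance of $\mathbb{R}^d$ among the other sample points; possible ties are broken by an arbitrary fixed measurable rule depending only on $\boldsymbol{X}_1,\dots,\boldsymbol{X}_n$. The triples $(i,j,k)$ counted are ordered triples of pairwise distinct indices. For every integer $m\ge1$, $$\mathfrak{o}_m:=\iint_{\Gamma_{m;2}}\exp\Big[-\lambda\big\{B(\boldsymbol{w}_1,\|\boldsymbol{w}_1\|)\cup B(\boldsymbol{w}_2,\|\boldsymbol{w}_2\|)\big\}\Big]\,d(\boldsymbol{w}_1,\boldsymbol{w}_2),$$ $$\Gamma_{m;2}:=\big\{(\boldsymbol{w}_1,\boldsymbol{w}_2)\in(\mathbb{R}^m)^2:\max(\|\boldsymbol{w}_1\|,\|\boldsymbol{w}_2\|)<\|\boldsymbol{w}_1-\boldsymbol{w}_2\|\big\},$$ where $B(\boldsymbol{w},r)\subset\mathbb{R}^m$ is the ball of center $\boldsymbol{w}$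 and radius $r$, $\|\cdot\|$ is the Euclidean norm, and $\lambda$ is Lebesgue measure on $\mathbb{R}^m$. *)

(* Defs.v *)
From HB Require Import structures.
From mathcomp Require Import all_boot all_order all_algebra finmap.
From mathcomp Require Import all_classical all_reals all_analysis.
Import Order.TTheory GRing.Theory Num.Theory.
Import numFieldNormedType.Exports.

Set Implicit Arguments.
Unset Strict Implicit.
Unset Printing Implicit Defensive.

Local Open Scope classical_set_scope.
Local Open Scope ring_scope.

(* R^n is 'rV[R]_n. Its topology and differential calculus are those of the
   library (sup norm); its sigma-algebra is the product one, generated by the
   coordinates, as the library does for tuples. For T = R it is the Borel
   sigma-algebra of R^n. *)

Definition measure_rV_display : measure_display -> measure_display.
Proof. exact. Qed.

Section measurable_rV.
Context {d} {T : measurableType d} (n : nat).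

Let coors : 'I_n -> 'rV[T]_n -> T := fun i x => x ord0 i.

Let rV_set0 : g_sigma_preimage coors set0.
Proof. exact: sigma_algebra0. Qed.

Let rV_setC A : g_sigma_preimage coors A -> g_sigma_preimage coors (~` A).
Proof. exact: sigma_algebraC. Qed.

Let rV_bigcup (F : (set 'rV[T]_n)^nat) :
  (forall i, g_sigma_preimage coors (F i)) ->
  g_sigma_preimage coors (\bigcup_i F i).
Proof. exact: sigma_algebra_bigcup. Qed.

HB.instance Definition _ := @isMeasurable.Build (measure_rV_display d)
  'rV[T]_n (g_sigma_preimage coors) rV_set0 rV_setC rV_bigcup.

End measurable_rV.

Section measurable_rV_theory.
Context d1 d2 (T1 : measurableType d1) (T2 : measurableType d2).

Lemma measurable_rV_coord n (i : 'I_n) :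
  measurable_fun [set: 'rV[T2]_n] (fun x : 'rV[T2]_n => x ord0 i).
Proof.
move=> _ Y mY; rewrite setTI; apply: sub_sigma_algebra => /=.
rewrite -bigcup_seq/=; exists i => /=; first by rewrite mem_index_enum.
by exists Y => //; rewrite setTI.
Qed.

Lemma measurable_fun_rVP n (f : T1 -> 'rV[T2]_n) :
  measurable_fun [set: T1] f <->
  forall i, measurable_fun [set: T1] (fun x => f x ord0 i).
Proof.
split=> [mf i|mf].
  exact: (@measurableT_comp _ _ _ _ _ _ (fun x : 'rV[T2]_n => x ord0 i) _ f
    (measurable_rV_coord i) mf).
move=> _ Y mY; rewrite setTI.
pose G := [set B : set 'rV[T2]_n | measurable (f @^-1` B)].
suff : measurable `<=` G by exact.
apply: smallest_sub.
  split; rewrite /G /=.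
  - by rewrite preimage_set0.
  - by move=> A mA; rewrite setTD preimage_setC; exact: measurableC.
  - by move=> F mF; rewrite preimage_bigcup; exact: bigcup_measurable.
rewrite -bigcup_seq/=; apply: bigcup_sub => i _ _ [B mB <-].
by rewrite /G /= setTI; have := mf i measurableT B mB; rewrite setTI.
Qed.

End measurable_rV_theory.

(* The library has Lebesgue measure in dimension 1 only; on R^(n+1) it is the
   image of the product measure under the bijection
   R * R^n -> R^(n+1). See lebesgue_rV_box for the volume of boxes. *)
Section lebesgue_rV.
Context {R : realType}.

Let lambda1 : {sigma_finite_measure set (measurableTypeR R) -> \bar R} :=
  @lebesgue_measure R.

Definition rV_cons n (p : measurableTypeR R * 'rV[R]_n) : 'rV[R]_n.+1 :=
  row_mx (const_mx p.1 : 'rV[R]_1) p.2.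

Definition rV_uncons n (v : 'rV[R]_n.+1) : measurableTypeR R * 'rV[R]_n :=
  (v ord0 ord0, rsubmx (v : 'rV[R]_(1 + n))).

Lemma rV_cons0 n (p : measurableTypeR R * 'rV[R]_n) :
  rV_cons p ord0 ord0 = p.1.
Proof.
rewrite /rV_cons (_ : ord0 = lshift n (ord0 : 'I_1)); last exact/val_inj.
by rewrite (@row_mxEl _ 1 1 n) mxE.
Qed.

Lemma rV_consS n (p : measurableTypeR R * 'rV[R]_n) (i : 'I_n) :
  rV_cons p ord0 (lift ord0 i) = p.2 ord0 i.
Proof.
rewrite /rV_cons (_ : lift ord0 i = rshift 1 i); last exact/val_inj.
by rewrite (@row_mxEr _ 1 1 n).
Qed.

Lemma rV_unconsK n : cancel (@rV_uncons n) (@rV_cons n).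
Proof.
move=> v; apply/rowP => i; have [->|[j ->]] : i = ord0 \/ exists j, i = lift ord0 j.
- by case: (unliftP ord0 i) => [j ->|->]; [right; exists j|left].
- by rewrite rV_cons0.
- rewrite rV_consS /rV_uncons /= mxE; congr (v _ _).
  exact/val_inj.
Qed.

Lemma rV_consK n : cancel (@rV_cons n) (@rV_uncons n).
Proof.
move=> [x v]; congr pair; first exact: rV_cons0.
by rewrite /rV_cons row_mxKr.
Qed.

Lemma measurable_rV_cons n : measurable_fun setT (@rV_cons n).
Proof.
apply/measurable_fun_rVP => i.
case: (unliftP ord0 i) => [j ->|->].
  rewrite (_ : (fun _ => _) = (fun v : 'rV[R]_n => v ord0 j) \o snd).
    exact: measurableT_comp (measurable_rV_coord j) _.
  by apply/funext => p; rewrite rV_consS.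
rewrite (_ : (fun _ => _) = fst); first exact: measurable_fst.
by apply/funext => p; rewrite rV_cons0.
Qed.

Lemma measurable_rV_uncons n : measurable_fun setT (@rV_uncons n).
Proof.
apply: measurable_fun_pair => /=; first exact: (@measurable_rV_coord _ R).
apply/measurable_fun_rVP => i.
rewrite (_ : (fun _ => _) = (fun v : 'rV[R]_n.+1 => v ord0 (rshift 1 i))).
  exact: measurable_rV_coord.
by apply/funext => v; rewrite mxE.
Qed.

Section cons_measure.
Context n (mu : {sigma_finite_measure set 'rV[R]_n -> \bar R}).

Definition rV_cons_measure : set 'rV[R]_n.+1 -> \bar R :=
  pushforward (lambda1 \x mu)%E (@rV_cons n).

Let cons0 : rV_cons_measure set0 = 0%E.
Proof. by rewrite /rV_cons_measure /pushforward preimage_set0 measure0. Qed.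

Let cons_ge0 A : (0 <= rV_cons_measure A)%E.
Proof. by rewrite /rV_cons_measure /pushforward measure_ge0. Qed.

Let cons_sigma_additive : semi_sigma_additive rV_cons_measure.
Proof.
move=> F mF tF mUF; rewrite /rV_cons_measure /pushforward preimage_bigcup.
have mp A : measurable A -> measurable (@rV_cons n @^-1` A).
  by move=> mA; rewrite -[X in measurable X]setTI; exact: measurable_rV_cons.
apply: measure_semi_sigma_additive.
- by move=> k; exact: mp.
- apply/trivIsetP => /= i j _ _ ij; rewrite -preimage_setI.
  by move/trivIsetP : tF => /(_ _ _ _ _ ij) ->//; rewrite preimage_set0.
- by rewrite -preimage_bigcup; exact: mp.
Qed.

HB.instance Definition _ := isMeasure.Build _ _ _ rV_cons_measure
  cons0 cons_ge0 cons_sigma_additive.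

Let cons_sigma_finite : sigma_finite setT rV_cons_measure.
Proof.
have /sigma_finiteP[F [TF ndF Foo]] := sigma_finiteT lambda1.
have /sigma_finiteP[G [TG ndG Goo]] := sigma_finiteT mu.
exists (fun k => @rV_uncons n @^-1` (F k `*` G k)).
  apply/seteqP; split => // v _ /=.
  have : setT (rV_uncons v).1 by [].
  have : setT (rV_uncons v).2 by [].
  rewrite TF TG => -[j _ Gj] [k _ Fk]; exists (maxn j k) => //; split.
  - by move: Fk; exact/subsetPset/ndF/leq_maxr.
  - by move: Gj; exact/subsetPset/ndG/leq_maxl.
move=> k; have [mF Fk] := Foo k; have [mG Gk] := Goo k.
have mFG : measurable (F k `*` G k) by exact: measurableX.
split.
  by rewrite -[X in measurable X]setTI; exact: measurable_rV_uncons.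
rewrite /rV_cons_measure /pushforward -comp_preimage.
rewrite (_ : _ \o _ = id) ?preimage_id; last first.
  by apply/funext => p /=; rewrite rV_consK.
by rewrite product_measure1E// lte_mul_pinfty// ge0_fin_numE.
Qed.

HB.instance Definition _ := Measure_isSigmaFinite.Build _ _ _ rV_cons_measure
  cons_sigma_finite.

Lemma rV_cons_measure_box (A : 'I_n.+1 -> set R) :
  (forall i, measurable (A i)) ->
  measurable [set v : 'rV[R]_n | forall i, A (lift ord0 i) (v ord0 i)] ->
  rV_cons_measure [set v | forall i, A i (v ord0 i)] =
  (@lebesgue_measure R (A ord0) *
    mu [set v | forall i, A (lift ord0 i) (v ord0 i)])%E.
Proof.
move=> mA mB; rewrite /rV_cons_measure /pushforward.
pose B : set 'rV[R]_n := [set v | forall i, A (lift ord0 i) (v ord0 i)].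
transitivity ((lambda1 \x mu)%E (A ord0 `*` B)); last first.
  by rewrite product_measure1E//; exact: mA.
congr ((lambda1 \x mu)%E _).
apply/seteqP; split => [p Ap|p [A0 AS] i] /=.
  split; first by have := Ap ord0; rewrite rV_cons0.
  by move=> i; have := Ap (lift ord0 i); rewrite rV_consS.
by case: (unliftP ord0 i) => [j ->|->]; rewrite ?rV_consS ?rV_cons0//; exact: AS.
Qed.

End cons_measure.

Fixpoint lebesgue_rV n : {sigma_finite_measure set 'rV[R]_n -> \bar R} :=
  match n with
  | 0%N => dirac (0 : 'rV[R]_0)
  | n'.+1 => rV_cons_measure (lebesgue_rV n')
  end.

Lemma measurable_rV_box n (A : 'I_n -> set R) :
  (forall i, measurable (A i)) ->
  measurable [set v : 'rV[R]_n | forall i, A i (v ord0 i)].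
Proof.
move=> mA.
rewrite (_ : mkset _ =
    \big[setI/setT]_(i < n) ((fun v : 'rV[R]_n => v ord0 i) @^-1` A i)).
  apply: bigsetI_measurable => i _; rewrite -[X in measurable X]setTI.
  exact: measurable_rV_coord.
rewrite -bigcap_seq; apply/seteqP; split => [v Av i _|v Av i]; first exact: Av.
by apply: Av; rewrite /= mem_index_enum.
Qed.

Lemma lebesgue_rV_box n (A : 'I_n -> set R) : (forall i, measurable (A i)) ->
  lebesgue_rV n [set v | forall i, A i (v ord0 i)] =
  (\prod_(i < n) @lebesgue_measure R (A i))%E.
Proof.
elim: n => [|n IH] in A * => mA.
  by rewrite big_ord0 /= diracE mem_set//= => -[].
rewrite big_ord_recl -IH => [|i]; last exact: mA.
have mB := measurable_rV_box (A := fun i => A (lift ord0 i))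
  (fun i => mA (lift ord0 i)).
exact: (rV_cons_measure_box (lebesgue_rV n) mA mB).
Qed.

End lebesgue_rV.

(* `|v| is the sup norm on 'rV[R]_n, hence this definition. *)
Definition enorm (R : realType) n (v : 'rV[R]_n) : R :=
  Num.sqrt (\sum_(i < n) v ord0 i ^+ 2).

Definition euclidean_ball (R : realType) n (w : 'rV[R]_n) (r : R) :
    set 'rV[R]_n :=
  [set v | enorm (v - w) < r].

Section smooth.
Context {R : realType}.

(* f is of class C^k on the open set O: its partial derivatives up to order k
   exist and are continuous on O. Since O is open, the values of f outside O
   are irrelevant. *)
Fixpoint class_C a b (k : nat) (O : set 'rV[R]_a) (f : 'rV[R]_a -> 'rV[R]_b)
    : Prop :=
  (forall x, O x -> {for x, continuous f}) /\
  match k with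
  | 0%N => True
  | k'.+1 => forall i : 'I_a,
      (forall x, O x -> derivable f x (delta_mx ord0 i)) /\
      class_C k' O ('D_(delta_mx ord0 i) f)
  end.

Definition smooth_on_open a b (O : set 'rV[R]_a) (f : 'rV[R]_a -> 'rV[R]_b) :=
  forall k, class_C k O f.

(* Smoothness on an arbitrary subset S of R^a: local smooth extendability. *)
Definition smooth_on_subset a b (S : set 'rV[R]_a)
    (f : 'rV[R]_a -> 'rV[R]_b) :=
  forall x, S x -> exists W F,
    [/\ open W, W x, smooth_on_open W F & {in S `&` W, F =1 f}].

(* (U, psi) is a chart of M: psi restricts to a diffeomorphism from the
   relatively open subset U of M onto the open subset V = psi @` U of R^m.
   Both psi and its inverse phi are total functions; only their restrictions to
   U and V matter. Continuity of psi on U and of phi on V is part of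
   smoothness, so that psi : U -> V is a homeomorphism. *)
Definition chart d m (M U : set 'rV[R]_d) (psi : 'rV[R]_d -> 'rV[R]_m) :=
  [/\ exists2 O, open O & U = M `&` O,
      open (psi @` U),
      smooth_on_subset U psi &
      exists2 phi : 'rV[R]_m -> 'rV[R]_d,
        {in U, cancel psi phi} & smooth_on_open (psi @` U) phi].

Definition smooth_submanifold d (m : nat) (M : set 'rV[R]_d) :=
  forall x, M x ->
    exists U, exists2 psi : 'rV[R]_d -> 'rV[R]_m, chart M U psi & U x.

End smooth.

(* Restriction of mu to D, as a set function; unlike mrestr it does not
   require a proof that D is measurable. *)
Definition restriction (R : realType) T (mu : set T -> \bar R) (D : set T) :
    set T -> \bar R :=
  fun A => mu (A `&` D).

Definition mutually_independent d d' (T : measurableType d)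
    (T' : measurableType d') (R : realType) (P : probability T R)
    (X : nat -> T -> T') :=
  forall (J : {fset nat}) (A : nat -> set T'),
    (forall i, measurable (A i)) ->
    P (\bigcap_(i in [set` J]) (X i @^-1` A i)) =
    (\prod_(i <- J) P (X i @^-1` A i))%E.

Section nearest_neighbor_graph.
Context {R : realType} (d n : nat).

(* nn x i is the index of the nearest neighbor of x_i in the sample x, a
   measurable choice being made in case of ties. The sample has to have at
   least two points. *)
Definition nearest_neighbor_rule (nn : n.-tuple 'rV[R]_d -> 'I_n -> 'I_n) :=
  (forall i j, measurable [set x | nn x i = j]) /\
  ((1 < n)%N -> forall x i, nn x i != i /\
    forall j, j != i ->
      enorm (tnth x i - tnth x (nn x i)) <= enorm (tnth x i - tnth x j)).

Definition nn_edge (nn : n.-tuple 'rV[R]_d -> 'I_n -> 'I_n)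
    (x : n.-tuple 'rV[R]_d) : rel 'I_n :=
  [rel i j | (j != i) && (j == nn x i)].

End nearest_neighbor_graph.

Definition shared_target_count n (e : rel 'I_n) : nat :=
  #|[set t : 'I_n * 'I_n * 'I_n | let: (i, j, k) := t in
      [&& i != j, i != k, j != k, e i k & e j k]]|.

Section limit_constant.
Context {R : realType} (m : nat).

Definition Gamma2 : set ('rV[R]_m * 'rV[R]_m) :=
  [set w | Num.max (enorm w.1) (enorm w.2) < enorm (w.1 - w.2)].

(* fine is harmless: the measure of a union of two balls is finite. *)
Definition limit_constant : \bar R :=
  (\int[lebesgue_rV m \x lebesgue_rV m]_(w in Gamma2)
    (expR (- fine (lebesgue_rV m (euclidean_ball w.1 (enorm w.1) `|`
                                  euclidean_ball w.2 (enorm w.2)))))%:E)%E.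

End limit_constant.
Arguments limit_constant R m : clear implicits.

(* Main.v *)
(* Call star a triple (i, j, k) such that X_i and X_j are farther from each other
   than from X_k and the balls of centers X_i, X_j passing through X_k contain no
   other sample point. Up to ties, the stars are the triples to be counted;
   restricting them to radius r costs at most a constant (the kissing number of
   R^d) times the number of points whose nearest neighbor is farther than r.
   By independence, the expected number of stars is the integral over their
   center x of an explicit function of n, r and x. For r = R n^(-1/m), dilating a
   chart around x by n^(1/m) turns this function into an integral over pairs of
   tangent vectors. For almost every x, along a subsequence of n, the dilated
   density becomes constant in L^1 on balls; an affine change of variables making
   the tangent plane Euclidean and this density equal to 1 then shows that the
   limit is the integral defining the constant, restricted to vectors of bounded
   norm. These functions of x are bounded by the square of the kissing number
   (apply the deterministic bound to a sample and an extra point x), hence the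
   limit can be integrated over x. Finally R tends to infinity, and since every
   subsequence of n has a further subsequence with the same limit, the whole
   sequence converges. *)

Require Import Defs.
From HB Require Import structures.
From mathcomp Require Import all_boot all_order all_algebra finmap.
From mathcomp Require Import all_classical all_reals all_analysis.
From mathcomp Require Import measurable_realfun.
From mathcomp Require Import ring lra zify.
Import Order.TTheory GRing.Theory Num.Theory.
Import numFieldNormedType.Exports.

Local Open Scope classical_set_scope.
Local Open Scope ring_scope.

Set Implicit Arguments.
Unset Strict Implicit.
Unset Printing Implicit Defensive.

(** * The Euclidean norm and Borel sets *)

Section euclidean_norm.
Context {R : realType}.

(** The density in a chart is merely integrable, so its blow-ups are controlled only almost
    everywhere and along a subsequence; this subsequence has to serve all charts and all radii at
    once, whence a countable atlas and a diagonal extraction. Charts are total functions constrained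
    only on their domains and [M] is not assumed Borel, so measurability of [M] must be drawn from
    the atlas before anything is integrated over it. The exponent [-1/m] is the one for which
    [n t^m = 1]: the mean number of sample points in a set of size [t] then tends to a volume, and
    the probability that none falls in it to the exponential of minus this volume. Once tangent
    plane and density are normalized, the centre [x] survives only as a factor [s > 0] on the
    truncation radius. This factor comes without any regularity in [x], but it is harmless because
    the radius finally tends to infinity. Truncation also leaves out pairs with a long edge, which
    no local limit sees; they are charged to the isolated points, whose frequency tends to 0 with
    growing radius. Finiteness of the constant is an outcome of the uniform bound. *)

Definition edot n (u v : 'rV[R]_n) : R := \sum_(i < n) u ord0 i * v ord0 i.

Lemma edotC n (u v : 'rV[R]_n) : edot u v = edot v u.
Proof. by apply: eq_bigr => i _; rewrite mulrC. Qed.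

Lemma edotDl n (u v w : 'rV[R]_n) : edot (u + v) w = edot u w + edot v w.
Proof. by rewrite -big_split; apply: eq_bigr => i _; rewrite mxE mulrDl. Qed.

Lemma edotZl n a (u v : 'rV[R]_n) : edot (a *: u) v = a * edot u v.
Proof. by rewrite mulr_sumr; apply: eq_bigr => i _; rewrite mxE mulrA. Qed.

Lemma edotNl n (u v : 'rV[R]_n) : edot (- u) v = - edot u v.
Proof. by rewrite -scaleN1r edotZl mulN1r. Qed.

Lemma edotE n (u : 'rV[R]_n) : edot u u = enorm u ^+ 2.
Proof.
rewrite sqr_sqrtr; last by apply: sumr_ge0 => i _; exact: sqr_ge0.
by apply: eq_bigr => i _; rewrite expr2.
Qed.

Lemma enorm_ge0 n (u : 'rV[R]_n) : 0 <= enorm u.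
Proof. exact: sqrtr_ge0. Qed.

Lemma enorm_sqB n (u v : 'rV[R]_n) :
  enorm (u - v) ^+ 2 = enorm u ^+ 2 + enorm v ^+ 2 - 2 * edot u v.
Proof.
rewrite -!edotE edotDl edotNl (edotC u) (edotC v (u - v)) !edotDl !edotNl.
by rewrite (edotC v u); ring.
Qed.

Lemma coord_le_enorm n (u : 'rV[R]_n) i : `|u ord0 i| <= enorm u.
Proof.
rewrite -sqrtr_sqr ler_wsqrtr// (bigD1 i)//= lerDl.
by apply: sumr_ge0 => j _; exact: sqr_ge0.
Qed.

Lemma enorm0 n : enorm (0 : 'rV[R]_n) = 0.
Proof.
by rewrite /enorm big1 ?sqrtr0// => i _; rewrite mxE expr0n.
Qed.

Lemma enorm_eq0 n (u : 'rV[R]_n) : (enorm u == 0) = (u == 0).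
Proof.
apply/eqP/eqP => [u0|->]; last exact: enorm0.
apply/rowP => i; rewrite mxE; apply/eqP; rewrite -normr_le0 -u0.
exact: coord_le_enorm.
Qed.

Lemma enormZ n a (u : 'rV[R]_n) : enorm (a *: u) = `|a| * enorm u.
Proof.
rewrite /enorm -(sqrtr_sqr a) -sqrtrM ?sqr_ge0// mulr_sumr.
by congr Num.sqrt; apply: eq_bigr => i _; rewrite mxE exprMn.
Qed.

Lemma enormN n (u : 'rV[R]_n) : enorm (- u) = enorm u.
Proof. by rewrite -scaleN1r enormZ normrN1 mul1r. Qed.

Lemma enormBC n (u v : 'rV[R]_n) : enorm (u - v) = enorm (v - u).
Proof. by rewrite -enormN opprB. Qed.

Lemma edot_le n (u v : 'rV[R]_n) : edot u v <= enorm u * enorm v.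
Proof.
have [/eqP|v0] := eqVneq (enorm v) 0.
  rewrite enorm_eq0 => /eqP ->; rewrite enorm0 mulr0 edotC.
  by rewrite -[X in edot X](scale0r u) edotZl mul0r.
have vp : 0 < enorm v by rewrite lt_def v0 enorm_ge0.
suff : edot u v ^+ 2 <= (enorm u * enorm v) ^+ 2.
  have [H _|H] := lerP (edot u v) 0.
    by rewrite (le_trans H)// mulr_ge0 ?enorm_ge0.
  by rewrite ler_pXn2r// ?nnegrE ?mulr_ge0 ?enorm_ge0 ?(ltW H).
(* The squared norm equals [|v|^2 (|u|^2 |v|^2 - <u,v>^2)]; this is Cauchy-Schwarz after division by
   [|v|^2]. *)
have := sqr_ge0 (enorm (enorm v ^+ 2 *: u - edot u v *: v)).
rewrite enorm_sqB !enormZ !exprMn !real_normK ?num_real//.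
rewrite edotZl (edotC u (_ *: v)) edotZl (edotC v) => H.
have v2 : 0 < enorm v ^+ 2 by rewrite exprn_gt0.
by rewrite -(ler_pM2l v2); lra.
Qed.

Lemma ler_enormD n (u v : 'rV[R]_n) : enorm (u + v) <= enorm u + enorm v.
Proof.
rewrite -(@ler_pXn2r _ 2)// ?nnegrE ?addr_ge0 ?enorm_ge0//.
rewrite -[v in leLHS]opprK enorm_sqB enormN (edotC u) edotNl edotC.
have := edot_le u v; lra.
Qed.

Lemma ler_dist_enorm n (u v : 'rV[R]_n) :
  `|enorm u - enorm v| <= enorm (u - v).
Proof.
rewrite ler_norml; apply/andP; split.
  by have := ler_enormD (v - u) u; rewrite subrK enormBC; lra.
by have := ler_enormD (u - v) v; rewrite subrK; lra.
Qed.

Lemma norm_le_enorm n (u : 'rV[R]_n) : `|u| <= enorm u.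
Proof.
rewrite [leLHS]/Num.norm/= mx_normrE; apply/bigmax_leP; split.
  exact: enorm_ge0.
by move=> [i j] _ /=; rewrite (ord1 i); exact: coord_le_enorm.
Qed.

Lemma coord_le_norm n (u : 'rV[R]_n) i : `|u ord0 i| <= `|u|.
Proof.
rewrite [leRHS]/Num.norm/= mx_normrE; apply/bigmax_geP; right.
by exists (ord0, i).
Qed.

(** The factor [n] replaces the sharp square root of [n]: only the equivalence of the two norms
    matters later. *)
Lemma enorm_le_norm n (u : 'rV[R]_n) : enorm u <= n%:R * `|u|.
Proof.
rewrite -(@ler_pXn2r _ 2)// ?nnegrE ?mulr_ge0 ?enorm_ge0//.
rewrite -edotE exprMn (@le_trans _ _ (\sum_(i < n) `|u| ^+ 2))//.
  apply: ler_sum => i _; rewrite -expr2 -real_normK ?num_real//.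
  by rewrite ler_pXn2r ?nnegrE ?coord_le_norm.
rewrite sumr_const card_ord -[leLHS]mulr_natl ler_wpM2r ?sqr_ge0//.
by rewrite -natrX ler_nat; case: n {u} => // n; rewrite expnS leq_pmulr ?expn_gt0.
Qed.

Lemma enorm_continuous n : continuous (@enorm R n).
Proof.
move=> x; apply/(@cvgrPdist_le _ R^o _ (nbhs (x : 'rV[R]_n)) (nbhs_filter (x : 'rV[R]_n))) => e e0.
(* [n.+1] instead of [n] keeps the divisor positive in dimension 0. *)
have n0 : 0 < n.+1%:R :> R by [].
near=> y; apply: (le_trans (ler_dist_enorm _ _)).
apply: (le_trans (enorm_le_norm _)).
rewrite (@le_trans _ _ (n.+1%:R * `|x - y|))//.
  by rewrite ler_wpM2r// ler_nat.
rewrite mulrC -ler_pdivlMr//.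
by near: y; apply: cvgr_dist_le => //; rewrite divr_gt0.
Unshelve. all: by end_near. Qed.

Lemma measurable_enorm d (T : measurableType d) n (f : T -> 'rV[R]_n) :
  measurable_fun setT f -> measurable_fun setT (fun x => enorm (f x)).
Proof.
move=> /measurable_fun_rVP mf.
apply: (@measurableT_comp _ _ _ _ _ _ (@Num.sqrt R)).
  by apply: continuous_measurable_fun; exact: sqrt_continuous.
by apply: measurable_sum => i; apply: measurable_funX; exact: mf.
Qed.

End euclidean_norm.

Section borel_rV.
Context {R : realType}.

(** These balls are those of the sup norm, hence boxes, hence measurable for the sigma-algebra
    generated by the coordinates. *)
Lemma measurable_ball_rV n (x : 'rV[R]_n) e : measurable (ball x e).
Proof.
have [e0|e0] := ltP 0 e; last first.
  (* The empty ball is treated apart: in dimension 0 the box below is the whole space. *)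
  rewrite (_ : ball x e = set0) ?measurable0//; apply/seteqP; split => // y [].
  by rewrite ltNge e0.
have := @measurable_rV_box R n (fun i => ball (x ord0 i) e)
  (fun i => measurable_ball _ _).
rewrite (_ : mkset _ = ball x e)//.
apply/seteqP; split => [y xy|y [_ xy] i]; last exact: xy.
by split => // i j; rewrite (ord1 i); exact: xy.
Qed.

Lemma rat_dense_rV n (x : 'rV[R]_n) (e : R) : 0 < e ->
  exists q : 'rV[rat]_n, ball (map_mx ratr q : 'rV[R]_n) e x.
Proof.
move=> e0; have H i : exists q : rat, ball (ratr q : R) e (x ord0 i).
  have [|q] := @rat_in_itvoo R (x ord0 i - e) (x ord0 i + e); first by lra.
  rewrite in_itv /= => /andP[q1 q2]; exists q.
  by rewrite /ball/= ltr_norml; apply/andP; split; lra.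
have [q qP] := choice H; exists (\row_i q i); split => // i j.
by rewrite (ord1 i) !mxE; exact: qP.
Qed.

(** A countable base of the topology. It yields the measurability of open sets and, later, the
    extraction of a countable atlas. *)
Lemma rat_ball_rV n (O : set 'rV[R]_n) x : open O -> O x ->
  exists q : 'rV[rat]_n * nat,
    ball (map_mx ratr q.1 : 'rV[R]_n) (q.2.+1%:R^-1) x /\
    ball (map_mx ratr q.1 : 'rV[R]_n) (q.2.+1%:R^-1) `<=` O.
Proof.
move=> oO Ox; have /nbhs_ballP[e /= e0 eO] : nbhs x O by exact: open_nbhs_nbhs.
have [k ke] : exists k, k.+1%:R^-1 < e / 2.
  have /ltr_add_invr[k kP] : 0 < e / 2 by rewrite divr_gt0.
  by exists k; rewrite add0r in kP.
have [|q qx] := @rat_dense_rV n x k.+1%:R^-1; first by rewrite invr_gt0.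
exists (q, k); split => //= y qy; apply: eO; rewrite (splitr e).
apply: (@le_ball _ _ _ (k.+1%:R^-1 + k.+1%:R^-1)).
  by rewrite lerD// ltW.
by apply: ball_triangle qy; exact: ball_sym.
Qed.

Lemma open_measurable_rV n (O : set 'rV[R]_n) : open O -> measurable O.
Proof.
move=> oO.
pose B (q : 'rV[rat]_n * nat) := ball (map_mx ratr q.1 : 'rV[R]_n) (q.2.+1%:R^-1).
rewrite (_ : O = \bigcup_(q in [set q | B q `<=` O]) B q); last first.
  apply/seteqP; split=> [x Ox|x [q /= qO qx]]; last exact: qO.
  by have [q [qx qO]] := rat_ball_rV oO Ox; exists q.
rewrite bigcup_mkcond; apply: countable_bigcupT_measurable => [|q].
  exact: countableP.
by case: ifP => // _; exact: measurable_ball_rV.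
Qed.

Lemma continuous_on_measurable_coord n (O : set 'rV[R]_n) (f : 'rV[R]_n -> R) :
  open O -> (forall x, O x -> {for x, continuous f}) -> measurable_fun O f.
Proof.
move=> oO cf; apply: (measurability _ (RGenOpens.measurableE R)).
move=> _ [_ [a [b ->]] <-]; apply: open_measurable_rV.
rewrite openE => x [Ox fx]; apply: filterI; first exact: open_nbhs_nbhs.
apply: cf => //; apply: open_nbhs_nbhs; split => //.
Qed.

Lemma continuous_on_measurable_rV n k (O : set 'rV[R]_n)
    (f : 'rV[R]_n -> 'rV[R]_k) :
  open O -> (forall x, O x -> {for x, continuous f}) ->
  forall i, measurable_fun O (fun x => f x ord0 i).
Proof.
move=> oO cf i; apply: continuous_on_measurable_coord => // x Ox.
apply: (@continuous_comp _ _ _ f (fun v : 'rV[R]_k => v ord0 i)).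
  exact: cf.
exact: coord_continuous.
Qed.

Lemma continuous_measurable_rV n k (f : 'rV[R]_n -> 'rV[R]_k) :
  continuous f -> measurable_fun setT f.
Proof.
move=> cf; apply/measurable_fun_rVP => i.
by apply: continuous_on_measurable_rV ; [exact: (@openT 'rV[R]_n)|move=> x _; exact: cf].
Qed.

End borel_rV.

(** * Images of Lebesgue measure under linear maps *)

Section image_measure.
Context d1 d2 (T1 : measurableType d1) (T2 : measurableType d2) (R : realType).
Variables (mu : {measure set T1 -> \bar R}) (f : T1 -> T2).
Hypothesis mf : measurable_fun setT f.

Definition image_measure : {measure set T2 -> \bar R} :=
  measure_function_pushforward__canonical__measure_function_Measure mu mf.

Lemma image_measureE A : image_measure A = mu (f @^-1` A).
Proof. by []. Qed.

Lemma ge0_integral_image_measure (g : T2 -> \bar R) :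
  measurable_fun setT g -> (forall y, 0 <= g y)%E ->
  (\int[image_measure]_y g y = \int[mu]_x g (f x))%E.
Proof.
by move=> mg g0; rewrite ge0_integral_pushforward//= preimage_setT.
Qed.

End image_measure.

Section sigma_finite_copy.
Context d (T : measurableType d) (R : realType).
Variables (mu : {measure set T -> \bar R}) (h : sigma_finite setT mu).

(** The proof [h] is an argument so that a canonical instance can be keyed on it: this turns a
    measure known to be sigma-finite only by a lemma into a bundled one. *)
Definition sigma_finite_copy of sigma_finite setT mu : set T -> \bar R := mu.

HB.instance Definition _ := Measure.copy (sigma_finite_copy h) mu.

HB.instance Definition _ :=
  Measure_isSigmaFinite.Build _ _ _ (sigma_finite_copy h) h.

End sigma_finite_copy.

(** The product is defined by integrating x-sections; uniqueness of the product identifies it with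
    the measure that integrates y-sections. *)
Lemma product_measure_ysection d1 d2 (T1 : measurableType d1)
    (T2 : measurableType d2) (R : realType)
    (m1 : {sigma_finite_measure set T1 -> \bar R})
    (m2 : {sigma_finite_measure set T2 -> \bar R}) (E : set (T1 * T2)) :
  measurable E -> ((m1 \x m2) E = \int[m2]_y m1 (ysection E y))%E.
Proof.
move=> mE; rewrite (@product_measure_unique _ _ _ _ _ m1 m2 (m1 \x^ m2)%E)//.
by move=> A B mA mB; rewrite /= product_measure2E.
Qed.

Section rV_measure_unique.
Context {R : realType} (n : nat).

Definition rV_boxes : set (set 'rV[R]_n) :=
  [set B | exists2 A : 'I_n -> set R, (forall i, measurable (A i)) &
     B = [set v : 'rV[R]_n | forall i, A i (v ord0 i)]].

Lemma measurable_rV_boxes : measurable = <<s rV_boxes >>.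
Proof.
apply/seteqP; split; apply: smallest_sub; try exact: smallest_sigma_algebra.
  rewrite -bigcup_seq => _ [i _ [B mB <-]]; apply: sub_sigma_algebra.
  exists (fun j => if j == i then B else setT).
    by move=> j; case: ifP.
  apply/seteqP; split => [v [_ Bv] j /=|v /(_ i)] /=; last by rewrite eqxx.
  by case: ifPn => // /eqP ->.
move=> _ [A mA ->]; exact: measurable_rV_box.
Qed.

Definition rV_cube (k : R) : set 'rV[R]_n := [set v | forall i, `[- k, k]%classic (v ord0 i)].

Lemma rV_cubeE k v : 0 <= k -> rV_cube k v <-> `|v| <= k.
Proof.
move=> k0; split => [vk|vk i]; last first.
  by rewrite /= in_itv/= -ler_norml (le_trans _ vk)// coord_le_norm.
rewrite [leLHS]/Num.norm/= mx_normrE; apply/bigmax_leP; split => //.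
move=> [i j] _ /=; rewrite (ord1 i).
by have := vk j; rewrite /= in_itv/= -ler_norml.
Qed.

Lemma rV_cube_bigcup : \bigcup_k rV_cube k%:R = setT.
Proof.
apply/seteqP; split => // v _; exists (Num.bound `|v|) => //.
by apply/rV_cubeE => //; rewrite ltW// archi_boundP.
Qed.

Lemma measurable_rV_cube k : measurable (rV_cube k).
Proof. exact: (@measurable_rV_box R n (fun=> `[-k, k]%classic)). Qed.

(** Boxes are stable under intersection, generate the sigma-algebra, and the cubes exhaust the space
    with finite mass. *)
Lemma rV_measure_unique (m1 m2 : {measure set 'rV[R]_n -> \bar R}) :
  (forall A : 'I_n -> set R, (forall i, measurable (A i)) ->
    m1 [set v | forall i, A i (v ord0 i)] =
    m2 [set v | forall i, A i (v ord0 i)]) ->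
  (forall k : nat, m1 (rV_cube k%:R) < +oo)%E ->
  forall A, measurable A -> m1 A = m2 A.
Proof.
move=> m12 moo; apply: (measure_unique rV_boxes (fun k => rV_cube k%:R)).
- exact: measurable_rV_boxes.
- move=> _ _ [A mA ->] [B mB ->]; exists (fun i => A i `&` B i).
    by move=> i; exact: measurableI.
  by apply/seteqP; split => [v [Av Bv] i|v AB]; split => // i; have [] := AB i.
- by move=> k; exists (fun=> `[-k%:R, k%:R]%classic).
- exact: rV_cube_bigcup.
- by move=> _ [A mA ->]; exact: m12.
- exact: moo.
Qed.

Lemma lebesgue_rV_cube k : 0 <= k ->
  lebesgue_rV n (rV_cube k) = ((2 * k) ^+ n)%:E.
Proof.
move=> k0; rewrite (@lebesgue_rV_box R n (fun=> `[-k, k]%classic))//.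
rewrite (eq_bigr (fun=> (2 * k)%:E)).
  by rewrite prodEFin prodr_const card_ord.
move=> i _; rewrite lebesgue_measure_itv/= lte_fin.
case: ltP => [_|kk]; first by rewrite -EFinB; congr EFin; ring.
by congr EFin; lra.
Qed.

Lemma lebesgue_rV_cube_lty (k : nat) : (lebesgue_rV n (rV_cube k%:R) < +oo)%E.
Proof. by rewrite lebesgue_rV_cube// ltry. Qed.

Lemma lebesgue_rV_bounded (A : set 'rV[R]_n) k : measurable A ->
  (forall v, A v -> `|v| <= k) -> (lebesgue_rV n A < +oo)%E.
Proof.
move=> mA Ak; apply: (@le_lt_trans _ _ (lebesgue_rV n (rV_cube `|k|))).
  apply: le_measure; rewrite ?inE//; first exact: measurable_rV_cube.
  by move=> v /Ak vk; apply/rV_cubeE => //; rewrite (le_trans vk)// ler_norm.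
by rewrite lebesgue_rV_cube// ltry.
Qed.

End rV_measure_unique.

Section lebesgue_affine.
Context {R : realType}.

Lemma lebesgue_affine1 (s c : R) (A : set (measurableTypeR R)) : 0 < s -> measurable A ->
  (s%:E * lebesgue_measure ((fun x => s * x + c)%R @^-1` A) = lebesgue_measure A)%E.
Proof.
move=> s0.
have mf : measurable_fun setT (fun x : measurableTypeR R => s * x + c : measurableTypeR R).
  by apply: measurable_funD => //; exact: measurable_funM.
have @sn : {nonneg R} := NngNum (ltW s0).
pose m := mscale sn (image_measure (@lebesgue_measure R) mf).
move=> mA; apply/esym; apply: (@lebesgue_measure_unique R m) => //.
move=> _ [[a b] _ <-]; transitivity (s%:E * lebesgue_measure (`]((a - c) / s)%R, ((b - c) / s)%R]%classic : set R))%E; last first.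
  congr (_ * lebesgue_measure _)%E; apply/esym; apply/seteqP; split => x /=; rewrite !in_itv/= ltr_pdivrMr// ler_pdivlMr//.
    by move=> /andP[? ?]; apply/andP; split; lra.
  by move=> /andP[? ?]; apply/andP; split; lra.
rewrite !lebesgue_measure_itv/= !lte_fin ltr_pM2r ?invr_gt0// ltrD2r.
case: ifPn => _; last by rewrite mule0.
by rewrite -!EFinB -EFinM; congr EFin; field; rewrite gt_eqF.
Qed.

Lemma measurable_affine_rV n (s : R) (c : 'rV[R]_n) :
  measurable_fun setT (fun v : 'rV[R]_n => s *: v + c).
Proof.
apply/measurable_fun_rVP => i.
rewrite (_ : (fun _ => _) = (fun v : 'rV[R]_n => s * v ord0 i + c ord0 i)).
  apply: measurable_funD => //; apply: measurable_funM => //.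
  exact: measurable_rV_coord.
by apply/funext => v; rewrite !mxE.
Qed.

Lemma lebesgue_rV_affine n (s : R) c (A : set 'rV[R]_n) : 0 < s -> measurable A ->
  ((s ^+ n)%:E * lebesgue_rV n ((fun v => s *: v + c)%R @^-1` A) = lebesgue_rV n A)%E.
Proof.
move=> s0 mA.
have @sn : {nonneg R} := NngNum (exprn_ge0 n (ltW s0)).
pose m := mscale sn (image_measure (lebesgue_rV n) (measurable_affine_rV s c)).
apply/esym; apply: (@rV_measure_unique R n (lebesgue_rV n) m) => //; last first.
  exact: lebesgue_rV_cube_lty.
move=> {mA}{}A mA.
transitivity (\prod_(i < n) @lebesgue_measure R (A i))%E; first exact: lebesgue_rV_box.
transitivity ((s ^+ n)%:E * lebesgue_rV n
    [set v | forall i, ((fun x => s * x + c ord0 i)%R @^-1` A i) (v ord0 i)])%E; last first.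
  congr (_ * lebesgue_rV n _)%E.
  by apply/seteqP; split => v /= Av i; have := Av i; rewrite !mxE.
transitivity ((s ^+ n)%:E * \prod_(i < n) @lebesgue_measure R
    ((fun x => s * x + c ord0 i)%R @^-1` A i))%E; last first.
  congr (_ * _)%E; apply/esym; apply: lebesgue_rV_box.
  move=> i; rewrite -[X in measurable X]setTI.
  suff : measurable_fun setT (fun x : measurableTypeR R => s * x + c ord0 i : measurableTypeR R).
    by move=> /(_ measurableT _ (mA i)).
  by apply: measurable_funD => //; exact: measurable_funM.
have -> : (s ^+ n)%:E = (\prod_(i < n) s%:E)%E.
  by rewrite prodEFin prodr_const card_ord.
rewrite -big_split/=; apply: eq_bigr => i _.
have := @lebesgue_affine1 s (c ord0 i) (A i) s0 (mA i); move=> ->.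
exact: erefl.
Qed.

Lemma lebesgue_rV_shift n c (A : set 'rV[R]_n) : measurable A ->
  lebesgue_rV n ((fun v => v + c)%R @^-1` A) = lebesgue_rV n A.
Proof.
move=> mA; rewrite -[RHS](@lebesgue_rV_affine _ 1 c)// expr1n mul1e.
by congr (lebesgue_rV n _); apply/seteqP; split => v /=; rewrite scale1r.
Qed.

End lebesgue_affine.

Section linear_image.
Context {R : realType} (n : nat).
Local Notation lam := (@lebesgue_rV R n).

Lemma measurable_addrV d (T : measurableType d) (f g : T -> 'rV[R]_n) :
  measurable_fun setT f -> measurable_fun setT g ->
  measurable_fun setT (fun x => f x + g x).
Proof.
move=> /measurable_fun_rVP mf /measurable_fun_rVP mg; apply/measurable_fun_rVP => i.
rewrite (_ : (fun _ => _) = (fun x => f x ord0 i + g x ord0 i)).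
  by apply: measurable_funD; [exact: mf|exact: mg].
by apply/funext => x; rewrite mxE.
Qed.

Lemma measurable_subrV d (T : measurableType d) (f g : T -> 'rV[R]_n) :
  measurable_fun setT f -> measurable_fun setT g ->
  measurable_fun setT (fun x => f x - g x).
Proof.
move=> /measurable_fun_rVP mf /measurable_fun_rVP mg; apply/measurable_fun_rVP => i.
rewrite (_ : (fun _ => _) = (fun x => f x ord0 i - g x ord0 i)).
  by apply: measurable_funB; [exact: mf|exact: mg].
by apply/funext => x; rewrite !mxE.
Qed.

(* Fubini on {(x, y) | B y, A (x + y)}, sheared by y |-> y - x *)
Lemma shift_invariant_unique (nu : {sigma_finite_measure set 'rV[R]_n -> \bar R}) :
  (forall c (A : set 'rV[R]_n), measurable A ->
    nu ((fun v : 'rV[R]_n => v + c) @^-1` A) = nu A) ->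
  forall A B : set 'rV[R]_n, measurable A -> measurable B ->
  (nu A * lam B = lam A * nu ((-%R : 'rV[R]_n -> _) @^-1` B))%E.
Proof.
move=> nuS A B mA mB.
pose E1 : set ('rV[R]_n * 'rV[R]_n) := [set p | B p.2 /\ A (p.1 + p.2)].
pose E2 : set ('rV[R]_n * 'rV[R]_n) := [set p | B (p.2 - p.1) /\ A p.2].
have mE1 : measurable E1.
  apply: measurableI; rewrite -[X in measurable X]setTI.
    exact: (@measurable_snd _ _ 'rV[R]_n 'rV[R]_n).
  exact: (measurable_addrV measurable_fst measurable_snd).
have mE2 : measurable E2.
  apply: measurableI; rewrite -[X in measurable X]setTI.
    exact: (measurable_subrV measurable_snd measurable_fst).
  exact: (@measurable_snd _ _ 'rV[R]_n 'rV[R]_n).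
have E12 : ((nu \x lam) E1 = (nu \x lam) E2)%E.
  apply: eq_integral => x _ /=.
  rewrite -(@lebesgue_rV_shift R n x (xsection E2 x)).
    congr (lebesgue_rV n _); apply/seteqP; split => y;
      by rewrite /xsection/= !inE /E1 /E2/= addrK (addrC x).
  exact: measurable_xsection.
move: E12; rewrite !product_measure_ysection//.
have -> : (\int[lam]_y nu (ysection E1 y) = nu A * lam B)%E.
  rewrite -[in RHS](setIT B) -integral_indic// -ge0_integralZl//; last first.
    by apply/measurable_EFinP; exact: measurable_indic.
  apply: eq_integral => y _; rewrite indicE.
  have [yB|yB] := boolP (y \in B).
    rewrite mule1 -(nuS y A)//; congr (nu _).
    apply/seteqP; split => x; rewrite /ysection/= !inE /E1/=; first by case.
    by move=> Ax; split => //; rewrite inE in yB.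
  rewrite mule0 (_ : ysection _ _ = set0) ?measure0//.
  apply/seteqP; split => x //; rewrite /ysection/= !inE /E1/= => -[By _].
  by move: yB; rewrite notin_setE.
have -> : (\int[lam]_y nu (ysection E2 y) =
    lam A * nu ((-%R : 'rV[R]_n -> _) @^-1` B))%E.
  rewrite muleC -[in RHS](setIT A) -integral_indic// -ge0_integralZl//; last first.
    by apply/measurable_EFinP; exact: measurable_indic.
  apply: eq_integral => y _; rewrite indicE.
  have [yA|yA] := boolP (y \in A).
    rewrite mule1 -(nuS y); last exact: measurable_ysection.
    congr (nu _).
    apply/seteqP; split => x; rewrite /ysection/= !inE /E2/= opprD addrCA subrr addr0.
      by case.
    by move=> Ax; split => //; rewrite inE in yA.
  rewrite mule0 (_ : ysection _ _ = set0) ?measure0//.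
  apply/seteqP; split => x //; rewrite /ysection/= !inE /E2/= => -[_ By].
  by move: yA; rewrite notin_setE.
by [].
Qed.

End linear_image.

Section linear_image_lebesgue.
Context {R : realType}.

Lemma mulmx_norm_bound a b (M : 'M[R]_(a, b)) :
  exists2 C, 0 <= C & forall v : 'rV[R]_a, `|v *m M| <= C * `|v|.
Proof.
exists (\sum_i \sum_j `|M i j|).
  by apply: sumr_ge0 => i _; apply: sumr_ge0.
move=> v; rewrite [leLHS]/Num.norm/= mx_normrE; apply/bigmax_leP; split.
  by rewrite mulr_ge0//; apply: sumr_ge0 => i _; apply: sumr_ge0.
move=> [i j] _ /=; rewrite (ord1 i) mxE (le_trans (ler_norm_sum _ _ _))//.
rewrite mulr_suml; apply: ler_sum => k _; rewrite normrM mulrC.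
rewrite ler_pM//; last exact: coord_le_norm.
by rewrite (bigD1 j)//= lerDl sumr_ge0.
Qed.

Lemma mulmx_continuous a b (M : 'M[R]_(a, b)) :
  continuous ((fun v => v *m M) : 'rV[R]_a -> 'rV[R]_b).
Proof.
have [C C0 CM] := mulmx_norm_bound M.
move=> x; apply/(@cvgrPdist_le _ 'rV[R]_b _ (nbhs (x : 'rV[R]_a)) (nbhs_filter (x : 'rV[R]_a))) => e e0.
have C1 : 0 < C + 1 by rewrite ltr_pwDr.
near=> y; rewrite -mulmxBl (le_trans (CM _))// (@le_trans _ _ ((C + 1) * `|x - y|))//.
  by rewrite ler_wpM2r// lerDl.
rewrite mulrC -ler_pdivlMr//.
by near: y; apply: cvgr_dist_le => //; rewrite divr_gt0.
Unshelve. all: by end_near. Qed.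

Lemma measurable_mulmx a b (M : 'M[R]_(a, b)) :
  measurable_fun setT ((fun v => v *m M) : 'rV[R]_a -> 'rV[R]_b).
Proof. by apply: (@continuous_measurable_rV R a b); exact: mulmx_continuous. Qed.

Variable n : nat.
Local Notation lam := (@lebesgue_rV R n).

(** The image of Lebesgue measure under [M] is invariant by translations, hence proportional to it.
    No determinant appears, since only the existence of a positive factor is used. *)
Lemma lebesgue_rV_linear (M : 'M[R]_n) : M \in unitmx ->
  exists2 c : R, 0 < c & forall A : set 'rV[R]_n, measurable A ->
    lam ((fun v => v *m M) @^-1` A) = (c%:E * lam A)%E.
Proof.
move=> uM.
pose nu := image_measure lam (measurable_mulmx M).
have [C C0 CM] := mulmx_norm_bound (invmx M).
have nu_bnd (A : set 'rV[R]_n) k : measurable A -> (forall v, A v -> `|v| <= k) -> (nu A < +oo)%E.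
  move=> mA Ak; apply: (@lebesgue_rV_bounded _ _ _ (C * k)).
    by rewrite -[X in measurable X]setTI; exact: measurable_mulmx.
  move=> v /= /Ak vk; rewrite -[v](mulmxK uM) (le_trans (CM _))//.
  by rewrite ler_wpM2l.
have nu_cube (k : nat) : (nu (rV_cube (n:=n) k%:R) < +oo)%E.
  apply: (nu_bnd _ k%:R); first exact: measurable_rV_cube.
  by move=> v /rV_cubeE ->.
have nusf : sigma_finite setT nu.
  exists (fun k : nat => rV_cube k%:R); first by rewrite rV_cube_bigcup.
  by move=> k; split; [exact: measurable_rV_cube|exact: nu_cube].
have nuS c (A : set 'rV[R]_n) : measurable A ->
    nu ((fun v : 'rV[R]_n => v + c) @^-1` A) = nu A.
  move=> mA; rewrite /nu !image_measureE -[RHS](lebesgue_rV_shift (c *m invmx M)).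
    congr (lebesgue_rV n _); apply/seteqP; split => v /=;
      by rewrite mulmxDl mulmxKV.
  by rewrite -[X in measurable X]setTI; exact: measurable_mulmx.
(* The centred unit cube has volume 1 and is its own opposite, so the uniqueness identity reads
   [nu A = lam A * nu Q] and the factor is [nu Q]. *)
pose Q : set 'rV[R]_n := rV_cube 2^-1.
have mQ : measurable Q by exact: measurable_rV_cube.
have lQ : lam Q = 1%E.
  by rewrite /Q lebesgue_rV_cube ?invr_ge0// divff// expr1n.
have QN : (-%R : 'rV[R]_n -> _) @^-1` Q = Q.
  apply/seteqP; split => v /=.
    by move/rV_cubeE; rewrite normrN => H; apply/rV_cubeE; [|apply: H].
  by move/rV_cubeE => H; apply/rV_cubeE; rewrite ?normrN//; apply: H.
have H A : measurable A -> nu A = (lam A * nu Q)%E.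
  move=> mA; have := @shift_invariant_unique R n (sigma_finite_copy nusf) nuS A Q mA mQ.
  by rewrite lQ QN mule1.
have nuQoo : (nu Q < +oo)%E.
  by apply: (nu_bnd _ 2^-1) => // v /rV_cubeE; apply.
have nuQ : nu Q = (fine (nu Q))%:E by rewrite fineK// ge0_fin_numE.
exists (fine (nu Q)); last first.
  by move=> A mA; rewrite -nuQ muleC -H.
(* If [nu Q] vanished, so would [nu setT], which is [lam setT], at least [lam Q = 1]. *)
rewrite lt_def fine_ge0// andbT; apply/eqP => Q0.
have := H setT measurableT; rewrite nuQ Q0 mule0 /nu image_measureE preimage_setT => T0.
have : (lam Q <= lam setT)%E by apply: le_measure; rewrite ?inE.
by rewrite T0 lQ lee_fin ler10.
Qed.

End linear_image_lebesgue.

(** * Spheres, isometries and derivatives *)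

Section spheres.
Context {R : realType}.

(** Each line parallel to the first axis meets the sphere in at most two points. In dimension 0 the
    measure is a Dirac mass and the sphere of radius 0 has mass 1. *)
Lemma lebesgue_rV_sphere n (c : 'rV[R]_n) r : (0 < n)%N ->
  lebesgue_rV n [set v | enorm (v - c) = r] = 0%E.
Proof.
case: n c => // n c _.
set S := (X in lebesgue_rV _ X).
have mS : measurable S.
  rewrite (_ : S = setT `&` (fun v => enorm (v - c)) @^-1` [set r]); last first.
    by rewrite setTI.
  apply: (measurable_enorm _ measurableT) => //.
  by apply: measurable_subrV => //; exact: measurable_id.
have mp : measurable (@rV_cons R n @^-1` S).
  by rewrite -[X in measurable X]setTI; exact: measurable_rV_cons.
transitivity ((@lebesgue_measure R \x lebesgue_rV n) (@rV_cons R n @^-1` S))%E => //.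
have := @product_measure_ysection _ _ _ _ _ (@lebesgue_measure R) (lebesgue_rV n) _ mp.
move=> ->; apply: integral0_eq => u _.
pose q := r ^+ 2 - \sum_(i < n) (u ord0 i - c ord0 (lift ord0 i)) ^+ 2.
apply: countable_lebesgue_measure0.
apply: (@sub_countable _ _ _ [set c ord0 ord0 + Num.sqrt q; c ord0 ord0 - Num.sqrt q]).
  apply: subset_card_le => x; rewrite /ysection/= inE /S/= => xr.
  have : (x - c ord0 ord0) ^+ 2 = q.
    have subE (v w : 'rV[R]_n.+1) i : (v - w) ord0 i = v ord0 i - w ord0 i.
      by rewrite !mxE.
    rewrite /q -xr -edotE /edot big_ord_recl subE rV_cons0 -expr2.
    under eq_bigr do rewrite subE rV_consS -expr2.
    by rewrite addrK.
  move=> xq; have : `|x - c ord0 ord0| = Num.sqrt q by rewrite -xq sqrtr_sqr.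
  have [h|h] := lerP 0 (x - c ord0 ord0).
    by rewrite ger0_norm// => <-; left; rewrite addrC subrK.
  by rewrite ltr0_norm// => <-; right; rewrite opprK addrC subrK.
by apply: finite_set_countable; exact: finite_set2.
Qed.

End spheres.

Section cholesky.
Context {R : rcfType}.

(** Induction on the size: after splitting off the first coordinate, the Schur complement
    [S' = C - b^T b / a] is again symmetric and positive definite. *)
Lemma cholesky m (S : 'M[R]_m) : S^T = S ->
  (forall u : 'rV[R]_m, u != 0 -> 0 < (u *m S *m u^T) ord0 ord0) ->
  exists T : 'M[R]_m, S = T *m T^T.
Proof.
elim: m S => [|m IH] S symS posS; first by exists 0; apply/matrixP => -[].
have {}IH := IH.
pose S1 : 'M[R]_(1 + m) := S.
pose a := ulsubmx S1 ord0 ord0.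
pose b : 'rV[R]_m := ursubmx S1.
pose C := drsubmx S1.
have S1E : S1 = block_mx a%:M b b^T C.
  rewrite -[S1]submxK; congr block_mx.
    by rewrite [ulsubmx S1]mx11_scalar.
  by rewrite /b trmx_ursub; congr dlsubmx; exact: esym symS.
have qE (x : 'rV[R]_1) (u : 'rV[R]_m) :
    row_mx x u *m S1 *m (row_mx x u)^T =
    (x *m a%:M + u *m b^T) *m x^T + (x *m b + u *m C) *m u^T.
  by rewrite S1E mul_row_block tr_row_mx mul_row_col.
have posS1 (u : 'rV[R]_(1 + m)) : u != 0 -> 0 < (u *m S1 *m u^T) ord0 ord0.
  exact: posS.
have a0 : 0 < a.
  have := posS1 (row_mx 1%:M 0); rewrite qE.
  rewrite trmx0 mulmx0 addr0 mul0mx addr0 mul1mx trmx1 mulmx1 mxE eqxx mulr1n.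
  apply; apply/eqP => /(congr1 lsubmx); rewrite row_mxKl => /matrixP/(_ ord0 ord0).
  by rewrite !mxE eqxx => /eqP; rewrite oner_eq0.
pose S' := C - a^-1 *: (b^T *m b).
have S'T : S'^T = S'.
  rewrite /S' linearB/= linearZ/= trmx_mul trmxK; congr (_ - _).
  by rewrite /C trmx_drsub; congr drsubmx; exact: symS.
have S'pos (u : 'rV[R]_m) : u != 0 -> 0 < (u *m S' *m u^T) ord0 ord0.
  (* This [x] minimizes the quadratic form of [S] over the first coordinate; the minimum is the form
     of [S'] at [u]. *)
  move=> u0; pose x : 'rV[R]_1 := - (a^-1 *: (u *m b^T)).
  have := posS1 (row_mx x u); rewrite qE.
  have -> : x *m a%:M + u *m b^T = 0.
    rewrite /x mul_mx_scalar scalerN scalerA divff ?gt_eqF// scale1r addrC.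
    by rewrite subrr.
  rewrite mul0mx add0r.
  have -> : x *m b + u *m C = u *m S'.
    by rewrite /x /S' mulmxBr mulNmx -scalemxAl -scalemxAr mulmxA addrC.
  apply; apply: contra u0 => /eqP xu0; apply/eqP.
  by rewrite -[u](row_mxKr x) xu0; apply/matrixP => i j; rewrite !mxE.
have [T' T'E] := IH _ S'T S'pos.
pose T0 : 'M[R]_(1 + m) :=
  block_mx (Num.sqrt a)%:M 0 ((Num.sqrt a)^-1 *: b^T) T'.
suff H : S1 = T0 *m T0^T by exists T0; exact: H.
rewrite S1E /T0 tr_block_mx mulmx_block.
have sa : Num.sqrt a * Num.sqrt a = a by rewrite -expr2 sqr_sqrtr// ltW.
have sa0 : Num.sqrt a != 0 by rewrite gt_eqF// sqrtr_gt0.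
congr block_mx.
- by rewrite trmx0 mulmx0 addr0 tr_scalar_mx -scalar_mxM sa.
- by rewrite mul0mx addr0 linearZ/= trmxK mul_scalar_mx scalerA divff// scale1r.
- by rewrite tr_scalar_mx mul_mx_scalar scalerA divff// scale1r trmx0 mulmx0 addr0.
- rewrite -T'E /S' linearZ/= trmxK -scalemxAl -scalemxAr scalerA -invfM sa.
  by rewrite addrCA subrr addr0.
Qed.

End cholesky.

Section isometry.
Context {R : realType}.

Lemma enorm_mulmx m d (A : 'M[R]_(m, d)) (u : 'rV[R]_m) :
  enorm (u *m A) ^+ 2 = (u *m (A *m A^T) *m u^T) ord0 ord0.
Proof.
rewrite -edotE mulmxA -mulmxA -trmx_mul mxE; apply: eq_bigr => i _.
by congr (_ * _); rewrite [RHS]mxE.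
Qed.

(** Cholesky applied to the Gram matrix [A A^T]; [T] is invertible since it has the same kernel as
    [A]. This replaces the tangent plane in dimension [d] by the Euclidean space of dimension
    [m]. *)
Lemma isometric_square m d (A : 'M[R]_(m, d)) :
  (forall u : 'rV[R]_m, u *m A = 0 -> u = 0) ->
  exists2 T : 'M[R]_m, T \in unitmx & forall u : 'rV[R]_m, enorm (u *m T) = enorm (u *m A).
Proof.
move=> injA; have [|u u0|T AT] := @cholesky R m (A *m A^T).
- by rewrite trmx_mul trmxK.
- rewrite -enorm_mulmx exprn_gt0// lt_def enorm_ge0 andbT enorm_eq0.
  by apply: contra u0 => /eqP /injA ->.
have TA u : enorm (u *m T) = enorm (u *m A).
  apply/eqP; rewrite -(@eqrXn2 _ 2)// ?enorm_ge0//; apply/eqP.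
  by rewrite !enorm_mulmx AT.
exists T => //; rewrite -row_free_unit -kermx_eq0; apply/eqP/row_matrixP => i.
rewrite row0; apply: injA; apply/eqP; rewrite -enorm_eq0 -TA enorm_eq0.
by rewrite -row_mul mulmx_ker row0.
Qed.

End isometry.

Section gateaux.
Context {R : realType}.

Lemma subrV_coord n (v w : 'rV[R]_n) i : (v - w) ord0 i = v ord0 i - w ord0 i.
Proof. by rewrite !mxE. Qed.

Lemma is_derive_line n (F : 'rV[R]_n -> R) p v s :
  derivable F (p + s *: v) v ->
  is_derive s 1 (fun t : R => F (p + t *: v)) ('D_v F (p + s *: v)).
Proof.
move=> dF; pose G (t : R) := F (p + t *: v).
have E : (fun h : R => h^-1 *: ((G \o shift s) (h *: 1) - G s)) =
    (fun h => h^-1 *: ((F \o shift (p + s *: v)) (h *: v) - F (p + s *: v))).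
  apply/funext => h; rewrite /G /=; congr (_ *: (F _ - _)).
  by rewrite addrCA; congr (_ + _); rewrite -scalerDl [h *: 1]mulr1.
split; first by rewrite /derivable E.
by rewrite /derive E.
Qed.

(** [class_C] speaks of partial derivatives only. Their continuity yields differentiability: go from
    [x] to [x + h] one coordinate at a time and apply the mean value theorem on each segment. *)
Lemma class_C1_diff a b (O : set 'rV[R]_a) (f : 'rV[R]_a -> 'rV[R]_b) x :
  open O -> class_C 1 O f -> O x ->
  exists A : 'M[R]_(a, b), forall e : R, 0 < e -> exists2 r : R, 0 < r &
    forall h : 'rV[R]_a, `|h| < r -> `|f (x + h) - f x - h *m A| <= e * `|h|.
Proof.
move=> oO [_ df] Ox.
exists (\matrix_(i, j) ('D_(delta_mx ord0 i) f x) ord0 j) => e e0.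
(* Each of the [a] segments may cost [e' |h|]; [a.+1] avoids a division by 0. *)
pose e' := e / a.+1%:R.
have e'0 : 0 < e' by rewrite divr_gt0.
have [r1 r10 r1O] : exists2 r : R, 0 < r & forall y, `|x - y| < r -> O y.
  have /nbhs_ballP[r /= r0 rO] : nbhs x O by exact: open_nbhs_nbhs.
  by exists r => // y xy; apply: rO; rewrite -ball_normE.
have [r2 r20 r2P] : exists2 r : R, 0 < r & forall y, `|x - y| < r -> forall i,
    `|'D_(delta_mx ord0 i) f x - 'D_(delta_mx ord0 i) f y| <= e'.
  have : \forall y \near x, forall i : 'I_a,
    `|'D_(delta_mx ord0 i) f x - 'D_(delta_mx ord0 i) f y| <= e'.
    apply: (@filter_forall _ _ _ _ (nbhs_filter (x : 'rV[R]_a))) => i; have [_ [cD _]] := df i.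
    exact: (proj1 (@cvgrPdist_le _ 'rV[R]_b _ (nbhs (x : 'rV[R]_a)) (nbhs_filter (x : 'rV[R]_a)) _ _) (cD x Ox) e' e'0).
  move=> /nbhs_ballP[r /= r0 rO].
  by exists r => // y xy; apply: rO; rewrite -ball_normE.
exists (Num.min r1 r2); first by rewrite lt_min r10.
move=> h hr.
(* The [k]-th vertex of the path: the first [k] coordinates are those of [x + h], the others those
   of [x]. *)
pose p (k : nat) : 'rV[R]_a := x + \row_(i < a) (if (i < k)%N then h ord0 i else 0).
have p0 : p 0%N = x by apply/rowP => i; rewrite !mxE ltn0 addr0.
have pa : p a = x + h by apply/rowP => i; rewrite !mxE ltn_ord.
rewrite [leLHS]/Num.norm/= mx_normrE; apply/bigmax_leP; split.
  by rewrite mulr_ge0// ltW.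
move=> [i0 j] _ /=; rewrite (ord1 i0) {i0}.
have step (k : 'I_a) : `|f (p k.+1) ord0 j - f (p k) ord0 j -
    h ord0 k * ('D_(delta_mx ord0 k) f x) ord0 j| <= e' * `|h|.
  pose v : 'rV[R]_a := delta_mx ord0 k.
  pose F (y : 'rV[R]_a) : R := f y ord0 j.
  pose g (t : R) : R := F (p k + t *: v).
  have g0 : g 0 = f (p k) ord0 j by rewrite /g scale0r addr0.
  have gh : g (h ord0 k) = f (p k.+1) ord0 j.
    rewrite /g /F; congr (f _ _ _); apply/rowP => i; rewrite !mxE eqxx/= -addrA.
    congr (_ + _); have -> : (i < k.+1)%N = (i == k) || (i < k)%N by rewrite ltnS leq_eqVlt.
    have [->|ik] := eqVneq i k; first by rewrite ltnn mulr1 add0r.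
    by rewrite mulr0 addr0.
  have qn (t : R) : `|t| <= `|h ord0 k| -> `|x - (p k + t *: v)| <= `|h|.
    move=> th; rewrite [leLHS]/Num.norm/= mx_normrE; apply/bigmax_leP; split => //.
    move=> [i1 i] _ /=; rewrite (ord1 i1) !mxE eqxx/= -addrA opprD addrA subrr add0r normrN.
    have [->|ik] := eqVneq i k.
      by rewrite ltnn add0r mulr1 (le_trans th)// coord_le_norm.
    by rewrite mulr0 addr0; case: ifP; rewrite ?normr0// coord_le_norm.
  have qr (t : R) : `|t| <= `|h ord0 k| -> `|x - (p k + t *: v)| < Num.min r1 r2.
    by move=> /qn H; rewrite (le_lt_trans H).
  have dg (t : R) : `|t| <= `|h ord0 k| ->
      is_derive t (1 : R) g (('D_v f (p k + t *: v)) ord0 j).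
    move=> /qr; rewrite lt_min => /andP[/r1O Oq _].
    have [dfq _] := df k; have := dfq _ Oq => dfq'.
    have -> : ('D_v f (p k + t *: v)) ord0 j = 'D_v F (p k + t *: v).
      by rewrite (derive_mx dfq') mxE.
    by apply: is_derive_line; exact: (proj1 (derivable_mxP _ _ _) dfq' ord0 j).
  (* The two signs of [h ord0 k] are separated because the mean value theorem wants ordered
     endpoints. *)
  have [t th gE] : exists2 t, `|t| <= `|h ord0 k| & g (h ord0 k) - g 0 =
      ('D_v f (p k + t *: v)) ord0 j * h ord0 k.
    have [hk|hk] := lerP 0 (h ord0 k).
      have [||t] := @MVT_segment R g (fun t => ('D_v f (p k + t *: v)) ord0 j) 0 (h ord0 k) hk.
      - move=> t; rewrite in_itv/= => /andP[t0 t1]; apply: dg.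
        by rewrite !ger0_norm// ltW.
      - apply: derivable_within_continuous => t; rewrite in_itv/= => /andP[t0 t1].
        by have [|+ _] := dg t; first by rewrite !ger0_norm.
      - rewrite in_itv/= => /andP[t0 t1]; rewrite subr0 => ->; exists t => //.
        by rewrite !ger0_norm.
    have [||t] := @MVT_segment R g (fun t => ('D_v f (p k + t *: v)) ord0 j) (h ord0 k) 0 (ltW hk).
    - move=> t; rewrite in_itv/= => /andP[t0 t1]; apply: dg.
      by rewrite !ltr0_norm// lerN2 ltW.
    - apply: derivable_within_continuous => t; rewrite in_itv/= => /andP[t0 t1].
      by have [|+ _] := dg t; first by rewrite !ler0_norm ?lerN2// ltW.
    - rewrite in_itv/= => /andP[t0 t1] gE; exists t.
        by rewrite !ler0_norm ?lerN2// ltW.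
      by rewrite -opprB gE sub0r mulrN opprK.
  rewrite -gh -g0 gE mulrC -mulrBr normrM mulrC ler_pM//; last exact: coord_le_norm.
  have := qr _ th; rewrite lt_min => /andP[_ /r2P/(_ k)]; apply: le_trans.
  by rewrite -subrV_coord distrC coord_le_norm.
have fE : f (x + h) ord0 j - f x ord0 j =
    \sum_(k < a) (f (p k.+1) ord0 j - f (p k) ord0 j).
  rewrite -(big_mkord xpredT (fun k => f (p k.+1) ord0 j - f (p k) ord0 j)).
  by rewrite (telescope_sumr (fun k => f (p k) ord0 j))// pa p0.
rewrite !subrV_coord fE [X in _ - X]mxE -sumrB (le_trans (ler_norm_sum _ _ _))//.
apply: (@le_trans _ _ (\sum_(k < a) e' * `|h|)).
  by apply: ler_sum => k _; have := step k; rewrite mxE.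
rewrite sumr_const card_ord -mulr_natl mulrA ler_wpM2r// /e'.
by rewrite mulrCA ler_piMr ?(ltW e0)// ler_pdivrMr// mul1r ler_nat.
Qed.

End gateaux.

(** * Continuity of translations in L^1 *)

Section weighted_convergence.
Context d (T : measurableType d) {R : realType}.
Variables (mu : {measure set T -> \bar R}) (D : set T).
Hypothesis mD : measurable D.

(** Write [q_k h_k - q' h' = q_k (h_k - h') + (q_k - q') h']: the first term is bounded by the L^1
    distance, the second tends to 0 by dominated convergence. The weights will be geometric events,
    the functions [h_k] blown-up densities, which converge only in L^1. *)
Lemma L1_bounded_weight_cvg (q : nat -> T -> R) (q' : T -> R) (h : nat -> T -> R) (h' : T -> R) :
  (forall k, measurable_fun D (q k)) -> measurable_fun D q' ->
  (forall k x, D x -> `|q k x| <= 1) ->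
  {ae mu, forall x, D x -> q k x @[k --> \oo] --> q' x} ->
  (forall k, mu.-integrable D (EFin \o h k)) -> mu.-integrable D (EFin \o h') ->
  (\int[mu]_(x in D) `|h k x - h' x|%:E @[k --> \oo] --> 0)%E ->
  (\int[mu]_(x in D) (q k x * h k x)%:E @[k --> \oo] -->
    \int[mu]_(x in D) (q' x * h' x)%:E)%E.
Proof.
move=> mq mq' q1 qq' ih ih' hh'.
have mh k : measurable_fun D (h k) by apply/measurable_EFinP; exact: measurable_int (ih k).
have mh' : measurable_fun D h' by apply/measurable_EFinP; exact: measurable_int ih'.
have [] := @dominated_convergence _ _ _ mu D mD (fun k x => (q k x * h' x)%:E)
  (fun x => (q' x * h' x)%:E) (fun x => `|h' x|%:E).
- by move=> k; apply/measurable_EFinP; exact: measurable_funM.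
- by apply/measurable_EFinP; exact: measurable_funM.
- apply: filterS qq' => x + Dx => /(_ Dx) qx.
  by apply: cvg_EFin; [exact: nearW|apply: cvgMl].
- exact: integrable_norm.
- apply: aeW => x k Dx; rewrite abse_EFin lee_fin normrM ler_piMl//; exact: q1.
move=> iq' _ qh'.
have iqh k : mu.-integrable D (fun x => (q k x * (h k x - h' x))%:E).
  apply: (@le_integrable _ _ _ mu D mD _ (fun x => (h k x - h' x)%:E)).
  - by apply/measurable_EFinP; apply: measurable_funM => //; exact: measurable_funB.
  - by move=> x Dx; rewrite !abse_EFin lee_fin normrM ler_piMl// q1.
  - by apply: (eq_integrable mD) (integrableB mD (ih k) ih') => x _.
have iqh' k : mu.-integrable D (fun x => (q k x * h' x)%:E).
  apply: (@le_integrable _ _ _ mu D mD _ (fun x => (h' x)%:E)) => //.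
  - by apply/measurable_EFinP; apply: measurable_funM.
  - by move=> x Dx; rewrite !abse_EFin lee_fin normrM ler_piMl// q1.
have E k : (\int[mu]_(x in D) (q k x * h k x)%:E =
    \int[mu]_(x in D) (q k x * h' x)%:E + \int[mu]_(x in D) (q k x * (h k x - h' x))%:E)%E.
  rewrite -integralD//; apply: eq_integral => x _; rewrite -EFinD; congr EFin; ring.
rewrite (eq_cvg _ _ E).
have -> : (\int[mu]_(x in D) (q' x * h' x)%:E = \int[mu]_(x in D) (q' x * h' x)%:E + 0)%E.
  by rewrite adde0.
apply: cvgeD => //.
  by rewrite fin_num_adde_defl.
apply/cvg_abse0P; apply: (squeeze_cvge _ (cvg_cst 0%E) hh'); apply: nearW => k.
rewrite abse_ge0/= (le_trans (le_abse_integral _ _ _))//.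
  by case/integrableP : (iqh k).
apply: ge0_le_integral => //.
- by apply: measurableT_comp => //; case/integrableP : (iqh k).
- by apply/measurable_EFinP; apply: measurableT_comp => //; exact: measurable_funB.
- by move=> x Dx; rewrite abse_EFin lee_fin normrM ler_piMl// q1.
Qed.

End weighted_convergence.

Section translation_continuity.
Context {R : realType} (n : nat).
Local Notation lam := (@lebesgue_rV R n).
Local Notation V := 'rV[R]_n.

(** Makes the open sets a generating family stable under intersection, as the Dynkin argument below
    requires. *)
Lemma measurable_rV_open : @measurable _ V = <<s [set O : set V | open O] >>.
Proof.
apply/seteqP; split; last first.
  apply: smallest_sub => [|O /= oO]; last exact: open_measurable_rV.
  exact: sigma_algebra_measurable.
apply: smallest_sub; first exact: smallest_sigma_algebra.
rewrite -bigcup_seq => _ [i _ [B mB <-]]; rewrite setTI.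
pose G := [set B : set R | <<s [set O : set V | open O] >> ((fun x : V => x ord0 i) @^-1` B)].
suff : measurable `<=` G by apply; exact: mB.
have -> : (@measurable _ R) = <<s @RGenOpens.G R >> by exact: RGenOpens.measurableE.
apply: smallest_sub.
  split; rewrite /G /=.
  - by rewrite preimage_set0; exact: sigma_algebra0.
  - move=> A GA; rewrite setTD preimage_setC -setTD.
    by apply: sigma_algebraCD => //; exact: smallest_sigma_algebra.
  - move=> F GF; rewrite preimage_bigcup.
    by apply: sigma_algebra_bigcup => //; exact: smallest_sigma_algebra.
move=> _ [a [b ->]]; apply: sub_sigma_algebra => /=.
apply: open_comp; last exact: interval_open.
by move=> x _; exact: coord_continuous.
Qed.

Lemma integral_shift (c : V) (g : V -> \bar R) : measurable_fun setT g ->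
  (forall v, 0 <= g v)%E -> (\int[lam]_v g (v + c)%R = \int[lam]_v g v)%E.
Proof.
move=> mg g0.
have mc : measurable_fun setT (fun v : V => v + c).
  by apply: measurable_addrV => //; exact: measurable_id.
rewrite -(@ge0_integral_image_measure _ _ _ _ R lam _ mc)//.
apply: eq_measure_integral => A mA _; rewrite image_measureE.
exact: lebesgue_rV_shift.
Qed.

Definition L1_continuous (f : V -> R) := forall h : nat -> V, h @ \oo --> (0 : V) ->
  (\int[lam]_v `|f (v + h k)%R - f v|%:E @[k --> \oo] --> 0)%E.

Lemma measurable_shift (f : V -> R) c : measurable_fun setT f ->
  measurable_fun setT (fun v : V => f (v + c)).
Proof.
move=> mf; apply: (measurableT_comp mf).
by apply: measurable_addrV => //; exact: measurable_id.
Qed.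

Lemma measurable_distE (f g : V -> R) : measurable_fun setT f -> measurable_fun setT g ->
  measurable_fun setT (fun v => `|f v - g v|%:E).
Proof.
by move=> mf mg; apply/measurable_EFinP; apply: measurableT_comp => //; exact: measurable_funB.
Qed.

(** The usual three-term estimate: translating [f - g] does not change its L^1 norm, so two of the
    thirds come from the approximation and one from [g]. *)
Lemma L1_continuous_approx (f : V -> R) : measurable_fun setT f ->
  (forall e : R, 0 < e -> exists g, [/\ measurable_fun setT g, L1_continuous g &
    (\int[lam]_v `|f v - g v|%:E <= e%:E)%E]) -> L1_continuous f.
Proof.
move=> mf H h h0; apply/fine_cvgP.
have e3 (e : R) : 0 < e -> 0 < e / 3 by move=> e0; rewrite divr_gt0.
have K (e : R) : 0 < e -> \forall k \near \oo,
    (\int[lam]_v `|f (v + h k)%R - f v|%:E <= e%:E)%E.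
  move=> e0; have [g [mg Lg fg]] := H _ (e3 _ e0).
  have := Lg h h0 => /fine_cvgP[gfin /cvgrPdist_le/(_ _ (e3 _ e0)) gle].
  near=> k.
  apply: (@le_trans _ _ (\int[lam]_v (`|f (v + h k) - g (v + h k)|%:E +
      `|g (v + h k) - g v|%:E + `|f v - g v|%:E))%E).
    apply: ge0_le_integral => //.
    - by apply: measurable_distE => //; exact: measurable_shift.
    - apply: emeasurable_funD; last exact: measurable_distE.
      by apply: emeasurable_funD; apply: measurable_distE => //; exact: measurable_shift.
    - move=> v _; rewrite -!EFinD lee_fin (distrC (f v) (g v)).
      have -> : f (v + h k) - f v = (f (v + h k) - g (v + h k)) +
        (g (v + h k) - g v) + (g v - f v) by ring.
      by rewrite (le_trans (ler_normD _ _))// lerD2r ler_normD.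
  rewrite ge0_integralD//; last 3 first.
  - by move=> v _; rewrite adde_ge0.
  - by apply: emeasurable_funD; apply: measurable_distE => //; exact: measurable_shift.
  - exact: measurable_distE.
  rewrite ge0_integralD//; last 2 first.
  - by apply: measurable_distE => //; exact: measurable_shift.
  - by apply: measurable_distE => //; exact: measurable_shift.
  rewrite (integral_shift _ (g := fun v => `|f v - g v|%:E))//; last exact: measurable_distE.
  have -> : e = e / 3 + e / 3 + e / 3 by field.
  rewrite !EFinD !leeD//.
  rewrite -[leLHS]fineK; last by near: k.
  rewrite lee_fin; have : `|0 - fine (\int[lam]_v (`|g (v + h k)%R - g v|%:E))| <= e / 3.
    by near: k.
  by rewrite sub0r normrN; apply: le_trans; exact: ler_norm.
have F : \forall k \near \oo, (\int[lam]_v `|f (v + h k)%R - f v|%:E \is a fin_num)%E.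
  apply: filterS (K 1 ltr01) => k k1; rewrite ge0_fin_numE ?(le_lt_trans k1) ?ltry//.
  exact: integral_ge0.
split => //; apply/cvgrPdist_le => e e0; near=> k.
rewrite sub0r normrN ger0_norm ?fine_ge0 ?integral_ge0//.
rewrite -lee_fin fineK; first by near: k; exact: K.
by near: k.
Unshelve. all: by end_near. Qed.

Lemma L1_continuousD (a : R) (f g : V -> R) : measurable_fun setT f -> measurable_fun setT g ->
  L1_continuous f -> L1_continuous g -> L1_continuous (fun v => a * f v + g v).
Proof.
move=> mf mg Lf Lg h h0.
have : (`|a|%:E * \int[lam]_v `|f (v + h k)%R - f v|%:E +
    \int[lam]_v `|g (v + h k)%R - g v|%:E @[k --> \oo] --> `|a|%:E * 0 + 0)%E.
  apply: cvgeD; [by rewrite mule0| |exact: Lg].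
  by apply: cvgeZl => //; exact: Lf.
rewrite mule0 adde0; apply: (squeeze_cvge _ (cvg_cst 0%E)); apply: nearW => k.
rewrite integral_ge0//= -ge0_integralZl//; last by apply: measurable_distE => //; exact: measurable_shift.
rewrite -ge0_integralD//; last 2 first.
- by apply: measurable_funeM; apply: measurable_distE => //; exact: measurable_shift.
- by apply: measurable_distE => //; exact: measurable_shift.
apply: ge0_le_integral => //.
- have mag : measurable_fun setT (fun v => a * f v + g v).
    by apply: measurable_funD => //; exact: measurable_funM.
  by apply: measurable_distE => //; exact: (measurable_shift _ mag).
- apply: emeasurable_funD; [apply: measurable_funeM|];
    by apply: measurable_distE => //; exact: measurable_shift.
- move=> v _; rewrite -EFinM -EFinD lee_fin -normrM.
  have -> : a * f (v + h k) + g (v + h k) - (a * f v + g v) =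
    a * (f (v + h k) - f v) + (g (v + h k) - g v) by ring.
  exact: ler_normD.
Qed.

Lemma L1_continuous0 : L1_continuous (fun=> 0).
Proof.
move=> h _; have E (k : nat) : (\int[lam]_v `|(0 : R) - 0|%:E = 0)%E.
  by under eq_integral do rewrite subrr normr0; rewrite integral0.
by rewrite (eq_cvg _ _ E); exact: cvg_cst.
Qed.

(** Points entering [O] under the translation have the same total mass as points leaving it, so it
    suffices to treat the latter: each [v] of an open [O] satisfies [O (v + h k)] eventually. *)
Lemma L1_continuous_open (O : set V) : open O -> (lam O < +oo)%E -> L1_continuous \1_O.
Proof.
move=> oO lO h h0; have mO := open_measurable_rV oO.
have m1 : measurable_fun setT (\1_O : V -> R) by exact: measurable_indic.
have iO c : (\int[lam]_v (\1_O (v + c)%R : R)%:E = lam O)%E.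
  rewrite (integral_shift c (g := fun v => (\1_O v)%:E))//.
    by rewrite integral_indic// setIT.
  exact/measurable_EFinP.
pose b k (v : V) : R := \1_O v * (1 - \1_O (v + h k)).
have mb k : measurable_fun setT (b k).
  by apply: measurable_funM => //; apply: measurable_funB => //; exact: measurable_shift.
have b0 k v : 0 <= b k v.
  by rewrite /b !indicE; do 2 case: (_ \in _); rewrite /= ?subrr ?subr0 ?mulr0 ?mulr1.
(* |1_O(v + h) - 1_O(v)| + 1_O(v) = 2 b(v) + 1_O(v + h), and 1_O and its
   translate have the same integral *)
have E k : (\int[lam]_v `|\1_O (v + h k)%R - \1_O v|%:E = 2%:E * \int[lam]_v (b k v)%:E)%E.
  have H : (\int[lam]_v `|(\1_O (v + h k)%R : R) - \1_O v|%:E + lam O =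
      2%:E * \int[lam]_v (b k v)%:E + lam O)%E.
    rewrite -[in LHS](iO 0) -[in RHS](iO (h k)).
    rewrite -ge0_integralD//; last 2 first.
    - by apply: measurable_distE => //; exact: measurable_shift.
    - by apply/measurable_EFinP; exact: measurable_shift.
    rewrite -ge0_integralZl//; [|exact/measurable_EFinP|by move=> v _; rewrite lee_fin].
      rewrite -ge0_integralD//; last 3 first.
      - by move=> v _; rewrite mule_ge0// lee_fin.
      - by apply: measurable_funeM; apply/measurable_EFinP.
      - by apply/measurable_EFinP; exact: measurable_shift.
      apply: eq_integral => v _; rewrite -EFinM -!EFinD; congr EFin.
      rewrite /b addr0 !indicE; do 2 case: (_ \in _) => /=; rewrite ?subrr ?subr0 ?sub0r ?normrN ?normr0 ?normr1; ring.
  have lOf : lam O \is a fin_num by rewrite ge0_fin_numE.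
  by move: H => /(congr1 (fun x => x - lam O)%E); rewrite !addeK.
rewrite (eq_cvg _ _ E).
suff : (2%:E * \int[lam]_v (b k v)%:E @[k --> \oo] --> 2%:E * 0)%E by rewrite mule0.
apply: cvgeZl => //.
have [] := @dominated_convergence _ _ _ lam setT measurableT (fun k v => (b k v)%:E)
  (cst 0%E) (fun v => (\1_O v)%:E) => //.
- by move=> k; apply/measurable_EFinP.
- apply: aeW => v _; have [Ov|Ov] := pselect (O v); last first.
    apply: (@cvg_trans _ ((0%E : \bar R) @[k --> \oo])); last exact: cvg_cst.
    apply: near_eq_cvg; apply: nearW => k /=.
    by rewrite /b indicE memNset// mul0r.
  apply: (@cvg_trans _ ((0%E : \bar R) @[k --> \oo])); last exact: cvg_cst.
  apply: near_eq_cvg.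
  have : \forall k \near \oo, O (v + h k).
    have : v + h k @[k --> \oo] --> v.
      by rewrite -[X in _ --> X]addr0; apply: cvgD => //; exact: cvg_cst.
    by apply; exact: open_nbhs_nbhs.
  by apply: filterS => k Ok; rewrite /b !indicE !mem_set//= subrr mulr0.
- apply/integrableP; split; first by apply/measurable_EFinP.
  under eq_integral do rewrite gee0_abs ?lee_fin//.
  by rewrite integral_indic// setIT.
- apply: aeW => v k _; rewrite abse_EFin lee_fin ger0_norm// /b.
  by rewrite !indicE; do 2 case: (_ \in _); rewrite /= ?subrr ?subr0 ?mulr0 ?mulr1.
- by move=> _ _; rewrite integral0.
Qed.

Lemma L1_continuous_bigcup (G : nat -> set V) :
  (forall j, measurable (G j)) -> nondecreasing_seq G ->
  (lam (\bigcup_j G j) < +oo)%E ->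
  (forall j, L1_continuous \1_(G j)) -> L1_continuous \1_(\bigcup_j G j).
Proof.
move=> mG ndG finG LG; have mU : measurable (\bigcup_j G j) by exact: bigcup_measurable.
apply: L1_continuous_approx; first exact: measurable_indic.
move=> e e0.
have finU : lam (\bigcup_j G j) \is a fin_num by rewrite ge0_fin_numE.
have : (lam \o G) x @[x --> \oo] --> (fine (lam (\bigcup_j G j)))%:E.
  by rewrite (fineK finU); exact: nondecreasing_cvg_mu.
move=> /fine_cvgP[_ /cvgrPdist_le/(_ e e0)[j _ /(_ j (leqnn j))]] /= lj.
exists (\1_(G j) : V -> R); split => //.
have GU : G j `<=` \bigcup_j G j by exact: bigcup_sup.
have -> : (\int[lam]_v `|\1_(\bigcup_j G j) v - \1_(G j) v|%:E =
    lam ((\bigcup_j G j) `\` G j))%E.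
  rewrite -(setIT (_ `\` _)) -integral_indic//; last exact: measurableD.
  apply: eq_integral => v _; congr EFin; rewrite !indicE in_setD.
  have [vG|vG] := boolP (v \in G j); last by rewrite subr0 andbT normr_nat.
  have -> : (v \in \bigcup_j G j) = true by apply: mem_set; apply: GU; rewrite inE in vG.
  by rewrite /= subrr normr0.
rewrite measureD// setIidr//.
have finGj : lam (G j) \is a fin_num.
  by rewrite ge0_fin_numE// (le_lt_trans _ finG)// le_measure ?inE.
suff : (lam (\bigcup_j G j) - lam (G j) <= e%:E)%E by [].
rewrite -(fineK finU) -(fineK finGj) -EFinB lee_fin.
exact: le_trans (ler_norm _) lj.
Qed.

(** Dynkin induction from open sets. Cutting by a ball keeps all measures finite, which complements
    and increasing unions need. *)
Lemma L1_continuous_ball (A : set V) : measurable A -> forall N : nat,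
  L1_continuous \1_(A `&` ball (0 : V) N%:R).
Proof.
have mB (N : nat) : measurable (ball (0 : V) N%:R) by exact: measurable_ball_rV.
have Bfin (N : nat) : (lam (ball (0%R : V) N%:R) < +oo)%E.
  apply: (@lebesgue_rV_bounded _ _ _ N%:R) => // v.
  by rewrite -ball_normE /= sub0r normrN => /ltW.
have oB (N : nat) : open (ball (0 : V) N%:R) .
  case: N => [|N]; last exact: ball_open.
  rewrite (_ : ball _ _ = set0); first exact: open0.
  by apply/seteqP; split => // v []; rewrite ltxx.
move=> mA; have : <<s [set O : set V | open O] >> A by rewrite -measurable_rV_open.
apply: (@dynkin_induction _ V [set O : set V | open O] (fun A => forall N : nat,
  L1_continuous \1_(A `&` ball (0 : V) N%:R))) => {A mA}.
- exact: measurable_rV_open.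
- by move=> A B /= oA oB'; exact: openI.
- by move=> N; rewrite setTI; apply: L1_continuous_open.
- move=> O /= oO N; apply: L1_continuous_open; first exact: openI.
  apply: le_lt_trans (Bfin N); apply: le_measure; rewrite ?inE//.
  by apply: measurableI => //; exact: open_measurable_rV.
- move=> A mA LA N.
  have -> : \1_(~` A `&` ball (0 : V) N%:R) =
      (fun v => -1 * \1_(A `&` ball (0 : V) N%:R) v + \1_(ball (0 : V) N%:R) v) :> (V -> R).
    apply/funext => v; move: (ball (0 : V) N%:R : set V) => B.
    rewrite !indicE !in_setI in_setC.
    by case: (v \in A); case: (v \in B); rewrite /=; ring.
  apply: L1_continuousD; [exact/measurable_indic/measurableI|exact: measurable_indic|exact: LA|].
  exact: L1_continuous_open.
- move=> F mF tF LF N.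
  pose G j := \bigcup_(k < j) F k `&` ball (0 : V) N%:R.
  have mG j : measurable (G j).
    by apply: measurableI => //; apply: bigcup_measurable => k _.
  have LG j : L1_continuous \1_(G j).
    elim: j => [|j IH].
      rewrite /G (_ : \bigcup_(k < 0) F k = set0); last first.
        by apply/seteqP; split => v // [k].
      by rewrite set0I indic0; exact: L1_continuous0.
    have -> : \1_(G j.+1) = (fun v => 1 * \1_(G j) v + \1_(F j `&` ball (0 : V) N%:R) v) :> (V -> R).
      apply/funext => v; rewrite mul1r /G; move: (ball (0 : V) N%:R : set V) => B.
      rewrite !indicE !in_setI.
      have -> : (v \in \bigcup_(k < j.+1) F k) = (v \in \bigcup_(k < j) F k) || (v \in F j).
        apply/idP/orP; rewrite !inE => -[].
          move=> k /=; rewrite ltnS leq_eqVlt => /orP[/eqP -> Fj|kj Fk]; first by right.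
          by left; exists k.
        - by move=> [k /= kj Fk]; exists k => //=; exact: ltnW.
        - by move=> Fj; exists j => //=.
      have [vF|vF] := boolP (v \in F j); last by rewrite orbF addr0.
      suff -> : (v \in \bigcup_(k < j) F k) = false by rewrite /= add0r.
      apply/negbTE; rewrite notin_setE => -[k /= kj Fk].
      move/trivIsetP : tF => /(_ k j I I); rewrite neq_ltn kj => /(_ isT).
      by move=> /seteqP[/(_ v) + _]; apply; split => //; rewrite inE in vF.
    apply: L1_continuousD => //; exact/measurable_indic/measurableI.
  have ndG : nondecreasing_seq G.
    move=> i j ij; apply/subsetPset => v [[k /= ki Fk] Bv]; split => //.
    by exists k => //=; exact: leq_trans ij.
  have UG : \bigcup_j G j = \bigcup_k F k `&` ball (0 : V) N%:R.
    apply/seteqP; split => [v [j _ [[k _ Fk] Bv]]|v [[k _ Fk] Bv]]; first by split => //; exists k.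
    by exists k.+1 => //; split => //; exists k => //=.
  rewrite -UG; apply: L1_continuous_bigcup => //.
  apply: le_lt_trans (Bfin N); apply: le_measure; rewrite ?inE//.
    exact: bigcup_measurable.
  by rewrite UG; exact: subIsetr.
Qed.

Import HBSimple.

Lemma L1_continuous_sum I (s : seq I) (F : I -> V -> R) :
  (forall i, measurable_fun setT (F i)) -> (forall i, L1_continuous (F i)) ->
  L1_continuous (fun v => \sum_(i <- s) F i v).
Proof.
move=> mF LF; elim: s => [|i s IH].
  by under eq_fun do rewrite big_nil; exact: L1_continuous0.
under eq_fun do rewrite big_cons -[F i _]mul1r.
by apply: L1_continuousD => //; apply: measurable_sum.
Qed.

(** Approximation in L^1 by simple functions reduces the claim to indicators of sets of finite
    measure, themselves increasing limits of bounded sets. *)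
Lemma L1_continuous_integrable (f : V -> R) :
  lam.-integrable setT (EFin \o f) -> L1_continuous f.
Proof.
move=> intf.
have mf : measurable_fun setT f by apply/measurable_EFinP; exact: measurable_int intf.
have Lball (A : set V) : measurable A -> (lam A < +oo)%E -> L1_continuous \1_A.
  move=> mA lA.
  have AE : \bigcup_(N : nat) (A `&` ball (0 : V) N%:R) = A.
    apply/seteqP; split => [v [N _ []]//|v Av].
    exists (Num.bound `|v|) => //; split => //.
    by rewrite -ball_normE /= sub0r normrN archi_boundP.
  rewrite -AE; apply: L1_continuous_bigcup; rewrite ?AE//.
  - by move=> N; apply: measurableI => //; exact: measurable_ball_rV.
  - move=> i j ij; apply/subsetPset; apply: setIS; apply: le_ball.
    by rewrite ler_nat.
  - by move=> N; exact: L1_continuous_ball.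
have [g [ig _ fg]] := approximation_sfun_integrable measurableT intf.
apply: L1_continuous_approx => // e e0.
have mg k : measurable_fun setT (g k) by apply/measurable_EFinP; exact: measurable_int (ig k).
have := fg => /fine_cvgP[[K0 _ Kfin] /cvgrPdist_le/(_ e e0)[K1 _ Kle]].
pose k := maxn K0 K1; exists (g k); split => //; last first.
  have H1 := Kfin k (leq_maxl _ _); have H2 := Kle k (leq_maxr _ _).
  apply: (@le_trans _ _ (\int[lam]_z `|(f z)%:E - (g k z)%:E|)%E) => //.
  rewrite -(fineK H1) lee_fin (le_trans _ H2)// /= sub0r normrN; exact: ler_norm.
have -> : (g k : V -> R) = (fun v => \sum_(y <- fset_set (range (g k))) y * \1_(g k @^-1` [set y]) v).
  by apply/funext => v; rewrite fimfunE fsbig_finite.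
apply: L1_continuous_sum => y.
  by apply: measurable_funM => //; exact: measurable_indic.
have my : measurable (g k @^-1` [set y]) by exact: measurable_sfunP.
(* The level set of 0 may have infinite measure, but its term vanishes. *)
have [->|y0] := eqVneq y 0.
  by under eq_fun do rewrite mul0r; exact: L1_continuous0.
rewrite (_ : (fun _ => _) = (fun v => y * \1_(g k @^-1` [set y]) v + 0)); last first.
  by apply/funext => v; rewrite addr0.
apply: L1_continuousD; [exact: measurable_indic| | |exact: L1_continuous0].
  by have := @measurable_cst _ _ V R setT 0.
apply: Lball => //.
(* Markov's inequality: a nonzero level set of an integrable function has finite measure. *)
have yp : (0 < `|y|%:E)%E by rewrite lte_fin normr_gt0.
rewrite -(lte_pmul2l _ yp)//.
have /integrableP[_] := ig k; rewrite mulry gtr0_sg ?mul1e ?normr_gt0//; apply: le_lt_trans.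
rewrite -(setIT (_ @^-1` _)) -integral_indic// -ge0_integralZl//; last first.
  by apply/measurable_EFinP; exact: measurable_indic.
apply: ge0_le_integral => //.
- by apply: measurable_funeM; apply/measurable_EFinP; exact: measurable_indic.
- by apply: measurableT_comp => //; exact/measurable_EFinP.
- move=> v _; rewrite /= -EFinM lee_fin indicE; have [|] := boolP (v \in _).
    by rewrite inE/= => ->; rewrite mulr1.
  by rewrite mulr0.
Qed.

End translation_continuity.

(** * Blowing up densities along a subsequence *)

Section extraction.
Context {R : realType}.

(** The error [a j] changes with [j], so that the [j]-th choice can take care of more functions and
    of a larger ball than the previous ones. *)
Lemma diagonal_subsequence (a : nat -> nat -> \bar R) :
  (forall j, a j k @[k --> \oo] --> 0)%E ->
  exists2 r : nat -> nat, (forall k, r k < r k.+1)%N &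
    forall j, (a j (r j) <= (1 / (2 ^ j.+1)%:R)%:E)%E.
Proof.
move=> a0.
have H (jp : nat * nat) : exists k, (jp.2 < k)%N /\ (a jp.1 k <= (1 / (2 ^ jp.1.+1)%:R)%:E)%E.
  case: jp => j p /=; have e0 : 0 < 1 / (2 ^ j.+1)%:R :> R by rewrite divr_gt0// ltr0n expn_gt0.
  have := a0 j => /fine_cvgP[fa /cvgrPdist_le/(_ _ e0) le].
  near \oo => k; exists k; split; first by near: k; exact: nbhs_infty_gt.
  rewrite -[leLHS]fineK; last by near: k.
  rewrite lee_fin (le_trans (ler_norm _))// -normrN -sub0r.
  by near: k.
have [g gP] := choice H.
pose r := fix F n := if n is n'.+1 then g (n, F n') else g (0, 0)%N.
exists r => [k|[|j]]; first by have [] := gP (k.+1, r k).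
  by have [] := gP (0, 0)%N.
by have [] := gP (j.+1, r j).
Unshelve. all: by end_near. Qed.

Lemma nneseries_fin_cvg0 (g : nat -> \bar R) : (forall k, 0 <= g k)%E ->
  (\sum_(k <oo) g k < +oo)%E -> (g k @[k --> \oo] --> 0)%E.
Proof.
move=> g0 gf; have := nneseries_tail_cvg gf (fun k _ => g0 k).
apply: (squeeze_cvge _ (cvg_cst 0%E)); apply: nearW => k.
rewrite g0/= (le_trans _ (nneseries_lim_ge k.+1 (fun i _ _ => g0 i)))//.
by rewrite big_nat1.
Qed.

(** The integrals sum to at most 1, so the series is integrable, hence finite almost everywhere, and
    its terms tend to 0. *)
Lemma ae_cvg0_of_summable d (T : measurableType d) (mu : {measure set T -> \bar R})
    (g : nat -> T -> \bar R) :
  (forall k, measurable_fun setT (g k)) -> (forall k x, 0 <= g k x)%E ->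
  (forall k, \int[mu]_x g k x <= (1 / (2 ^ k.+1)%:R)%:E)%E ->
  {ae mu, forall x, (g k x @[k --> \oo] --> 0)%E}.
Proof.
move=> mg g0 gle.
have Soo : (\int[mu]_x (\sum_(k <oo) g k x) < +oo)%E.
  rewrite integral_nneseries//.
  apply: (@le_lt_trans _ _ (\sum_(k <oo) (1 / (2 ^ k.+1)%:R)%:E)%E).
    by apply: lee_nneseries => // k _ _; exact: integral_ge0.
  exact: le_lt_trans (epsilon_trick0 xpredT ler01) (ltry _).
have iS : mu.-integrable setT (fun x => \sum_(k <oo) g k x)%E.
  apply/integrableP; split; first exact: ge0_emeasurable_sum.
  under eq_integral do rewrite gee0_abs ?nneseries_ge0//.
  exact: Soo.
have := integrable_ae measurableT iS; apply: filterS => x /(_ I) Sx.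
apply: nneseries_fin_cvg0 => //.
by rewrite -ge0_fin_numE// nneseries_ge0.
Qed.

End extraction.

Lemma integrable_cst_lty d (T : measurableType d) (R : realType)
    (mu : {measure set T -> \bar R}) (A : set T) (r : R) :
  measurable A -> (mu A < +oo)%E -> mu.-integrable A (cst r%:E).
Proof.
move=> mA Aoo; apply/integrableP; split; first exact: measurable_cst.
by rewrite integral_cst// lte_mul_pinfty.
Qed.

Section dilation.
Context {R : realType} (n : nat).
Local Notation lam := (@lebesgue_rV R n).
Local Notation V := 'rV[R]_n.

Definition eball (N : nat) : set V := [set w | enorm w <= N%:R].

Lemma measurable_eball N : measurable (eball N).
Proof.
rewrite (_ : eball N = setT `&` [set w | enorm w <= N%:R]); last by rewrite setTI.
apply: measurable_fun_ler => //; apply: measurable_enorm; exact: measurable_id.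
Qed.

Lemma eball_lty N : (lam (eball N) < +oo)%E.
Proof.
apply: (@lebesgue_rV_bounded _ _ _ N%:R); first exact: measurable_eball.
by move=> v vN; rewrite (le_trans (norm_le_enorm _)).
Qed.

Lemma measurable_dilation (t : R) :
  measurable_fun setT (fun p : V * V => p.1 + t *: p.2).
Proof.
apply: (measurable_addrV measurable_fst).
have := measurableT_comp (@measurable_affine_rV R n t 0) (@measurable_snd _ _ V V).
by apply: eq_measurable_fun => p _ /=; rewrite addr0.
Qed.

Definition dilation_error (f : V -> R) (t : R) (p : V * V) : \bar R :=
  `|f (p.1 + t *: p.2) - f p.1|%:E.

Lemma dilation_error_ge0 f t p : (0 <= dilation_error f t p)%E.
Proof. by rewrite /dilation_error lee_fin. Qed.

Lemma measurable_dilation_error f t : measurable_fun setT f ->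
  measurable_fun setT (dilation_error f t).
Proof.
move=> mf; apply/measurable_EFinP; apply: measurableT_comp => //.
apply: measurable_funB; first exact: measurableT_comp (measurable_dilation t).
exact: measurableT_comp measurable_fst.
Qed.

(** After exchanging the integrals, the inner one is the L^1 distance between [f] and its translate
    by [t k *: w]; it tends to 0 for each [w] and is bounded by twice the norm of [f]. *)
Lemma dilation_L1_cvg (f : V -> R) (t : nat -> R) N :
  lam.-integrable setT (EFin \o f) -> t @ \oo --> 0 ->
  (\int[lam]_v \int[lam]_(w in eball N) dilation_error f (t k) (v, w) @[k --> \oo] --> 0)%E.
Proof.
move=> intf t0.
have mf : measurable_fun setT f by apply/measurable_EFinP; exact: measurable_int intf.
pose G k w := (\int[lam]_v dilation_error f (t k) (v, w))%E.
have mE := measurable_eball N.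
have E k : (\int[lam]_v \int[lam]_(w in eball N) dilation_error f (t k) (v, w) =
    \int[lam]_(w in eball N) G k w)%E.
  have mI : measurable_fun setT (fun p : V * V => dilation_error f (t k) p * (\1_(eball N) p.2)%:E)%E.
    apply: emeasurable_funM; first exact: measurable_dilation_error.
    apply/measurable_EFinP; apply: measurableT_comp => //.
  have H := @fubini_tonelli _ _ _ _ _ lam lam _ mI.
  transitivity (\int[lam]_v \int[lam]_w (dilation_error f (t k) (v, w) * (\1_(eball N) w)%:E))%E.
    by apply: eq_integral => v _; rewrite integral_mkcond epatch_indic.
  transitivity (\int[lam]_w \int[lam]_v (dilation_error f (t k) (v, w) * (\1_(eball N) w)%:E))%E.
    by apply: H => p; rewrite mule_ge0// lee_fin.
  rewrite [RHS]integral_mkcond epatch_indic; apply: eq_integral => w _.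
  have c0 : (0 <= ((\1_(eball N) w) : R)%:E)%E by rewrite lee_fin.
  rewrite [X in _ = (_ * X)%E]/= /G; move: ((\1_(eball N) w : R)%:E) c0 => c c0.
  have mD : measurable_fun setT (fun v => dilation_error f (t k) (v, w)).
    exact: measurableT_comp (measurable_dilation_error _ mf) (measurable_pair2 _).
  have D0 v : (0 <= dilation_error f (t k) (v, w))%E by exact: dilation_error_ge0.
  exact: (@ge0_integralZr _ _ _ lam setT measurableT _ mD c (fun v _ => D0 v) c0).
rewrite (eq_cvg _ _ E).
pose C : \bar R := (2%:E * \int[lam]_v `|f v|%:E)%E.
have absf : measurable_fun setT (fun v => `|f v|%:E).
  by apply/measurable_EFinP; exact: measurableT_comp.
have Cfin : C \is a fin_num.
  have /integrableP[_] := intf => foo; rewrite ge0_fin_numE ?mule_ge0 ?integral_ge0//.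
  by rewrite /C lte_mul_pinfty ?ltry//; exact: foo.
have [] := @dominated_convergence _ _ _ lam (eball N) mE G (cst 0%E) (cst C).
- move=> k; apply: measurable_funTS.
  exact: (@measurable_fun_fubini_tonelli_G _ _ V V R lam _ (measurable_dilation_error (t k) mf) (dilation_error_ge0 f (t k))).
- exact: measurable_cst.
- apply: aeW => w _; have tw : t k *: w @[k --> \oo] --> (0 : V).
    by rewrite -(scale0r w); apply: cvgZ => //; exact: cvg_cst.
  exact: (L1_continuous_integrable intf tw).
- by rewrite -(fineK Cfin); apply: integrable_cst_lty => //; exact: eball_lty.
- apply: aeW => w k _; rewrite gee0_abs; last first.
    by apply: integral_ge0 => v _; exact: dilation_error_ge0.
  apply: (@le_trans _ _ (\int[lam]_v (`|f (v + t k *: w)%R|%:E + `|f v|%:E))%E).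
    apply: ge0_le_integral => //.
    - by move=> v _; exact: dilation_error_ge0.
    - exact: measurableT_comp (measurable_dilation_error _ mf) (measurable_pair2 _).
    - apply: emeasurable_funD => //.
      apply/measurable_EFinP; apply: measurableT_comp => //.
      exact: measurable_shift.
    - by move=> v _; rewrite -EFinD lee_fin ler_normB.
  rewrite ge0_integralD//; last first.
    apply/measurable_EFinP; apply: measurableT_comp => //.
    exact: measurable_shift.
  rewrite (integral_shift (t k *: w) absf)// /C.
  by rewrite -[leRHS]/(2%:R%:E * _)%E mule_natl mule2n.
by move=> _ _; rewrite integral0.
Qed.

(* By Fubini and continuity of translations in L^1, the blow-up errors tend to
   0 in L^1(dv), hence almost everywhere along a subsequence. This replaces
   Lebesgue's differentiation theorem. *)
Lemma blowup_subsequence (f : nat -> V -> R) (t : nat -> R) :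
  (forall l, lam.-integrable setT (EFin \o f l)) -> t @ \oo --> 0 ->
  exists2 r : nat -> nat, (forall k, r k < r k.+1)%N &
    forall l, {ae lam, forall v, forall N : nat,
      (\int[lam]_(w in eball N) `|f l (v + t (r k) *: w)%R - f l v|%:E @[k --> \oo] --> 0)%E}.
Proof.
move=> intf t0.
have mf l : measurable_fun setT (f l) by apply/measurable_EFinP; exact: measurable_int (intf l).
pose b l j k := (\int[lam]_v \int[lam]_(w in eball j) dilation_error (f l) (t k) (v, w))%E.
(* Step [j] treats the first [j] functions on the ball of radius [j]; any given pair of a function
   and a radius is thus treated by all but finitely many steps. *)
have [|r rS rP] := @diagonal_subsequence R (fun j k => \sum_(l < j) b l j k)%E.
  move=> j; suff : ((\sum_(l < j) b l j k) @[k --> \oo] --> \sum_(l < j) (0 : \bar R))%E.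
    by rewrite big1.
  apply: cvg_nnesum => [l _|l _].
    by apply: nearW => k; apply: integral_ge0 => v _; apply: integral_ge0 => w _; exact: dilation_error_ge0.
  exact: dilation_L1_cvg.
exists r => // l.
pose g j v := if (l < j)%N then
  (\int[lam]_(w in eball j) dilation_error (f l) (t (r j)) (v, w))%E else 0%E.
have g0 j v : (0 <= g j v)%E by rewrite /g; case: ifP => // _; apply: integral_ge0 => w _; exact: dilation_error_ge0.
have mg j : measurable_fun setT (g j).
  rewrite /g; case: (l < j)%N; last exact: measurable_cst.
  have mI : measurable_fun setT (fun p : V * V =>
      dilation_error (f l) (t (r j)) p * (\1_(eball j) p.2)%:E)%E.
    apply: emeasurable_funM; first exact: measurable_dilation_error.
    apply/measurable_EFinP; apply: measurableT_comp => //.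
    exact: measurable_indic (measurable_eball _).
  have I0 p : (0 <= dilation_error (f l) (t (r j)) p * (\1_(eball j) p.2)%:E)%E.
    by rewrite mule_ge0 ?lee_fin//; exact: dilation_error_ge0.
  have := @measurable_fun_fubini_tonelli_F _ _ V V R lam _ mI I0.
  apply: eq_measurable_fun => v _.
  by rewrite /fubini_F [RHS]integral_mkcond epatch_indic.
have : {ae lam, forall v, (g k v @[k --> \oo] --> 0)%E}.
  apply: (ae_cvg0_of_summable mg g0) => j; rewrite /g.
  have [lj|lj] := ltnP l j; last by rewrite integral0 lee_fin divr_ge0.
  apply: le_trans (rP j); rewrite (bigD1 (Ordinal lj))//= leeDl//.
  by apply: sume_ge0 => i _; apply: integral_ge0 => v _; apply: integral_ge0 => w _; exact: dilation_error_ge0.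
apply: filterS => v gv N.
apply: (squeeze_cvge _ (cvg_cst 0%E) gv).
near=> j.
rewrite integral_ge0//= /g ifT; last by near: j; exact: nbhs_infty_gt.
apply: ge0_subset_integral => //; [exact: measurable_eball|exact: measurable_eball| |].
  apply: measurable_funTS.
  exact: measurableT_comp (measurable_dilation_error _ (mf l)) (measurable_pair1 v).
move=> w; rewrite /eball/= => wN; rewrite (le_trans wN)// ler_nat.
by near: j; exact: nbhs_infty_ge.
Unshelve. all: by end_near. Qed.

End dilation.

(** * The limit functional *)

Section exponential_limit.
Context {R : realType}.

Lemma pow_onem_le_expR (p : R) N : 0 <= p <= 1 -> (1 - p) ^+ N <= expR (- (N%:R * p)).
Proof.
move=> /andP[p0 p1]; rewrite -mulrN mulrC expRM_natr lerXn2r ?nnegrE ?subr_ge0 ?expR_ge0//.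
exact: expR_ge1Dx.
Qed.

(** Since [1 / (1 - p) = 1 + p / (1 - p)], this is [1 + y <= exp y] at [y = p / (1 - p)]. *)
Lemma pow_onem_ge_expR (p : R) N : 0 <= p < 1 -> expR (- (N%:R * p / (1 - p))) <= (1 - p) ^+ N.
Proof.
move=> /andP[p0 p1]; have q0 : 0 < 1 - p by rewrite subr_gt0.
rewrite -mulrA -mulrN mulrC expRM_natr lerXn2r ?nnegrE ?expR_ge0 ?(ltW q0)//.
rewrite expRN -[leRHS]invrK lef_pV2 ?posrE ?expR_gt0 ?invr_gt0//.
have -> : p * (1 - p)^-1 = (1 - p)^-1 - 1 by field; rewrite gt_eqF.
have := expR_ge1Dx ((1 - p)^-1 - 1); rewrite addrCA subrr addr0.
by [].
Qed.

(** The Poisson limit of an empty binomial count. The [j] points already used by the configuration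
    are negligible, because [p k] tends to 0. *)
Lemma pow_onem_cvg (n : nat -> nat) (p : nat -> R) (a : R) j :
  (n k @[k --> \oo] --> \oo) -> (forall k, 0 <= p k <= 1) ->
  (n k)%:R * p k @[k --> \oo] --> a ->
  (1 - p k) ^+ (n k - j) @[k --> \oo] --> expR (- a).
Proof.
move=> noo p01 npa.
have ninv : (n k)%:R^-1 @[k --> \oo] --> (0 : R).
  apply/gtr0_cvgV0.
    near=> k; rewrite ltr0n; near: k.
    by move/cvgnyPgt : noo => /(_ 0%N).
  by apply/cvgrnyP.
have p0 : p k @[k --> \oo] --> 0.
  have : (n k)%:R^-1 * ((n k)%:R * p k) @[k --> \oo] --> 0 * a by exact: cvgM.
  rewrite mul0r; apply: cvg_trans; apply: near_eq_cvg; near=> k.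
  rewrite mulrA mulVf ?mul1r// pnatr_eq0 -lt0n; near: k.
  by move/cvgnyPgt : noo => /(_ 0%N).
have Npa : (n k - j)%:R * p k @[k --> \oo] --> a.
  have : (n k)%:R * p k - j%:R * p k @[k --> \oo] --> a - j%:R * 0.
    by apply: cvgB => //; apply: cvgMr.
  rewrite mulr0 subr0; apply: cvg_trans; apply: near_eq_cvg; near=> k.
  rewrite natrB ?mulrBl//; near: k.
  by move/cvgnyPge : noo => /(_ j).
have expc (u : nat -> R) (b : R) : u k @[k --> \oo] --> b -> expR (- u k) @[k --> \oo] --> expR (- b).
  by move=> ub; apply: continuous_cvg; [exact: continuous_expR|exact: cvgN].
apply: (@squeeze_cvgr _ _ _ _ (fun k => expR (- ((n k - j)%:R * p k / (1 - p k))))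
  (fun k => expR (- ((n k - j)%:R * p k)))).
- near=> k; rewrite pow_onem_le_expR// andbT pow_onem_ge_expR//.
  have /andP[-> _] := p01 k; near: k.
  by move/cvgr_lt : p0 => /(_ 1 ltr01).
- apply: expc; rewrite -[X in _ --> X]divr1; apply: cvgM => //.
  have -> : 1^-1 = (1 - 0 : R)^-1 by rewrite subr0.
  by apply: cvgV; [rewrite subr0 oner_eq0|apply: cvgB => //; exact: cvg_cst].
- exact: expc.
Unshelve. all: by end_near. Qed.

End exponential_limit.

Section comparison.
Context {R : realType}.

Definition lte_if (c : bool) (x y : R) : bool := if c then x <= y else x < y.

(** Off ties of the limits, strict and large inequalities are eventually equivalent: this is why
    both versions of stars have the same limit. *)
Lemma lte_if_near c (x y : nat -> R) (a b : R) :
  x k @[k --> \oo] --> a -> y k @[k --> \oo] --> b -> a != b ->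
  \forall k \near \oo, lte_if c (x k) (y k) = (a < b).
Proof.
move=> xa yb ab.
have dl : y k - x k @[k --> \oo] --> b - a by exact: cvgB.
case: ltgtP ab => // [ab|ba] _.
  have d0 : 0 < b - a by rewrite subr_gt0.
  near=> k; have H : 0 < y k - x k.
    by near: k; exact: (cvgr_gt _ dl).
  by rewrite subr_gt0 in H; rewrite /lte_if; case: c; rewrite ?H// ltW.
have d0 : b - a < 0 by rewrite subr_lt0.
near=> k; have H : y k - x k < 0.
  by near: k; exact: (cvgr_lt _ dl).
by rewrite subr_lt0 in H; rewrite /lte_if; case: c; apply/negbTE; rewrite -?ltNge// -leNgt ltW.
Unshelve. all: by end_near. Qed.

Lemma measurable_lte_if d (T : measurableType d) c (f g : T -> R) :
  measurable_fun setT f -> measurable_fun setT g ->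
  measurable_fun setT (fun x => lte_if c (f x) (g x)).
Proof.
by move=> mf mg; case: c; [exact: measurable_fun_ler|exact: measurable_fun_ltr].
Qed.

Lemma measurable_boolR d (T : measurableType d) (b : T -> bool) :
  measurable_fun setT b -> measurable_fun setT (fun x => (b x)%:R : R).
Proof.
move=> mb; apply: (@measurableT_comp _ _ _ _ _ _ (fun b : bool => b%:R : R)) => //.
Qed.

(* p lies in the ball of center y having the origin on its boundary, closed if c
   is true and open otherwise *)
Definition in_nball d c (p y : 'rV[R]_d) : bool := lte_if c (enorm (p - y)) (enorm y).

Definition in_gamma d c (y z : 'rV[R]_d) : bool :=
  lte_if c (Num.max (enorm y) (enorm z)) (enorm (y - z)).

End comparison.

Section limit_functional.
Context {R : realType} (m : nat).
Local Notation V := 'rV[R]_m.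
Local Notation lam := (@lebesgue_rV R m).

Definition ball_pair (p : V * V) : set V :=
  euclidean_ball p.1 (enorm p.1) `|` euclidean_ball p.2 (enorm p.2).

Lemma measurable_ball_pair_prod :
  measurable [set q : (V * V) * V | ball_pair q.1 q.2].
Proof.
rewrite (_ : [set q | _] =
  [set q : (V * V) * V | (enorm (q.2 - q.1.1) < enorm q.1.1) || (enorm (q.2 - q.1.2) < enorm q.1.2)]); last first.
  by apply/seteqP; split => q /= /orP.
rewrite -[X in measurable X]setTI.
have m1 : measurable_fun setT (fun q : (V * V) * V => q.1.1).
  exact: measurableT_comp measurable_fst measurable_fst.
have m2 : measurable_fun setT (fun q : (V * V) * V => q.1.2).
  exact: measurableT_comp measurable_snd measurable_fst.
have m3 : measurable_fun setT (fun q : (V * V) * V => q.2) by exact: measurable_snd.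
apply: (@measurable_or _ _ setT (fun q : (V * V) * V => enorm (q.2 - q.1.1) < enorm q.1.1) (fun q : (V * V) * V => enorm (q.2 - q.1.2) < enorm q.1.2)) => //.
  by apply: measurable_fun_ltr; apply: measurable_enorm => //; exact: measurable_subrV.
by apply: measurable_fun_ltr; apply: measurable_enorm => //; exact: measurable_subrV.
Qed.

Lemma measurable_ball_pair p : measurable (ball_pair p).
Proof.
have := measurable_xsection p measurable_ball_pair_prod.
by congr measurable; apply/seteqP; split => w; rewrite /xsection /= inE.
Qed.

Lemma ball_pair_bounded p w : ball_pair p w -> enorm w <= 2 * (enorm p.1 + enorm p.2).
Proof.
have H (y : V) : enorm (w - y) < enorm y -> enorm w <= 2 * enorm y.
  by move=> wy; have := ler_enormD (w - y) y; rewrite subrK; lra.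
by have := enorm_ge0 p.1; have := enorm_ge0 p.2; move=> ? ? [/H|/H]; lra.
Qed.

Lemma ball_pair_lty p : (lam (ball_pair p) < +oo)%E.
Proof.
apply: (@lebesgue_rV_bounded _ _ _ (2 * (enorm p.1 + enorm p.2))).
  exact: measurable_ball_pair.
by move=> w /ball_pair_bounded; apply: le_trans; exact: norm_le_enorm.
Qed.

Lemma measurable_lebesgue_ball_pair : measurable_fun setT (fun p => fine (lam (ball_pair p))).
Proof.
apply: (measurableT_comp (fine_measurable measurableT)).
have := measurable_fun_xsection lam measurable_ball_pair_prod.
apply: eq_measurable_fun => p _ /=; congr (lebesgue_rV m _).
by apply/seteqP; split => w; rewrite /xsection /= inE.
Qed.

Definition pair_density (r : R) (p : V * V) : R :=
  ([&& enorm p.1 <= r, enorm p.2 <= r & in_gamma false p.1 p.2])%:R *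
  expR (- fine (lam (ball_pair p))).

Lemma pair_density_ge0 r p : 0 <= pair_density r p.
Proof. by rewrite mulr_ge0 ?expR_ge0. Qed.

Lemma measurable_pair_density r : measurable_fun setT (pair_density r).
Proof.
apply: measurable_funM.
  apply: measurable_boolR; apply: measurable_and.
    by apply: measurable_fun_ler => //; exact: measurable_enorm measurable_fst.
  apply: measurable_and.
    by apply: measurable_fun_ler => //; exact: measurable_enorm measurable_snd.
  apply: measurable_lte_if.
    by apply: measurable_maxr; apply: measurable_enorm => //; exact: measurable_snd.
  by apply: measurable_enorm; apply: measurable_subrV => //; exact: measurable_snd.
apply: measurableT_comp => //; apply: measurableT_comp => //.
exact: measurable_lebesgue_ball_pair.
Qed.

Definition pair_integral (r : R) : \bar R :=
  (\int[lam \x lam]_p (pair_density r p)%:E)%E.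

Lemma limit_constantE : limit_constant R m =
  (\int[lam \x lam]_p ((in_gamma false p.1 p.2)%:R * expR (- fine (lam (ball_pair p))))%:E)%E.
Proof.
rewrite /limit_constant integral_mkcond; apply: eq_integral => p _.
rewrite patchE; case: ifPn; rewrite ?inE ?notin_setE /Gamma2 /= /in_gamma /lte_if => H.
  by rewrite H mul1r.
by rewrite (negbTE (introN idP H)) mul0r.
Qed.

(** Monotone convergence in the truncation radius. The factor [s] is the one left by the blow-up at
    a point; it has no influence on the limit. *)
Lemma pair_integral_cvg (s : R) : 0 < s ->
  (pair_integral (N%:R * s) @[N --> \oo] --> limit_constant R m)%E.
Proof.
move=> s0; rewrite limit_constantE.
pose F (p : V * V) := ((in_gamma false p.1 p.2)%:R * expR (- fine (lam (ball_pair p))))%:E.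
suff : (pair_integral (N%:R * s) @[N --> \oo] --> \int[lam \x lam]_p F p)%E by [].
have -> : F = (fun p => limn (fun N => (pair_density (N%:R * s) p)%:E)).
  apply/funext => p; apply/esym/cvg_lim => //.
  apply: (@cvg_trans _ (F p @[_ --> \oo])); last exact: cvg_cst.
  apply: near_eq_cvg; near=> N; rewrite /F /pair_density; congr ((_%:R * _)%:E).
  have -> : enorm p.1 <= N%:R * s.
    rewrite -ler_pdivrMr//; near: N; exact: nbhs_infty_ger.
  have -> : enorm p.2 <= N%:R * s.
    rewrite -ler_pdivrMr//; near: N; exact: nbhs_infty_ger.
  by [].
apply: cvg_monotone_convergence => //.
- by move=> N; apply/measurable_EFinP; exact: measurable_pair_density.
- by move=> N p _; rewrite lee_fin pair_density_ge0.
- move=> p _ N N' NN'; rewrite lee_fin ler_wpM2r ?expR_ge0// ler_nat.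
  have H (x : R) : x <= N%:R * s -> x <= N'%:R * s.
    by move=> /le_trans; apply; rewrite ler_pM2r// ler_nat.
  have := H (enorm p.1); have := H (enorm p.2).
  case: (_ <= N%:R * s) => //=; case: (_ <= N%:R * s) => //= -> // -> //.
Unshelve. all: by end_near. Qed.

Definition cball (r : R) : set V := [set w | enorm w <= r].

Lemma measurable_cball (r : R) : measurable (cball r).
Proof.
rewrite /cball.
rewrite (_ : [set w : V | _] = setT `&` [set w : V | enorm w <= r]); last by rewrite setTI.
by apply: measurable_fun_ler => //; apply: measurable_enorm; exact: measurable_id.
Qed.

Lemma cball_lty (r : R) : (lam (cball r) < +oo)%E.
Proof.
apply: (@lebesgue_rV_bounded _ _ _ r); first exact: measurable_cball.
by move=> w /=; apply: le_trans; exact: norm_le_enorm.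
Qed.

(** No formula for the volume of balls: the ball contains a cube of side [x N], of volume at least
    [x N] once [1 <= x N], and [exp (- x) <= 1 / x]. *)
Lemma closed_ball_volume_pinfty (s : R) : (0 < m)%N -> 0 < s ->
  (expR (- fine (lam (cball (N%:R * s)))) @[N --> \oo] --> 0)%R.
Proof.
move=> m0 s0; have mR : 0 < m%:R :> R by rewrite ltr0n.
pose x N : R := 2 * (N%:R * s / m%:R).
have H N : 1 <= x N -> x N <= fine (lam (cball (N%:R * s))).
  move=> x1; rewrite -lee_fin fineK ?ge0_fin_numE ?cball_lty//.
  have r0 : 0 <= N%:R * s / m%:R by rewrite divr_ge0// mulr_ge0// ltW.
  apply: (@le_trans _ _ (lam (rV_cube (N%:R * s / m%:R)))).
    by rewrite lebesgue_rV_cube// lee_fin -/(x N) ler_eXnr.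
  apply: le_measure; rewrite ?inE; [exact: measurable_rV_cube|exact: measurable_cball|].
  move=> w /(rV_cubeE _ r0) wr; rewrite /cball /= (le_trans (enorm_le_norm _))//.
  by rewrite mulrC -ler_pdivlMr.
have Hinv : m%:R / (2 * s) * N.+1%:R^-1 @[N --> \oo] --> (m%:R / (2 * s) * 0 : R).
  by apply: cvgMr; exact: cvg_harmonic.
rewrite -cvg_shiftS; apply: (squeeze_cvgr _ (cvg_cst 0)); last first.
  by rewrite mulr0 in Hinv; exact: Hinv.
near=> N; rewrite expR_ge0/=.
have x1 : 1 <= x N.+1.
  have : m%:R / (2 * s) <= N.+1%:R.
    by rewrite (@le_trans _ _ N%:R) ?ler_nat//; near: N; exact: nbhs_infty_ger.
  by rewrite ler_pdivrMr ?mulr_gt0// /x mulrA ler_pdivlMr// mul1r; lra.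
rewrite (@le_trans _ _ (expR (- x N.+1)))// ?ler_expR ?lerN2 ?H//.
have xp : 0 < x N.+1 by rewrite (lt_le_trans _ x1).
rewrite expRN (@le_trans _ _ (x N.+1)^-1)//.
  rewrite lef_pV2 ?posrE ?expR_gt0// (le_trans _ (expR_ge1Dx _))//.
  by rewrite lerDr.
rewrite /x le_eqVlt; apply/orP; left; apply/eqP; field.
by rewrite !gt_eqF.
Unshelve. all: by end_near. Qed.

End limit_functional.

(** * Convergence of masses and pair integrals under blow-up *)

Section product_integral.
Context d1 d2 (T1 : measurableType d1) (T2 : measurableType d2) (R : realType).
Variables (m1 : {sigma_finite_measure set T1 -> \bar R}).
Variables (m2 : {sigma_finite_measure set T2 -> \bar R}).

Lemma integral_prod_mul (a : T1 -> \bar R) (b : T2 -> \bar R) :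
  measurable_fun setT a -> measurable_fun setT b ->
  (forall x, 0 <= a x)%E -> (forall x, 0 <= b x)%E ->
  (\int[m1 \x m2]_p (a p.1 * b p.2) = \int[m1]_x a x * \int[m2]_y b y)%E.
Proof.
move=> ma mb a0 b0.
have mab : measurable_fun setT (fun p : T1 * T2 => a p.1 * b p.2)%E.
  by apply: emeasurable_funM; [exact: measurableT_comp ma measurable_fst|exact: measurableT_comp mb measurable_snd].
rewrite (@fubini_tonelli1 _ _ _ _ _ m1 m2 _ mab) => [|p]; last by rewrite mule_ge0.
rewrite -ge0_integralZr//; last by apply: integral_ge0.
apply: eq_integral => x _; rewrite /fubini_F/=.
by rewrite -ge0_integralZl.
Qed.

Lemma integral_prodset_mul (A : set T1) (B : set T2) (a : T1 -> \bar R) (b : T2 -> \bar R) :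
  measurable A -> measurable B ->
  measurable_fun setT a -> measurable_fun setT b ->
  (forall x, 0 <= a x)%E -> (forall x, 0 <= b x)%E ->
  (\int[m1 \x m2]_(p in A `*` B) (a p.1 * b p.2) = \int[m1]_(x in A) a x * \int[m2]_(y in B) b y)%E.
Proof.
move=> mA mB ma mb a0 b0.
rewrite integral_mkcond [in RHS]integral_mkcond [X in (_ * X)%E]integral_mkcond.
rewrite -integral_prod_mul.
- apply: eq_integral => -[x y] _; rewrite !patchE/= in_setX/=.
  by case: (x \in A); case: (y \in B); rewrite /= ?mule0 ?mul0e.
- by apply/(measurable_restrictT _ mA); exact: measurable_funTS.
- by apply/(measurable_restrictT _ mB); exact: measurable_funTS.
- by move=> x; rewrite patchE; case: ifP.
- by move=> x; rewrite patchE; case: ifP.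
Qed.

Lemma product_null_ysection (E : set (T1 * T2)) : measurable E ->
  (forall y, m1 (ysection E y) = 0%E) -> ((m1 \x m2) E = 0)%E.
Proof.
move=> mE E0; rewrite product_measure_ysection//.
by apply: integral0_eq => y _; rewrite E0.
Qed.

Lemma product_null_xsection (E : set (T1 * T2)) : measurable E ->
  (forall x, m2 (xsection E x) = 0%E) -> ((m1 \x m2) E = 0)%E.
Proof.
by move=> mE E0; apply: integral0_eq => y _ /=; rewrite E0.
Qed.

Lemma product_null_setU (A B : set (T1 * T2)) : measurable A -> measurable B ->
  ((m1 \x m2) A = 0 -> (m1 \x m2) B = 0 -> (m1 \x m2) (A `|` B) = 0)%E.
Proof. by move=> mA mB A0 B0; apply: null_set_setU. Qed.

End product_integral.

Section local_limit.
Context {R : realType} (m d : nat).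
Local Notation V := 'rV[R]_m.
Local Notation lam := (@lebesgue_rV R m).
(** The situation at one point, in the abstract: [c0] is the density there, [phi k] and [g k] are
    the dilated inverse chart and density. The norm of the derivative of the chart is that of [T]
    divided by [s], and [T] carries [c0] times Lebesgue measure to Lebesgue measure. *)
Variables (T : 'M[R]_m) (s c0 : R).
Hypotheses (m_gt0 : (0 < m)%N) (uT : T \in unitmx) (s0 : 0 < s) (c00 : 0 < c0).
Hypothesis lamT : forall A : set V, measurable A ->
  (c0%:E * lam ((fun v => v *m T) @^-1` A) = lam A)%E.
Variables (phi : nat -> V -> 'rV[R]_d) (g : nat -> V -> R) (n : nat -> nat).
Hypothesis mphi : forall k, measurable_fun setT (phi k).
Hypothesis mg : forall k, measurable_fun setT (g k).
Hypothesis g0 : forall k w, 0 <= g k w.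
Hypothesis ig : forall k, lam.-integrable setT (EFin \o g k).
Hypothesis noo : n k @[k --> \oo] --> \oo.
Hypothesis gc0 : forall N : nat,
  (\int[lam]_(w in eball N) `|g k w - c0|%:E @[k --> \oo] --> 0)%E.
Hypothesis phiB : forall u v,
  enorm (phi k u - phi k v) @[k --> \oo] --> enorm ((u - v) *m T) / s.
Hypothesis phi1 : forall u, enorm (phi k u) @[k --> \oo] --> enorm (u *m T) / s.
(** Bounded points of the manifold come from bounded parameters. The condition on [g] excludes
    parameters outside the chart, where [phi] will have arbitrary values. *)
Hypothesis confined : forall r : R, exists N : nat, \forall k \near \oo,
  forall w, g k w != 0 -> enorm (phi k w) <= r -> enorm w <= N%:R.

Lemma preimage_mulmx_measurable (A : set V) : measurable A ->
  measurable ((fun v => v *m T) @^-1` A).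
Proof. by move=> mA; rewrite -[X in measurable X]setTI; exact: measurable_mulmx. Qed.

Lemma preimage_mulmx_null (A : set V) : measurable A -> lam A = 0%E ->
  lam ((fun v => v *m T) @^-1` A) = 0%E.
Proof.
move=> mA A0; have /eqP := lamT mA; rewrite A0 mule_eq0 eqe gt_eqF//=.
by move/eqP.
Qed.

Lemma mulmx_confined (r : R) : exists N : nat, forall w : V, enorm (w *m T) <= r -> enorm w <= N%:R.
Proof.
have [C C0 CT] := mulmx_norm_bound (invmx T).
exists (Num.bound (m%:R * (C * `|r|))) => w wr.
rewrite (@le_trans _ _ (m%:R * (C * `|r|)))//; last first.
  by rewrite ltW// archi_boundP// !mulr_ge0.
rewrite (le_trans (enorm_le_norm _))// ler_wpM2l//.
rewrite -[w in leLHS](mulmxK uT) (le_trans (CT _))// ler_wpM2l//.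
by rewrite (le_trans (norm_le_enorm _))// (le_trans wr)// ler_norm.
Qed.

Lemma integral_mulmx (h : V -> \bar R) : measurable_fun setT h -> (forall v, 0 <= h v)%E ->
  (\int[lam]_v (c0%:E * h (v *m T)) = \int[lam]_v h v)%E.
Proof.
move=> mh h0; rewrite ge0_integralZl//; last 2 first.
- exact: measurableT_comp mh (measurable_mulmx T).
- by rewrite lee_fin ltW.
rewrite -(ge0_integral_image_measure lam (measurable_mulmx T) mh h0).
have @sn : {nonneg R} := NngNum (ltW c00).
rewrite -[c0]/(sn%:num) -ge0_integral_mscale//.
by apply: eq_measure_integral => A mA _; exact: lamT.
Qed.

Lemma measurable_sphere (c : V) (r : R) : measurable [set w : V | enorm (w - c) = r].
Proof.
rewrite (_ : [set w | _] = setT `&` (fun w => enorm (w - c)) @^-1` [set r]); last by rewrite setTI.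
apply: (measurable_enorm _ measurableT) => //.
by apply: measurable_subrV => //; exact: measurable_id.
Qed.

(** The indicators converge off the preimage of the null set [Z], and confinement puts all the mass
    in a fixed ball, where [g k] tends to [c0] in L^1; the factor [c0] is then absorbed by [T]. *)
Lemma mass_cvg (b : nat -> V -> bool) (E Z : set V) (r : R) :
  (forall k, measurable_fun setT (b k)) -> measurable E -> measurable Z -> lam Z = 0%E ->
  (forall a, E a -> enorm a <= r) ->
  (\forall k \near \oo, forall w, b k w -> enorm (phi k w) <= r) ->
  (forall w, ~ Z (w *m T) -> \forall k \near \oo, b k w = (w *m T \in E)) ->
  (\int[lam]_w ((b k w)%:R * g k w)%:E @[k --> \oo] --> lam E)%E.
Proof.
move=> mb mE mZ Z0 Er br bE.
have [N0 N0P] := confined r; have [N1 N1P] := mulmx_confined r.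
pose N := maxn N0 N1.
have mD := @measurable_eball R m N; have Doo := @eball_lty R m N.
have H : (\int[lam]_(w in eball N) ((b k w)%:R * g k w)%:E @[k --> \oo] -->
    \int[lam]_(w in eball N) ((w *m T \in E)%:R * c0)%:E)%E.
  apply: L1_bounded_weight_cvg => //.
  - by move=> k; apply: measurable_funTS; exact: measurable_boolR.
  - apply: measurable_funTS.
    exact: (measurableT_comp (@measurable_indic _ V R setT E mE) (measurable_mulmx T)).
  - by move=> k w _; rewrite normr_nat lern1 leq_b1.
  - exists ((fun v => v *m T) @^-1` Z); split.
    + exact: preimage_mulmx_measurable.
    + exact: preimage_mulmx_null.
    + move=> w /=; apply: contra_notP => nZ _.
      apply: (@cvg_trans _ (((w *m T \in E)%:R : R) @[k --> \oo])); last exact: cvg_cst.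
      by apply: near_eq_cvg; have := bE w nZ; apply: filterS => k ->.
  - by move=> k; apply: integrableS (ig k).
  - exact: integrable_cst_lty.
have -> : lam E = (\int[lam]_(w in eball N) ((w *m T \in E)%:R * c0)%:E)%E.
  have mTE := preimage_mulmx_measurable mE.
  rewrite -lamT// -(setIidl (_ : (fun v => v *m T) @^-1` E `<=` eball N)); last first.
    by move=> w /= /Er /N1P wN; rewrite /eball/= (le_trans wN)// ler_nat leq_maxr.
  rewrite -integral_indic// -ge0_integralZl//; last 2 first.
  - by apply/measurable_EFinP; exact: measurable_indic.
  - by rewrite lee_fin ltW.
  by apply: eq_integral => w _; rewrite -EFinM mulrC indicE.
apply: cvg_trans H; apply: near_eq_cvg; near=> k.
rewrite integral_mkcond; apply: eq_integral => w _; rewrite patchE.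
case: ifPn => //; rewrite notin_setE /eball/= => wN.
have [->|gw] := eqVneq (g k w) 0; first by rewrite mulr0.
have [bw|] := boolP (b k w); last by rewrite mul0r.
exfalso; apply: wN; rewrite (@le_trans _ _ N0%:R) ?ler_nat ?leq_maxl//.
have N0k : forall w, g k w != 0 -> enorm (phi k w) <= r -> enorm w <= N0%:R by near: k.
apply: N0k => //.
have brk : forall w, b k w -> enorm (phi k w) <= r by near: k.
exact: brk.
Unshelve. all: by end_near. Qed.

Lemma enorm_phi_le (u : V) : \forall k \near \oo, enorm (phi k u) <= enorm (u *m T) / s + 1.
Proof.
by have := @phi1 u; move/cvgr_le; apply; rewrite ltrDl.
Qed.

Lemma in_nball_near c (u w : V) : enorm ((w - u) *m T) <> enorm (u *m T) ->
  \forall k \near \oo, in_nball c (phi k w) (phi k u) =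
    (w *m T \in euclidean_ball (u *m T) (enorm (u *m T))).
Proof.
move=> wu; have := @lte_if_near R c _ _ _ _ (@phiB w u) (@phi1 u).
rewrite (_ : (w *m T \in _) = (enorm ((w - u) *m T) / s < enorm (u *m T) / s)).
  by apply; apply/eqP => /mulIf; rewrite invr_eq0 gt_eqF// => /(_ isT).
rewrite ltr_pM2r ?invr_gt0// mulmxBl /euclidean_ball.
by apply/idP/idP; rewrite inE.
Qed.

Lemma volume_cvg (r : R) :
  (\int[lam]_w ((enorm (phi k w) <= r)%R%:R * g k w)%:E @[k --> \oo] --> lam (cball (r * s)))%E.
Proof.
apply: (@mass_cvg (fun k w => enorm (phi k w) <= r) _ [set w | enorm (w - 0) = r * s] (Num.max r (r * s))).
- by move=> k; apply: measurable_fun_ler => //; exact: measurable_enorm.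
- exact: measurable_cball.
- exact: measurable_sphere.
- exact: lebesgue_rV_sphere.
- by move=> a; rewrite /cball/= le_max => ->; rewrite orbT.
- by apply: nearW => k w H; rewrite le_max H.
- move=> w; rewrite /= subr0 => wr.
  have wr' : enorm (w *m T) / s != r.
    by apply/eqP => H; apply: wr; rewrite -H divfK// gt_eqF.
  have := @lte_if_near R true _ _ _ _ (@phi1 w) (cvg_cst r) wr'.
  move=> H; apply: filterS (H _) => k; rewrite /lte_if => ->.
  rewrite lt_neqAle wr' ler_pdivrMr//=.
  by apply/idP/idP; rewrite inE.
Qed.

(** This limit is the volume in the exponent of [limit_constant]; the exceptional set consists of
    the two bounding spheres. *)
Lemma nball_mass_cvg c (u v : V) :
  (\int[lam]_w ((in_nball c (phi k w) (phi k u) || in_nball c (phi k w) (phi k v))%:R * g k w)%:E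
    @[k --> \oo] --> lam (ball_pair (u *m T, v *m T)))%E.
Proof.
pose S (y : V) : set V := [set w | enorm (w - y) = enorm y].
(* A ball with the origin on its boundary lies within twice the norm of its centre; the [+ 1] leaves
   room for the convergence of [phi k u] and [phi k v]. *)
pose r1 := 2 * (enorm (u *m T) / s + 1) + 2 * (enorm (v *m T) / s + 1).
pose r := Num.max r1 (2 * (enorm (u *m T) + enorm (v *m T))).
apply: (@mass_cvg _ _ (S (u *m T) `|` S (v *m T)) r).
- move=> k; apply: measurable_or; apply: measurable_lte_if => //;
    by apply: measurable_enorm; apply: measurable_subrV => //; exact: mphi.
- exact: measurable_ball_pair.
- by apply: measurableU; exact: measurable_sphere.
- by apply: null_set_setU; [exact: measurable_sphere|exact: measurable_sphere|exact: lebesgue_rV_sphere|exact: lebesgue_rV_sphere].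
- by move=> a /ball_pair_bounded H; rewrite /r le_max H orbT.
- have H1 := enorm_phi_le u; have H2 := enorm_phi_le v.
  near=> k => w.
  have K1 : enorm (phi k u) <= enorm (u *m T) / s + 1 by near: k.
  have K2 : enorm (phi k v) <= enorm (v *m T) / s + 1 by near: k.
  have K (y : V) : in_nball c (phi k w) (phi k y) -> enorm (phi k w) <= 2 * enorm (phi k y).
    rewrite /in_nball /lte_if => H.
    have {}H : enorm (phi k w - phi k y) <= enorm (phi k y) by case: c H => // /ltW.
    by have := ler_enormD (phi k w - phi k y) (phi k y); rewrite subrK; lra.
  have := enorm_ge0 (phi k u); have := enorm_ge0 (phi k v) => ? ?.
  by rewrite /r le_max => /orP[/K|/K] H; apply/orP; left; rewrite /r1; lra.
- move=> w /not_orP[wu wv].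
  have := @in_nball_near c u w; have := @in_nball_near c v w.
  rewrite !mulmxBl => /(_ wv) Hv /(_ wu) Hu.
  by apply: filterS2 Hu Hv => k -> ->; rewrite /ball_pair in_setU.
Unshelve. all: by end_near. Qed.

(** [p k] stands for the probability that one sample point enters one of the two balls. [pE] is
    asked only for pairs within radius [r], whose balls will lie inside a chart. The balls are
    closed exactly when the comparison in [in_gamma] is strict, hence [~~ C]. *)
Variables (p : nat -> V * V -> R) (r : R) (C : bool) (j : nat).
Hypothesis mp : forall k, measurable_fun setT (p k).
Hypothesis p01 : forall k q, 0 <= p k q <= 1.
Hypothesis pE : \forall k \near \oo, forall u v,
  enorm (phi k u) <= r -> enorm (phi k v) <= r ->
  (n k)%:R * p k (u, v) = fine (\int[lam]_w
    ((in_nball (~~ C) (phi k w) (phi k u) || in_nball (~~ C) (phi k w) (phi k v))%:R * g k w)%:E).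

Lemma in_gammaE c d' (y z : 'rV[R]_d') : in_gamma c y z =
  lte_if c (enorm y) (enorm (y - z)) && lte_if c (enorm z) (enorm (y - z)).
Proof. by rewrite /in_gamma /lte_if; case: c; rewrite ?ge_max ?gt_max. Qed.

Definition pair_weight k (q : V * V) : R :=
  [&& enorm (phi k q.1) <= r, enorm (phi k q.2) <= r & in_gamma C (phi k q.1) (phi k q.2)]%:R *
  (1 - p k q) ^+ (n k - j).

Lemma measurable_pair_weight k : measurable_fun setT (pair_weight k).
Proof.
have m1 : measurable_fun setT (fun q : V * V => phi k q.1) by exact: measurableT_comp (mphi k) measurable_fst.
have m2 : measurable_fun setT (fun q : V * V => phi k q.2) by exact: measurableT_comp (mphi k) measurable_snd.
apply: measurable_funM.
  apply: measurable_boolR; apply: measurable_and.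
    by apply: measurable_fun_ler => //; exact: measurable_enorm.
  apply: measurable_and.
    by apply: measurable_fun_ler => //; exact: measurable_enorm.
  apply: measurable_lte_if.
    by apply: measurable_maxr; apply: measurable_enorm.
  by apply: measurable_enorm; exact: measurable_subrV.
by apply: measurable_funX; apply: measurable_funB => //; exact: mp.
Qed.

(** Pairs for which one of the comparisons defining the limit weight is a tie. *)
Definition pair_bad : set (V * V) :=
  [set q | [|| enorm q.1 == r * s, enorm q.2 == r * s,
     enorm (q.1 - q.2) == enorm q.1 | enorm (q.1 - q.2) == enorm q.2]].

(** Off ties the indicator is eventually constant. If it is 0, so is the limit; if it is 1, [pE]
    applies and the power tends to the exponential of minus the volume of the two balls. *)
Lemma pair_weight_cvg (u v : V) : ~ pair_bad (u *m T, v *m T) ->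
  pair_weight k (u, v) @[k --> \oo] --> pair_density (r * s) (u *m T, v *m T).
Proof.
move=> /negP; rewrite !negb_or /= => /and4P[ur vr uvu uvv].
have si : s^-1 != 0 by rewrite invr_eq0 gt_eqF.
have dv (a b : R) : (a / s < b / s) = (a < b) by rewrite ltr_pM2r ?invr_gt0.
have Hr (w : V) : enorm (w *m T) != r * s ->
    \forall k \near \oo, (enorm (phi k w) <= r) = (enorm (w *m T) <= r * s).
  move=> wr; have wr' : enorm (w *m T) / s != r.
    by apply: contra wr => /eqP <-; rewrite divfK// gt_eqF.
  have := @lte_if_near R true _ _ _ _ (@phi1 w) (cvg_cst r) wr'.
  move=> H; apply: filterS (H _) => k; rewrite /lte_if => ->.
  by rewrite lt_neqAle wr' ler_pdivrMr.
have Hg : \forall k \near \oo, in_gamma C (phi k u) (phi k v) = in_gamma false (u *m T) (v *m T).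
  have H1 := @lte_if_near R C _ _ _ _ (@phi1 u) (@phiB u v) _.
  have H2 := @lte_if_near R C _ _ _ _ (@phi1 v) (@phiB u v) _.
  rewrite !(inj_eq (mulIf si)) mulmxBl in H1 H2.
  have {}H1 := H1 _; have {}H2 := H2 _.
  near=> k; rewrite !in_gammaE; congr (_ && _).
    by rewrite -[RHS]dv -mulmxBl; near: k; rewrite mulmxBl; apply: H1; rewrite eq_sym.
  by rewrite -[RHS]dv -mulmxBl; near: k; rewrite mulmxBl; apply: H2; rewrite eq_sym.
pose b := [&& enorm (u *m T) <= r * s, enorm (v *m T) <= r * s & in_gamma false (u *m T) (v *m T)].
have Hb : \forall k \near \oo, [&& enorm (phi k u) <= r, enorm (phi k v) <= r & in_gamma C (phi k u) (phi k v)] = b.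
  by apply: filterS3 (Hr u ur) (Hr v vr) Hg => k -> -> ->.
rewrite /pair_density -/b.
have [b1|/negbTE b0] := boolP b; last first.
  rewrite mul0r; apply: (@cvg_trans _ ((0 : R) @[k --> \oo])); last exact: cvg_cst.
  apply: near_eq_cvg; apply: filterS Hb => k Hk.
  by rewrite /pair_weight /= Hk b0 mul0r.
have npa : (n k)%:R * p k (u, v) @[k --> \oo] --> fine (lam (ball_pair (u *m T, v *m T))).
  have := @nball_mass_cvg (~~ C) u v.
  rewrite -[X in _ --> X]fineK ?ge0_fin_numE ?ball_pair_lty//.
  move=> /fine_cvgP[_]; apply: cvg_trans; apply: near_eq_cvg.
  apply: filterS2 Hb pE => k Hk pEk /=; rewrite pEk//;
    by move: Hk; rewrite b1 => /and3P[].
have := pow_onem_cvg j noo (fun k => p01 k (u, v)) npa.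
rewrite mul1r; apply: cvg_trans; apply: near_eq_cvg.
by apply: filterS Hb => k Hk; rewrite /pair_weight /= Hk b1 mul1r.
Unshelve. all: by end_near. Qed.

Definition pair_bad_preimage : set (V * V) := [set q | pair_bad (q.1 *m T, q.2 *m T)].

(** With one vector suitably fixed, each of the four tie conditions puts the other on the preimage
    of a sphere. *)
Lemma pair_bad_preimage_null : measurable pair_bad_preimage /\ ((lam \x lam) pair_bad_preimage = 0)%E.
Proof.
have meq (f h : V * V -> R) : measurable_fun setT f -> measurable_fun setT h ->
    measurable [set q | f q = h q].
  move=> mf mh; rewrite (_ : [set q | _] = setT `&` [set q | f q == h q]).
    have := measurable_fun_eqr mf mh; move=> /(_ measurableT [set true]) H; exact: H.
  by rewrite setTI; apply/seteqP; split => q /= /eqP.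
have m1 : measurable_fun setT (fun q : V * V => q.1 *m T) by exact: measurableT_comp (measurable_mulmx T) measurable_fst.
have m2 : measurable_fun setT (fun q : V * V => q.2 *m T) by exact: measurableT_comp (measurable_mulmx T) measurable_snd.
pose E1 : set (V * V) := [set q | enorm (q.1 *m T) = r * s].
pose E2 : set (V * V) := [set q | enorm (q.2 *m T) = r * s].
pose E3 : set (V * V) := [set q | enorm (q.1 *m T - q.2 *m T) = enorm (q.1 *m T)].
pose E4 : set (V * V) := [set q | enorm (q.1 *m T - q.2 *m T) = enorm (q.2 *m T)].
have mE1 : measurable E1 by apply: meq => //; exact: measurable_enorm.
have mE2 : measurable E2 by apply: meq => //; exact: measurable_enorm.
have mE3 : measurable E3 by apply: meq; apply: measurable_enorm => //; exact: measurable_subrV.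
have mE4 : measurable E4 by apply: meq; apply: measurable_enorm => //; exact: measurable_subrV.
have S0 (c : V) (a : R) : lam ((fun v => v *m T) @^-1` [set w : V | enorm (w - c) = a]) = 0%E.
  by apply: preimage_mulmx_null; [exact: measurable_sphere|exact: lebesgue_rV_sphere].
have E10 : ((lam \x lam) E1 = 0)%E.
  apply: product_null_ysection => // y; rewrite -(S0 0 (r * s)); congr (lebesgue_rV m _).
  by apply/seteqP; split => w; rewrite /ysection/= inE /E1/= subr0.
have E20 : ((lam \x lam) E2 = 0)%E.
  apply: product_null_xsection => // y; rewrite -(S0 0 (r * s)); congr (lebesgue_rV m _).
  by apply/seteqP; split => w; rewrite /xsection/= inE /E2/= subr0.
have E30 : ((lam \x lam) E3 = 0)%E.
  apply: product_null_xsection => // y; rewrite -(S0 (y *m T) (enorm (y *m T))); congr (lebesgue_rV m _).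
  by apply/seteqP; split => w; rewrite /xsection/= inE /E3/= enormBC.
have E40 : ((lam \x lam) E4 = 0)%E.
  apply: product_null_ysection => // y; rewrite -(S0 (y *m T) (enorm (y *m T))); congr (lebesgue_rV m _).
  by apply/seteqP; split => w; rewrite /ysection/= inE /E4/=.
have -> : pair_bad_preimage = E1 `|` E2 `|` E3 `|` E4.
  apply/seteqP; split => q.
    by move=> /or4P[] /eqP H; [left; left; left|left; left; right|left; right|right].
  by move=> [[[|]|]|] H; apply/or4P; [apply: Or41|apply: Or42|apply: Or43|apply: Or44]; apply/eqP.
have mE12 : measurable (E1 `|` E2) by exact: measurableU.
have mE123 : measurable (E1 `|` E2 `|` E3) by exact: measurableU.
split; first exact: measurableU.
apply: (product_null_setU mE123 mE4 _ E40).
apply: (product_null_setU mE12 mE3 _ E30).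
exact: (product_null_setU mE1 mE2 E10 E20).
Qed.

(** Each of the two variables absorbs one factor [c0] in the change of variables by [T]. *)
Lemma pair_integral_mulmx (a : R) :
  (\int[lam \x lam]_q (pair_density a (q.1 *m T, q.2 *m T) * (c0 * c0))%:E = pair_integral m a)%E.
Proof.
have m1 : measurable_fun setT (fun q : V * V => q.1 *m T) by exact: measurableT_comp (measurable_mulmx T) measurable_fst.
have m2 : measurable_fun setT (fun q : V * V => q.2 *m T) by exact: measurableT_comp (measurable_mulmx T) measurable_snd.
have mT : measurable_fun setT (fun q : V * V => (q.1 *m T, q.2 *m T)) by exact: measurable_fun_pair.
have mpd := @measurable_pair_density R m a.
have mE : measurable_fun setT (fun q : V * V => (pair_density a q)%:E) by exact/measurable_EFinP.
have pd0 (q : V * V) : (0 <= (pair_density a q)%:E)%E by rewrite lee_fin pair_density_ge0.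
have mL : measurable_fun setT (fun q : V * V => (pair_density a (q.1 *m T, q.2 *m T) * (c0 * c0))%:E).
  by apply/measurable_EFinP; apply: measurable_funM => //; exact: measurableT_comp mpd mT.
rewrite (@fubini_tonelli1 _ _ _ _ _ lam lam _ mL); last first.
  by move=> q; rewrite lee_fin mulr_ge0 ?pair_density_ge0// mulr_ge0 ?ltW.
rewrite /pair_integral (@fubini_tonelli1 _ _ _ _ _ lam lam _ mE pd0).
pose F (u : V) := (\int[lam]_v (pair_density a (u, v))%:E)%E.
have mF : measurable_fun setT F by exact: (@measurable_fun_fubini_tonelli_F _ _ V V R lam _ mE pd0).
rewrite [RHS](_ : _ = \int[lam]_u F u)%E; last by apply: eq_integral.
rewrite -(integral_mulmx mF); last by move=> u; exact: integral_ge0.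
apply: eq_integral => u _; rewrite /fubini_F/= /F.
rewrite -(@integral_mulmx (fun v => (pair_density a (u *m T, v))%:E)) => [||v]; last first.
- by rewrite lee_fin pair_density_ge0.
- exact: measurableT_comp mE (measurable_pair1 _).
rewrite -ge0_integralZl//; last 3 first.
- apply: measurable_funeM; apply: (measurableT_comp mE).
  by apply: measurable_fun_pair => //; exact: measurable_mulmx.
- by move=> v _; rewrite mule_ge0// lee_fin ltW.
- by rewrite lee_fin ltW.
by apply: eq_integral => v _; rewrite -!EFinM; congr EFin; ring.
Qed.

Lemma pair_weight_bounded k q : 0 <= pair_weight k q <= 1.
Proof.
have /andP[p0 p1] := p01 k q.
have q0 : 0 <= 1 - p k q by rewrite subr_ge0.
rewrite /pair_weight mulr_ge0 ?exprn_ge0//= mulr_ile1 ?exprn_ge0 ?lern1 ?leq_b1//.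
by rewrite exprn_ile1// gerBl.
Qed.

(** From [a b - c^2 = (a - c)(b - c) + (a - c) c + c (b - c)]; the three terms are products of
    one-variable functions. *)
Lemma product_density_L1 N : (\int[lam \x lam]_(q in eball N `*` eball N)
  `|g k q.1 * g k q.2 - c0 * c0|%:E @[k --> \oo] --> 0)%E.
Proof.
have mD := @measurable_eball R m N; have Doo := @eball_lty R m N.
have mDD : measurable (@eball R m N `*` @eball R m N) by exact: measurableX.
pose e k := (\int[lam]_(w in eball N) `|g k w - c0|%:E)%E.
have ec : (e k @[k --> \oo] --> 0)%E by exact: gc0.
have me k : measurable_fun setT (fun w => `|g k w - c0|%:E).
  by apply/measurable_EFinP; apply: measurableT_comp => //; exact: measurable_funB.
pose A k (w : V) := `|g k w - c0|%:E.
have A0 k w : (0 <= A k w)%E by rewrite lee_fin.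
pose f1 k (q : V * V) := (A k q.1 * A k q.2)%E.
pose f2 k (q : V * V) := (A k q.1 * cst c0%:E q.2)%E.
pose f3 k (q : V * V) := (cst c0%:E q.1 * A k q.2)%E.
have mA1 k : measurable_fun setT (fun q : V * V => A k q.1) by exact: measurableT_comp (me k) measurable_fst.
have mA2 k : measurable_fun setT (fun q : V * V => A k q.2) by exact: measurableT_comp (me k) measurable_snd.
have mf1 k : measurable_fun (eball N `*` eball N) (f1 k) by apply: measurable_funTS; exact: emeasurable_funM.
have mf2 k : measurable_fun (eball N `*` eball N) (f2 k).
  by apply: measurable_funTS; apply: emeasurable_funM => //; exact: measurable_cst.
have mf3 k : measurable_fun (eball N `*` eball N) (f3 k).
  by apply: measurable_funTS; apply: emeasurable_funM => //; exact: measurable_cst.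
have c0e : (0 <= c0%:E)%E by rewrite lee_fin ltW.
have f10 k q : (0 <= f1 k q)%E by rewrite mule_ge0.
have f20 k q : (0 <= f2 k q)%E by rewrite mule_ge0.
have f30 k q : (0 <= f3 k q)%E by rewrite mule_ge0.
have If1 k : (\int[lam \x lam]_(q in eball N `*` eball N) f1 k q = e k * e k)%E.
  exact: (integral_prodset_mul lam lam mD mD (me k) (me k) (A0 k) (A0 k)).
have cI : (\int[lam]_(w in eball N) cst c0%:E w = c0%:E * lam (@eball R m N))%E.
  by rewrite integral_cst.
have If2 k : (\int[lam \x lam]_(q in eball N `*` eball N) f2 k q = e k * (c0%:E * lam (@eball R m N)))%E.
  rewrite -cI; apply: (integral_prodset_mul lam lam mD mD (me k) _ (A0 k)) => //; exact: measurable_cst.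
have If3 k : (\int[lam \x lam]_(q in eball N `*` eball N) f3 k q = c0%:E * lam (@eball R m N) * e k)%E.
  rewrite -cI; apply: (integral_prodset_mul lam lam mD mD _ (me k) _ (A0 k)) => //; exact: measurable_cst.
have bnd k : (\int[lam \x lam]_(q in eball N `*` eball N) `|g k q.1 * g k q.2 - c0 * c0|%:E <=
    e k * e k + e k * (c0%:E * lam (@eball R m N)) + c0%:E * lam (@eball R m N) * e k)%E.
  rewrite -If1 -If2 -If3.
  rewrite -(ge0_integralD (lam \x lam)%E mDD (fun q _ => f10 k q) (mf1 k) (fun q _ => f20 k q) (mf2 k)).
  have f120 q : (0 <= f1 k q + f2 k q)%E by rewrite adde_ge0.
  rewrite -(ge0_integralD (lam \x lam)%E mDD (fun q _ => f120 q) (emeasurable_funD (mf1 k) (mf2 k)) (fun q _ => f30 k q) (mf3 k)).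
  apply: ge0_le_integral => //.
  - apply: measurable_funTS; apply/measurable_EFinP; apply: measurableT_comp => //.
    apply: measurable_funB => //; apply: measurable_funM.
      exact: measurableT_comp (mg k) measurable_fst.
    exact: measurableT_comp (mg k) measurable_snd.
  - by apply: emeasurable_funD; [exact: emeasurable_funD|].
  - move=> q _; rewrite /f1 /f2 /f3 /A -!EFinM -!EFinD lee_fin.
    have -> : g k q.1 * g k q.2 - c0 * c0 =
      (g k q.1 - c0) * (g k q.2 - c0) + (g k q.1 - c0) * c0 + c0 * (g k q.2 - c0) by ring.
    rewrite (le_trans (ler_normD _ _))// lerD//; last by rewrite normrM gtr0_norm.
    by rewrite (le_trans (ler_normD _ _))// normrM lerD2l normrM (gtr0_norm c00).
have lf : lam (@eball R m N) \is a fin_num by rewrite ge0_fin_numE.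
have cf : (c0%:E * lam (@eball R m N))%E \is a fin_num by rewrite fin_numM.
have L : (e k * e k + e k * (c0%:E * lam (@eball R m N)) + c0%:E * lam (@eball R m N) * e k @[k --> \oo] -->
    0 * 0 + 0 * (c0%:E * lam (@eball R m N)) + c0%:E * lam (@eball R m N) * 0)%E.
  apply: cvgeD; first by rewrite !mul0e mule0.
    apply: cvgeD; first by rewrite !mul0e.
      by apply: cvgeM => //; rewrite mule_def_fin.
    exact: cvgeZr.
  exact: cvgeZl.
rewrite !mul0e !mule0 !adde0 in L.
apply: (squeeze_cvge _ (cvg_cst 0%E) L); apply: nearW => k.
by rewrite integral_ge0//= bnd.
Qed.

(** Outside a fixed product of balls both integrands vanish, the left one by [confined] and the
    right one by [mulmx_confined]. On this product the weights converge almost everywhere and the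
    densities in L^1. *)
Lemma pair_limit :
  (\int[lam \x lam]_q (pair_weight k q * (g k q.1 * g k q.2))%:E @[k --> \oo] --> pair_integral m (r * s))%E.
Proof.
have [N0 N0P] := confined r; have [N1 N1P] := mulmx_confined (r * s).
pose N := maxn N0 N1.
have mD := @measurable_eball R m N; have Doo := @eball_lty R m N.
pose D2 := @eball R m N `*` @eball R m N.
have mD2 : measurable D2 by exact: measurableX.
have D2oo : ((lam \x lam) D2 < +oo)%E by rewrite product_measure1E// lte_mul_pinfty// ge0_fin_numE.
have m1 : measurable_fun setT (fun q : V * V => q.1 *m T) by exact: measurableT_comp (measurable_mulmx T) measurable_fst.
have m2 : measurable_fun setT (fun q : V * V => q.2 *m T) by exact: measurableT_comp (measurable_mulmx T) measurable_snd.
have mT : measurable_fun setT (fun q : V * V => (q.1 *m T, q.2 *m T)) by exact: measurable_fun_pair.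
have mgg k : measurable_fun setT (fun q : V * V => g k q.1 * g k q.2).
  by apply: measurable_funM; [exact: measurableT_comp (mg k) measurable_fst|exact: measurableT_comp (mg k) measurable_snd].
have gfin k : (\int[lam]_(w in eball N) (g k w)%:E < +oo)%E.
  have /integrableP[_] := integrableS measurableT mD (@subsetT _ _) (ig k).
  by under eq_integral do rewrite gee0_abs ?lee_fin//.
have H : (\int[lam \x lam]_(q in D2) (pair_weight k q * (g k q.1 * g k q.2))%:E @[k --> \oo] -->
    \int[lam \x lam]_(q in D2) (pair_density (r * s) (q.1 *m T, q.2 *m T) * (c0 * c0))%:E)%E.
  apply: (@L1_bounded_weight_cvg _ _ R (lam \x lam)%E D2 mD2 pair_weight
    (fun q => pair_density (r * s) (q.1 *m T, q.2 *m T)) (fun k q => g k q.1 * g k q.2) (fun=> c0 * c0)).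
  - by move=> k; apply: measurable_funTS; exact: measurable_pair_weight.
  - by apply: measurable_funTS; exact: measurableT_comp (@measurable_pair_density R m _) mT.
  - by move=> k q _; have /andP[w0 w1] := pair_weight_bounded k q; rewrite ger0_norm.
  - have [mB B0] := pair_bad_preimage_null.
    exists pair_bad_preimage; split => // q /=; apply: contra_notP => nB _.
    by case: q nB => u v nB; exact: pair_weight_cvg.
  - move=> k; apply/integrableP; split.
      by apply: measurable_funTS; apply/measurable_EFinP; exact: mgg.
    rewrite (_ : (\int[lam \x lam]_(q in D2) _ = \int[lam \x lam]_(q in D2) ((EFin \o g k) q.1 * (EFin \o g k) q.2))%E); last first.
      by apply: eq_integral => q _; rewrite /= ger0_norm ?mulr_ge0// EFinM.
    rewrite (@integral_prodset_mul _ _ _ _ R lam lam _ _ (EFin \o g k) (EFin \o g k))//.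
    + have I0 : (0 <= \int[lam]_(w in eball N) (g k w)%:E)%E.
        by apply: integral_ge0 => w _; rewrite lee_fin.
      apply: lte_mul_pinfty => //; last exact: gfin.
      by rewrite ge0_fin_numE//; exact: gfin.
    + exact/measurable_EFinP.
    + exact/measurable_EFinP.
    + by move=> x; rewrite lee_fin.
    + by move=> x; rewrite lee_fin.
  - exact: integrable_cst_lty.
  - exact: product_density_L1.
have <- : (\int[lam \x lam]_(q in D2) (pair_density (r * s) (q.1 *m T, q.2 *m T) * (c0 * c0))%:E =
    pair_integral m (r * s))%E.
  rewrite -pair_integral_mulmx integral_mkcond; apply: eq_integral => -[u v] _; rewrite patchE.
  case: ifPn => //; rewrite notin_setE /D2 /eball/= => uv.
  rewrite /pair_density/=; have [ur|] := boolP (enorm (u *m T) <= r * s); last by rewrite !mul0r.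
  have [vr|] := boolP (enorm (v *m T) <= r * s); last by rewrite !mul0r.
  exfalso; apply: uv; split; rewrite (@le_trans _ _ N1%:R) ?N1P// ler_nat leq_maxr//.
apply: cvg_trans H; apply: near_eq_cvg; near=> k.
rewrite integral_mkcond; apply: eq_integral => -[u v] _; rewrite patchE.
case: ifPn => //; rewrite notin_setE /D2 /eball/= => uv.
have [->|gu] := eqVneq (g k u) 0; first by rewrite mul0r mulr0.
have [->|gv] := eqVneq (g k v) 0; first by rewrite !mulr0.
rewrite /pair_weight/=.
have N0k : forall w, g k w != 0 -> enorm (phi k w) <= r -> enorm w <= N0%:R by near: k.
have [ur|] := boolP (enorm (phi k u) <= r); last by rewrite !mul0r.
have [vr|] := boolP (enorm (phi k v) <= r); last by rewrite !mul0r.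
by exfalso; apply: uv; split; rewrite (@le_trans _ _ N0%:R) ?N0k// ler_nat leq_maxl.
Unshelve. all: by end_near. Qed.

End local_limit.

(** * Deterministic bounds on the number of triples *)

Section kissing.
Context {R : realType} (d : nat).
Local Notation V := 'rV[R]_d.

(** Number of cells of a grid of mesh [1/(d+1)] on the cube of side 2: the integer part of a number
    between 0 and [2(d+1)] takes at most [2(d+1)+1] values. It is only an upper bound of the kissing
    number. *)
Definition kissing_bound : nat := ((2 * d.+1).+1 ^ d)%N.

(** In the triangle with vertices 0, [u], [v] the side [u - v] is a longest one, so the angle at 0
    is at least 60 degrees: by the law of cosines [2 <u,v>] is at most the smaller squared norm. *)
Lemma unit_far (u v : V) : u != 0 -> v != 0 ->
  enorm u <= enorm (u - v) -> enorm v <= enorm (u - v) ->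
  1 <= enorm ((enorm u)^-1 *: u - (enorm v)^-1 *: v).
Proof.
move=> u0 v0 hu hv.
have pu : 0 < enorm u by rewrite lt_def enorm_ge0 enorm_eq0 u0.
have pv : 0 < enorm v by rewrite lt_def enorm_ge0 enorm_eq0 v0.
rewrite -(@ler_pXn2r _ 2)// ?nnegrE ?enorm_ge0// expr1n enorm_sqB.
rewrite !enormZ !ger0_norm ?invr_ge0 ?enorm_ge0// !mulVf ?gt_eqF//.
rewrite edotZl edotC edotZl edotC.
suff : 2 * edot u v <= enorm u * enorm v.
  move=> H; have : 2 * edot u v / (enorm u * enorm v) <= 1 by rewrite ler_pdivrMr ?mulr_gt0// mul1r.
  rewrite invfM; lra.
have := enorm_sqB u v; have hu2 : enorm u ^+ 2 <= enorm (u - v) ^+ 2.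
  by rewrite ler_pXn2r ?nnegrE ?enorm_ge0.
have hv2 : enorm v ^+ 2 <= enorm (u - v) ^+ 2 by rewrite ler_pXn2r ?nnegrE ?enorm_ge0.
have [uv|vu] := lerP (enorm u) (enorm v).
  have : enorm u * enorm u <= enorm u * enorm v by rewrite ler_pM2l.
  by rewrite !expr2 in hu2 hv2 *; lra.
have : enorm v * enorm v <= enorm u * enorm v by rewrite ler_pM2r// ltW.
by rewrite !expr2 in hu2 hv2 *; lra.
Qed.

(* The vectors u i / |u i| are at mutual distance at least 1, so each cube of a
   grid of mesh 1 / (d + 1) contains at most one of them. *)
Lemma kissing (I : finType) (S : {set I}) (u : I -> V) :
  (forall i, i \in S -> u i != 0) ->
  (forall i j, i \in S -> j \in S -> i != j -> enorm (u i) <= enorm (u i - u j)) ->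
  (#|S| <= kissing_bound)%N.
Proof.
move=> u0 far.
pose e i := (enorm (u i))^-1 *: u i.
have e1 i k : i \in S -> `|e i ord0 k| <= 1.
  move=> iS; rewrite (le_trans (coord_le_enorm _ _))// enormZ ger0_norm ?invr_ge0 ?enorm_ge0//.
  by rewrite mulVf// enorm_eq0 u0.
pose c : R := d.+1%:R.
have c0 : 0 < c by rewrite ltr0n.
pose y i k := c * (e i ord0 k + 1).
have y0 i k : i \in S -> 0 <= y i k.
  by move=> /(e1 i k); rewrite ler_norml => /andP[H _]; rewrite mulr_ge0 ?(ltW c0)//; lra.
have y2 i k : i \in S -> (Num.truncn (y i k) < (2 * d.+1).+1)%N.
  move=> iS; rewrite ltnS -(ler_nat R); have /andP[le_y _] := truncn_itv (y0 i k iS).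
  rewrite (le_trans le_y)// natrM mulrC ler_pM2l//; have := e1 i k iS; rewrite ler_norml => /andP[_ H]; lra.
pose cell i : {ffun 'I_d -> 'I_(2 * d.+1).+1} := [ffun k => inord (Num.truncn (y i k))].
have inj : {in S &, injective cell}.
  move=> i j iS jS cij; apply/eqP/negPn/negP => ij.
  have H1 : 1 <= enorm (e i - e j).
    apply: unit_far; rewrite ?u0 ?far//.
    by rewrite enormBC far// eq_sym.
  have H2 k : `|e i ord0 k - e j ord0 k| <= c^-1.
    have tk : Num.truncn (y i k) = Num.truncn (y j k).
      move/ffunP : cij => /(_ k); rewrite !ffunE => /(congr1 val) /=.
      by rewrite !inordK ?y2.
    have /andP[a1 a2] := truncn_itv (y0 i k iS).
    have /andP[b1 b2] := truncn_itv (y0 j k jS).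
    rewrite tk in a1 a2.
    have : `|y i k - y j k| <= 1.
      by rewrite ler_norml; move: a1 a2 b1 b2; rewrite -natr1 => *; apply/andP; split; lra.
    rewrite /y -mulrBr (_ : e i ord0 k + 1 - (e j ord0 k + 1) = e i ord0 k - e j ord0 k); last by ring.
    by rewrite normrM gtr0_norm// -ler_pdivlMl// mulr1.
  (* The choice of the mesh: [d] coordinates differing by at most [1/(d+1)] give a squared distance
     at most [d/(d+1)^2]. *)
  have : enorm (e i - e j) ^+ 2 < 1.
    rewrite -edotE (@le_lt_trans _ _ (\sum_(k < d) c^-1 ^+ 2))//.
      apply: ler_sum => k _; rewrite -expr2 -real_normK ?num_real// mxE [X in _ + X]mxE.
      by rewrite ler_pXn2r ?nnegrE ?invr_ge0 ?(ltW c0)// H2.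
    rewrite sumr_const card_ord -mulr_natl exprVn ltr_pdivrMr ?exprn_gt0// mul1r expr2.
    by rewrite -natrM ltr_nat mulnS; lia.
  have : 1 <= enorm (e i - e j) ^+ 2 by rewrite expr2 mulr_ege1.
  by rewrite leNgt => /negP.
rewrite -(card_in_imset inj) (leq_trans (max_card _))//.
by rewrite card_ffun !card_ord.
Qed.

(** Serves twice: [y] is a sample point when long edges are counted, and an extra point when stars
    around a given centre are bounded. *)
Lemma nearest_indegree (I : finType) (S : {set I}) (x : I -> V) (y : V) :
  (forall i, i \in S -> x i != y) ->
  (forall i j, i \in S -> j \in S -> i != j -> enorm (x i - y) <= enorm (x i - x j)) ->
  (#|S| <= kissing_bound)%N.
Proof.
move=> xy H; apply: (@kissing _ S (fun i => x i - y)) => [i iS|i j iS jS ij].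
  by rewrite subr_eq0 xy.
by rewrite opprB addrA subrK H.
Qed.

End kissing.

Section counting.
Context {R : realType} (d n : nat).
Local Notation V := 'rV[R]_d.
Variable nn : n.-tuple V -> 'I_n -> 'I_n.
Hypothesis nn_rule : nearest_neighbor_rule nn.
Hypothesis n_gt1 : (1 < n)%N.
Implicit Types x : n.-tuple V.

(* For C = false the inequalities are such that a star is a pair of edges i -> k,
   j -> k whatever the rule for ties; for C = true such that any pair of edges
   i -> k, j -> k of length at most r is a star. *)
Definition star (C : bool) (r : R) x (i j k : 'I_n) : bool :=
  [&& [&& i != j, i != k & j != k],
      [&& enorm (tnth x i - tnth x k) <= r, enorm (tnth x j - tnth x k) <= r &
          in_gamma C (tnth x i - tnth x k) (tnth x j - tnth x k)] &
      [forall l, [|| l == i, l == j, l == k |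
        ~~ (in_nball (~~ C) (tnth x l - tnth x k) (tnth x i - tnth x k) ||
            in_nball (~~ C) (tnth x l - tnth x k) (tnth x j - tnth x k))]]].

Definition isolated (r : R) x (i : 'I_n) : bool :=
  [forall l, (l == i) || ~~ (enorm (tnth x l - tnth x i) <= r)].

Lemma countE x : shared_target_count (nn_edge nn x) =
  (\sum_i \sum_j \sum_k [&& [&& i != j, i != k & j != k], nn x i == k & nn x j == k])%N.
Proof.
rewrite /shared_target_count -sum1_card big_mkcond/= pair_big/= pair_big/=.
apply: eq_bigr => -[[i j] k] _.
have -> : ((i, j, k) \in [set t : 'I_n * 'I_n * 'I_n | let: (i, j, k) := t in
      [&& i != j, i != k, j != k, nn_edge nn x i k & nn_edge nn x j k]]) =
      [&& i != j, i != k, j != k, nn_edge nn x i k & nn_edge nn x j k].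
  by apply/idP/idP; rewrite inE.
rewrite /nn_edge/=.
rewrite (eq_sym k (nn x i)) (eq_sym k (nn x j)) (eq_sym k i) (eq_sym k j).
by case: (i != j); case: (i != k); case: (j != k); case: (nn x i == k); case: (nn x j == k).
Qed.

(** In a strict star no other point is as close to [i] or [j] as [k] is, so any rule for ties
    selects [k]. *)
Lemma count_ge x (r : R) :
  (\sum_i \sum_j \sum_k star false r x i j k <= shared_target_count (nn_edge nn x))%N.
Proof.
rewrite countE; apply: leq_sum => i _; apply: leq_sum => j _; apply: leq_sum => k _.
have [/and3P[/and3P[ij ik jk] /and3P[_ _ g] /forallP H]|//] := boolP (star _ _ _ _ _ _).
have K (a b : 'I_n) : a != k -> b != a -> 
    enorm (tnth x a - tnth x k) < enorm (tnth x a - tnth x b) ->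
    (forall l, l != i -> l != j -> l != k -> enorm (tnth x a - tnth x k) < enorm (tnth x a - tnth x l)) ->
    ((a == i) && (b == j)) || ((a == j) && (b == i)) -> nn x a == k.
  move=> ak ba ab Hl abij; have [_ /(_ n_gt1 x a)[na /(_ k)]] := nn_rule.
  rewrite eq_sym ak => /(_ isT) le; apply/negPn/negP => nk.
  have : enorm (tnth x a - tnth x k) < enorm (tnth x a - tnth x (nn x a)).
    have [->//|nb] := eqVneq (nn x a) b.
    by case/orP: abij => /andP[/eqP ai /eqP bj]; apply: Hl; rewrite // -?ai -?bj.
  by rewrite ltNge le.
have g' : enorm (tnth x i - tnth x k) < enorm (tnth x i - tnth x j) /\
    enorm (tnth x j - tnth x k) < enorm (tnth x i - tnth x j).
  by move: g; rewrite /in_gamma /lte_if gt_max opprB addrA subrK => /andP[].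
have Hl l : l != i -> l != j -> l != k -> enorm (tnth x i - tnth x k) < enorm (tnth x i - tnth x l) /\
    enorm (tnth x j - tnth x k) < enorm (tnth x j - tnth x l).
  move=> /negbTE li /negbTE lj /negbTE lk; have := H l; rewrite li lj lk /=.
  rewrite /in_nball /lte_if /= negb_or -!ltNge !opprB !addrA !subrK => /andP[h1 h2].
  by rewrite (enormBC (tnth x i) (tnth x l)) (enormBC (tnth x j) (tnth x l)).
have -> : nn x i == k.
  apply: (K i j) => //; rewrite ?eqxx ?orbT//; first by rewrite eq_sym.
    by case: g'.
  by move=> l li lj lk; case: (Hl l).
have -> : nn x j == k.
  apply: (K j i) => //; rewrite ?eqxx ?orbT//.
    by rewrite (enormBC (tnth x j) (tnth x i)); case: g'.
  by move=> l li lj lk; case: (Hl l).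
by rewrite ij ik jk.
Qed.

(** Two edges of length at most [r] into [k] form a large star. Otherwise one edge starts from a
    point with no other point within [r]; this point determines [k], and the second edge has at most
    [kissing_bound d] origins. *)
Lemma count_le x (r : R) : (forall i j, i != j -> tnth x i != tnth x j) ->
  (shared_target_count (nn_edge nn x) <=
   \sum_i \sum_j \sum_k star true r x i j k +
   (2 * kissing_bound d) * \sum_i isolated r x i)%N.
Proof.
move=> xinj; rewrite countE.
have [_ /(_ n_gt1 x) nnP] := nn_rule.
pose far i := ~~ (enorm (tnth x i - tnth x (nn x i)) <= r).
(* Pairs of edges whose first one is long; exchanging [i] and [j] gives the other case, whence the
   factor 2. *)
pose F1 (i j k : 'I_n) : bool := [&& far i, j != nn x i, nn x j == nn x i & k == nn x i].
have S1 : (\sum_i \sum_j \sum_k F1 i j k <= kissing_bound d * \sum_i isolated r x i)%N.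
  rewrite big_distrr/=; apply: leq_sum => i _.
  have [fi|fi] := boolP (far i); last first.
    rewrite big1// => j _; rewrite big1// => k _.
    by rewrite /F1 (negbTE fi).
  have -> : isolated r x i.
    apply/forallP => l; have [->|li]//= := eqVneq l i.
    have [_ /(_ l li)] := nnP i; rewrite /far -ltNge in fi.
    by move=> H; rewrite -ltNge enormBC (lt_le_trans fi).
  rewrite muln1.
  have -> : (\sum_j \sum_k F1 i j k = #|[set j | (j != nn x i) && (nn x j == nn x i)]%SET|)%N.
    rewrite -sum1_card [RHS]big_mkcond; apply: eq_bigr => j _.
    rewrite (bigD1 (nn x i))//= big1 ?addn0 => [|k /negbTE ki]; last first.
      by rewrite /F1 ki !andbF.
    by rewrite /F1 fi eqxx andbT/= inE; case: (_ && _).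
  apply: (@nearest_indegree R d _ _ (fun j => tnth x j) (tnth x (nn x i))) => [j|a b].
    by rewrite inE => /andP[ji _]; exact: xinj.
  rewrite !inE => /andP[an /eqP na] /andP[bn /eqP nb] ab.
  by have [_ /(_ b)] := nnP a; rewrite na eq_sym; apply.
have S2 : (\sum_i \sum_j \sum_k F1 j i k <= kissing_bound d * \sum_i isolated r x i)%N.
  by rewrite exchange_big.
rewrite mul2n -addnn mulnDl.
apply: (@leq_trans (\sum_i \sum_j \sum_k (star true r x i j k + (F1 i j k + F1 j i k)))%N); last first.
  under eq_bigr do under eq_bigr do rewrite !big_split/=.
  under eq_bigr do rewrite !big_split/=.
  by rewrite !big_split/= leq_add2l leq_add.
apply: leq_sum => i _; apply: leq_sum => j _; apply: leq_sum => k _.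
have [/and3P[/and3P[ij ik jk] /eqP ni /eqP nj]|//] := boolP (_ && _).
have [fi|fi] := boolP (far i).
  have -> : F1 i j k by rewrite /F1 fi ni nj eqxx jk.
  by rewrite /=; lia.
have [fj|fj] := boolP (far j).
  have -> : F1 j i k by rewrite /F1 fj ni nj eqxx ik.
  by rewrite /=; lia.
suff -> : star true r x i j k by rewrite /=; lia.
rewrite /star ij ik jk/=.
rewrite /far ni negbK in fi; rewrite /far nj negbK in fj; rewrite fi fj /=.
have [_ Hi] := nnP i; have [_ Hj] := nnP j; rewrite ni in Hi; rewrite nj in Hj.
apply/andP; split.
  rewrite /in_gamma /lte_if ge_max opprB addrA subrK Hi ?(eq_sym j)//=.
  by rewrite (enormBC (tnth x i)) Hj.
apply/forallP => l; have [//|li]/= := eqVneq l i; have [//|lj]/= := eqVneq l j.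
have [//|lk]/= := eqVneq l k.
rewrite /in_nball /lte_if /= negb_or -!leNgt !opprB !addrA !subrK.
by rewrite (enormBC (tnth x l)) Hi//= (enormBC (tnth x l)) Hj.
Qed.

End counting.

(** * Integration over independent samples *)

Section independent_sample.
Context {R : realType} dO (Omega : measurableType dO) (P : probability Omega R).
Context dV (V : measurableType dV) (X : nat -> {mfun Omega >-> V}).
Variable mu : probability V R.
Hypothesis law : forall i A, measurable A -> P (X i @^-1` A) = mu A.
Hypothesis indep : mutually_independent P (fun i => X i : Omega -> V).

(** [Y] has law [nu] and is independent of the family of the [X l] with [l] in [s]. Points can then
    be moved from [s] into [Y] one at a time, which avoids the joint law of the whole sample. *)
Definition independent_of dT (T : measurableType dT)
    (nu : probability T R) (Y : Omega -> T) (s : seq nat) :=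
  measurable_fun setT Y /\
  forall A (B : nat -> set V), measurable A -> (forall l, measurable (B l)) ->
  P (Y @^-1` A `&` [set w | forall l, l \in s -> B l (X l w)]) =
  (nu A * \prod_(l <- s) mu (B l))%E.

Lemma independent_of_sample k s : uniq (k :: s) -> independent_of mu (X k) s.
Proof.
move=> us; split; first exact: measurable_funPT.
move=> A B mA mB.
pose J : {fset nat} := [fset l in k :: s]%fset.
have := indep J (A := fun l => if l == k then A else B l) _.
have -> : \bigcap_(i in [set` J]) (X i @^-1` (if i == k then A else B i)) =
    X k @^-1` A `&` [set w | forall l, l \in s -> B l (X l w)].
  apply/seteqP; split => [w H|w [Hk Hs] l].
    split; first by have := H k; rewrite /= !inE eqxx => /(_ isT).
    move=> l ls; have := H l; rewrite /= !inE ls orbT => /(_ isT).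
    by case: eqVneq ls => // ->; move: us => /= /andP[/negbTE ->].
  rewrite /= !inE; case: eqVneq => [-> _//|_ /=]; exact: Hs.
move=> ->; last by move=> l; case: ifP.
have -> : (\prod_(i <- J) P (X i @^-1` (if i == k then A else B i)) =
   \prod_(i <- k :: s) P (X i @^-1` (if i == k then A else B i)))%E.
  by apply: perm_big; apply: uniq_perm; rewrite ?fset_uniq// => l; rewrite !inE.
rewrite big_cons eqxx law//; congr (_ * _)%E.
apply: eq_big_seq => l ls; rewrite law; last by case: ifP.
by case: eqVneq ls => // ->; move: us => /= /andP[/negbTE ->].
Qed.

Lemma measure_unique_prod dT (T : measurableType dT) (m1 m2 : {measure set (T * V) -> \bar R}) :
  (m1 setT < +oo)%E ->
  (forall A B, measurable A -> measurable B -> m1 (A `*` B) = m2 (A `*` B)) ->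
  forall C, measurable C -> m1 C = m2 C.
Proof.
move=> m1oo m12 C mC.
pose G := [set A `*` B | A in @measurable _ T & B in @measurable _ V].
apply: (measure_unique G (fun=> setT)) => //.
- exact: measurable_prod_measurableType.
- move=> _ _ [A mA [B mB <-]] [A' mA' [B' mB' <-]]; rewrite -setXI.
  by exists (A `&` A'); [exact: measurableI|exists (B `&` B') => //; exact: measurableI].
- by move=> _; exists setT => //; exists setT => //; rewrite setXTT.
- by apply/seteqP; split => // x _; exists 0%N.
- by move=> _ [A mA [B mB <-]]; exact: m12.
Qed.

(** For a fixed event on the remaining points, both sides are finite measures of [C] that agree on
    rectangles. *)
Lemma independent_of_cons dT (T : measurableType dT) (nu : probability T R) Y l s :
  uniq (l :: s) -> independent_of nu Y (l :: s) ->
  independent_of (nu \x mu)%E (fun w => (Y w, X l w)) s.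
Proof.
move=> us [mY HY].
have mYX : measurable_fun setT (fun w => (Y w, X l w)).
  by apply: measurable_fun_pair => //; exact: measurable_funPT.
split => // C B mC mB.
pose E := [set w | forall l, l \in s -> B l (X l w)].
have mE : measurable E.
  rewrite (_ : E = \big[setI/setT]_(l <- s) (X l @^-1` B l)); last by rewrite -bigcap_seq.
  apply: bigsetI_measurable => i _; rewrite -[X in measurable X]setTI.
  exact: measurable_funPT.
have q_fin : (\prod_(i <- s) mu (B i))%E \is a fin_num.
  by elim/big_ind : _ => // [x y|i _]; [exact: fin_numM|exact: fin_num_measure].
have q_ge0 : 0 <= fine (\prod_(i <- s) mu (B i))%E.
  by rewrite fine_ge0// prode_ge0.
(* [m1] is the image of [P] restricted to the event [E], and [m2] is the product law scaled by the
   probability of [E]. *)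
pose m1 := image_measure (mrestr P mE) mYX.
pose m2 : {measure set (T * V) -> \bar R} := mscale (NngNum q_ge0) (nu \x mu)%E.
have -> : P ((fun w => (Y w, X l w)) @^-1` C `&` E) = m1 C by [].
transitivity (m2 C); last by rewrite /m2 /= /mscale /= fineK// muleC.
apply: (@measure_unique_prod _ _ m1 m2) => //.
  rewrite /m1 image_measureE (@le_lt_trans _ _ 1%E) ?ltry//.
  by apply: probability_le1; apply: measurableI => //; rewrite preimage_setT.
move=> A D mA mD; transitivity (nu A * mu D * \prod_(i <- s) mu (B i))%E; last first.
  by rewrite /m2 /= /mscale /= fineK// muleC; congr (_ * _)%E; rewrite -product_measure1E.
rewrite -muleA [X in (_ * X)%E](_ : _ =
   \prod_(i <- l :: s) mu (if i == l then D else B i))%E; last first.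
  rewrite big_cons eqxx; congr (_ * _)%E; apply: eq_big_seq => i si.
  by case: eqVneq si => // ->; move: us => /= /andP[/negbTE ->].
rewrite -HY//; last by move=> i; case: ifP.
rewrite /m1 image_measureE /mrestr /=; congr (P _).
apply/seteqP; split => [w [[Yw Xw] Ew]|w [Yw Hw]].
  split => // i; rewrite inE; case: eqVneq => [->//|_ /=]; exact: Ew.
split; first by split => //; have := Hw l; rewrite inE eqxx => /(_ isT).
move=> i si; have := Hw i; rewrite inE si orbT => /(_ isT).
by case: eqVneq si => // ->; move: us => /= /andP[/negbTE ->].
Qed.

(** Given [Y = y], the points of [s] fall independently in the section of [C] at [y]. The induction
    moves one point into [Y] and integrates it out by Fubini. *)
Lemma independent_of_formula (s : seq nat) dT (T : measurableType dT) (nu : probability T R) Y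
    (A : set T) (C : set (T * V)) :
  uniq s -> independent_of nu Y s -> measurable A -> measurable C ->
  P (Y @^-1` A `&` [set w | forall l, l \in s -> C (Y w, X l w)]) =
  (\int[nu]_(y in A) ((fine (mu (xsection C y))) ^+ size s)%:E)%E.
Proof.
elim: s => [|l s IH] in dT T nu Y A C * => us iY mA mC.
  rewrite /=; under eq_integral do rewrite expr0.
  rewrite integral_cst// mul1e; have [_ /(_ A (fun=> setT) mA (fun=> measurableT))] := iY.
  rewrite big_nil mule1 => H; apply: etrans H; congr (P _); apply/seteqP; split => w [Aw _]; split => // l; by rewrite in_nil.
have /andP[ls us'] := us.
have iY' := independent_of_cons us iY.
have mpr : measurable_fun setT (fun q : (T * V) * V => (q.1.1, q.2)).
  by apply: measurable_fun_pair => //; exact: measurableT_comp measurable_fst measurable_fst.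
(* The condition on the point [l] goes into [A']; [C'] ignores this point, so its sections depend on
   [y] only. *)
pose A' := (A `*` setT) `&` C.
pose C' := (fun q : (T * V) * V => (q.1.1, q.2)) @^-1` C.
have mA' : measurable A' by apply: measurableI => //; exact: measurableX.
have mC' : measurable C' by rewrite -[X in measurable X]setTI; exact: mpr.
have := IH _ _ _ _ A' C' us' iY' mA' mC'.
have -> : (fun w => (Y w, X l w)) @^-1` A' `&` [set w | forall i, i \in s -> C' ((Y w, X l w), X i w)] =
   Y @^-1` A `&` [set w | forall i, i \in l :: s -> C (Y w, X i w)].
  apply/seteqP; split => [w [[[Aw _] Cw] H]|w [Aw H]].
    by split => // i; rewrite inE => /orP[/eqP ->//|]; exact: H.
  split; first by split => //; apply: H; rewrite inE eqxx.
  by move=> i si; apply: (H i); rewrite inE si orbT.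
move=> ->.
have mfx := measurable_fun_xsection mu mC.
have mf : measurable_fun setT (fun y => (fine (mu (xsection C y)) ^+ size s)%:E).
  by apply/measurable_EFinP; apply: measurable_funX; exact: measurableT_comp (fine_measurable measurableT) mfx.
have secE (y : T) (u : V) : xsection C' (y, u) = xsection C y.
  by apply/seteqP; split => v; rewrite /xsection /= !inE.
rewrite integral_mkcond [RHS]integral_mkcond.
pose F (q : T * V) : \bar R := ((fine (mu (xsection C q.1)) ^+ size s)%:E * (\1_A' q)%:E)%E.
have F0 q : (0 <= F q)%E by rewrite mule_ge0 ?lee_fin ?exprn_ge0 ?fine_ge0.
have mF : measurable_fun setT F.
  apply: emeasurable_funM; first exact: measurableT_comp mf measurable_fst.
  by apply/measurable_EFinP; exact: measurable_indic.
transitivity (\int[nu \x mu]_q F q)%E.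
  apply: eq_integral => -[y u] _; rewrite patchE /F secE /= indicE.
  by case: (_ \in _); rewrite ?mule1 ?mule0.
rewrite (@fubini_tonelli1 _ _ _ _ _ nu mu _ mF F0) /fubini_F.
apply: eq_integral => y _; rewrite /F /=.
rewrite ge0_integralZl//; first last.
- by rewrite lee_fin exprn_ge0 ?fine_ge0.
- apply/measurable_EFinP; apply: (measurableT_comp (f := \1_A' : T * V -> R)) => //; exact: measurable_indic.
rewrite patchE; have [Ay|Ay] := boolP (y \in A).
  rewrite (_ : (fun u => _) = (fun u => (\1_(xsection C y) u)%:E)); last first.
    apply/funext => u; rewrite !indicE; congr (_%:R%:E); congr nat_of_bool.
    apply/idP/idP; rewrite /xsection /A' !inE /=; first by move=> [_]; rewrite inE.
    by rewrite inE => H; split => //; split => //; exact/set_mem.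
  rewrite integral_indic ?setIT//; last exact: measurable_xsection.
  by rewrite -[X in (_ * X)%E]fineK ?fin_num_measure//; [rewrite -EFinM -exprSr|exact: measurable_xsection].
rewrite (_ : (fun u => _) = cst 0%E) ?integral0 ?mule0//.
apply/funext => u; rewrite indicE memNset//= => -[[/= Ay' _] _].
by rewrite (mem_set Ay') in Ay.
Qed.

End independent_sample.

(** * Expected number of stars *)

Section star_law.
Context {R : realType} (d : nat).
Local Notation V := 'rV[R]_d.
Variable mu : probability V R.
Implicit Types (C : bool) (r : R) (x y z w : V).

Definition near_gamma C r x y z : bool :=
  [&& enorm (y - x) <= r, enorm (z - x) <= r & in_gamma C (y - x) (z - x)].

Definition hits C x y z w : bool :=
  in_nball (~~ C) (w - x) (y - x) || in_nball (~~ C) (w - x) (z - x).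

Definition miss C x y z : R := fine (mu [set w | ~~ hits C x y z w]).

(** Conditional probability, given the centre [x], that two given sample points form a star around
    it, [N] further points having to stay out of the balls. *)
Definition star_mass C (N : nat) r x : \bar R :=
  (\int[mu]_y \int[mu]_z ((near_gamma C r x y z)%:R * miss C x y z ^+ N)%:E)%E.

Definition far_mass r x : R := fine (mu [set w | ~~ (enorm (w - x) <= r)]).

Section measurability.
Context dT (T : measurableType dT) (f g h p : T -> V).
Hypotheses (mf : measurable_fun setT f) (mg : measurable_fun setT g).
Hypotheses (mh : measurable_fun setT h) (mp : measurable_fun setT p).

Lemma measurable_near_gamma C r : measurable_fun setT (fun t => near_gamma C r (f t) (g t) (h t)).
Proof.
have mgf : measurable_fun setT (fun t => g t - f t) by exact: measurable_subrV.
have mhf : measurable_fun setT (fun t => h t - f t) by exact: measurable_subrV.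
apply: measurable_and; first by apply: measurable_fun_ler => //; exact: measurable_enorm.
apply: measurable_and; first by apply: measurable_fun_ler => //; exact: measurable_enorm.
apply: measurable_lte_if; first by apply: measurable_maxr; exact: measurable_enorm.
by apply: measurable_enorm; exact: measurable_subrV.
Qed.

Lemma measurable_hits C : measurable_fun setT (fun t => hits C (f t) (g t) (h t) (p t)).
Proof.
have mgf : measurable_fun setT (fun t => g t - f t) by exact: measurable_subrV.
have mhf : measurable_fun setT (fun t => h t - f t) by exact: measurable_subrV.
have mpf : measurable_fun setT (fun t => p t - f t) by exact: measurable_subrV.
by apply: measurable_or; apply: measurable_lte_if; apply: measurable_enorm => //; exact: measurable_subrV.
Qed.

Lemma measurable_far r : measurable_fun setT (fun t => ~~ (enorm (p t - f t) <= r)).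
Proof.
apply: measurable_neg; apply: measurable_fun_ler => //.
by apply: measurable_enorm; exact: measurable_subrV.
Qed.

End measurability.

Lemma measurable_setb dT (T : measurableType dT) (b : T -> bool) :
  measurable_fun setT b -> measurable [set t | b t].
Proof.
move=> mb; rewrite (_ : [set t | _] = setT `&` b @^-1` [set true]); last by rewrite setTI.
exact: mb.
Qed.

Section miss_measurability.
Context dT (T : measurableType dT) (f g h : T -> V).
Hypotheses (mf : measurable_fun setT f) (mg : measurable_fun setT g) (mh : measurable_fun setT h).

Lemma measurable_miss C : measurable_fun setT (fun t => miss C (f t) (g t) (h t)).
Proof.
have mE : measurable [set q : T * V | ~~ hits C (f q.1) (g q.1) (h q.1) q.2].
  apply: measurable_setb; apply: measurable_neg.
  by apply: measurable_hits => //; exact: measurableT_comp measurable_fst.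
have := measurableT_comp (fine_measurable measurableT) (measurable_fun_xsection mu mE).
apply: eq_measurable_fun => t _ /=; congr (fine (mu _)).
by apply/seteqP; split => w; rewrite /xsection /= inE.
Qed.

Lemma measurable_star_weight C N r : measurable_fun setT (fun t =>
  ((near_gamma C r (f t) (g t) (h t))%:R * miss C (f t) (g t) (h t) ^+ N)%:E).
Proof.
apply/measurable_EFinP; apply: measurable_funM.
  by apply: measurable_boolR; exact: measurable_near_gamma.
by apply: measurable_funX; exact: measurable_miss.
Qed.

End miss_measurability.

Lemma star_weight_ge0 C N r x y z :
  (0 <= ((near_gamma C r x y z)%:R * miss C x y z ^+ N)%:E)%E.
Proof. by rewrite lee_fin mulr_ge0// exprn_ge0// fine_ge0. Qed.

Lemma measurable_far_mass r : measurable_fun setT (far_mass r).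
Proof.
have mE : measurable [set q : V * V | ~~ (enorm (q.2 - q.1) <= r)].
  by apply: measurable_setb; apply: measurable_far.
have := measurableT_comp (fine_measurable measurableT) (measurable_fun_xsection mu mE).
apply: eq_measurable_fun => t _ /=; congr (fine (mu _)).
by apply/seteqP; split => w; rewrite /xsection /= inE.
Qed.

Lemma far_mass_ge0 r x : 0 <= far_mass r x.
Proof. exact: fine_ge0. Qed.

Lemma star_massE C N r x : star_mass C N r x =
  (\int[mu \x mu]_q ((near_gamma C r x q.1 q.2)%:R * miss C x q.1 q.2 ^+ N)%:E)%E.
Proof.
rewrite (@fubini_tonelli1 _ _ _ _ _ mu mu)//.
  exact: measurable_star_weight.
by move=> q; exact: star_weight_ge0.
Qed.

Lemma star_mass_ge0 C N r x : (0 <= star_mass C N r x)%E.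
Proof. by rewrite star_massE; apply: integral_ge0 => q _; exact: star_weight_ge0. Qed.

Lemma measurable_star_mass C N r : measurable_fun setT (star_mass C N r).
Proof.
pose F (q : V * (V * V)) := ((near_gamma C r q.1 q.2.1 q.2.2)%:R * miss C q.1 q.2.1 q.2.2 ^+ N)%:E.
have mF : measurable_fun setT F.
  apply: measurable_star_weight => //.
    exact: measurableT_comp measurable_fst measurable_snd.
  exact: measurableT_comp measurable_snd measurable_snd.
have F0 q : (0 <= F q)%E by exact: star_weight_ge0.
pose mumu : probability (V * V)%type R := (mu \x mu)%E.
have := @measurable_fun_fubini_tonelli_F _ _ _ _ R mumu _ mF F0.
by apply: eq_measurable_fun => x _; rewrite star_massE.
Qed.

End star_law.

Section sampled_stars.
Context {R : realType} (d : nat).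
Local Notation V := 'rV[R]_d.
Context dO (Omega : measurableType dO) (P : probability Omega R).
Variable X : nat -> {mfun Omega >-> V}.
Variable mu : probability V R.
Hypothesis law : forall i A, measurable A -> P (X i @^-1` A) = mu A.
Hypothesis indep : mutually_independent P (fun i => X i : Omega -> V).

Definition sample n w : n.-tuple V := [tuple X i w | i < n].

Definition others n (b : pred 'I_n) : seq nat := [seq val l | l <- enum [pred l | ~~ b l]].

Lemma others_uniq n (b : pred 'I_n) : uniq (others b).
Proof. by rewrite map_inj_uniq ?enum_uniq//; exact: val_inj. Qed.

Lemma mem_others n (b : pred 'I_n) (l : 'I_n) : (val l \in others b) = ~~ b l.
Proof. by rewrite mem_map; [rewrite mem_enum|exact: val_inj]. Qed.

Lemma othersP n (b : pred 'I_n) (Q : nat -> Prop) :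
  (forall l, l \in others b -> Q l) <-> (forall l : 'I_n, b l \/ Q l).
Proof.
split=> [H l|H l]; last by case/mapP => k; rewrite mem_enum inE => bk ->; case: (H k) => // /(elimN idP).
by have [bl|bl] := boolP (b l); [left|right; apply: H; rewrite mem_others].
Qed.

Lemma size_others n (b : pred 'I_n) : size (others b) = (n - #|b|)%N.
Proof.
rewrite size_map -cardE; have := cardC b; rewrite card_ord => cb.
have -> : #|[pred l | ~~ b l]| = #|[predC b]| by [].
by rewrite -[X in _ = (X - _)%N]cb addKn.
Qed.

(** The centre [k] is conditioned on before the two ends, so the outer integral is over the centre;
    [n - 3] points remain. *)
Lemma star_probability C r n (i j k : 'I_n) : i != j -> i != k -> j != k ->
  P [set w | star C r (sample n w) i j k] = (\int[mu]_x star_mass mu C (n - 3) r x)%E.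
Proof.
move=> ij ik jk.
pose s := others (pred3 i j k).
have us : uniq [:: val k, val i, val j & s].
  have sn (l : 'I_n) : pred3 i j k l -> val l \notin s by rewrite mem_others negbK.
  rewrite /= !inE !negb_or others_uniq !sn ?inE ?eqxx ?orbT// !andbT.
  have -> : val k != val i by rewrite eq_sym.
  have -> : val k != val j by rewrite eq_sym.
  exact: ij.
have ss : size s = (n - 3)%N.
  rewrite size_others; congr (_ - _)%N.
  transitivity #|[set i; j; k]%SET|; last first.
    by rewrite finset.setUC cardsU1 !inE cards2 ij negb_or eq_sym ik eq_sym jk.
  by apply: eq_card => l; rewrite !inE orbA.
have I1 := independent_of_sample law indep us.
have /= /andP[_ us1] := us.
have I2 := independent_of_cons us1 I1.
have /= /andP[_ us2] := us1.
have I3 := independent_of_cons us2 I2.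
have /= /andP[_ us3] := us2.
pose A := [set q : (V * V) * V | near_gamma C r q.1.1 q.1.2 q.2].
pose B := [set q : ((V * V) * V) * V | ~~ hits C q.1.1.1 q.1.1.2 q.1.2 q.2].
have m1 : measurable_fun setT (fun q : (V * V) * V => q.1.1) by exact: measurableT_comp measurable_fst measurable_fst.
have m2 : measurable_fun setT (fun q : (V * V) * V => q.1.2) by exact: measurableT_comp measurable_snd measurable_fst.
have m3 : measurable_fun setT (fun q : (V * V) * V => q.2) by exact: measurable_snd.
have mA : measurable A by apply: measurable_setb; exact: measurable_near_gamma.
have mB : measurable B.
  apply: measurable_setb; apply: measurable_neg.
  exact: (measurable_hits (measurableT_comp m1 measurable_fst) (measurableT_comp m2 measurable_fst)
    (measurableT_comp m3 measurable_fst) measurable_snd).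
have := independent_of_formula us3 I3 mA mB.
rewrite ss (_ : _ `&` _ = [set w | star C r (sample n w) i j k]); last first.
  apply/seteqP; split => w.
    move=> [Aw /othersP H]; rewrite /star /= ij ik jk !tnth_mktuple /=.
    move: Aw; rewrite /A /near_gamma /= => -> /=.
    apply/forallP => l; rewrite tnth_mktuple; case: (H l) => /=.
      by case/or3P => ->; rewrite ?orbT.
    by rewrite /B /hits /= => ->; rewrite !orbT.
  rewrite /= /star !tnth_mktuple => /and3P[_ Aw /forallP H]; split => //.
  apply/othersP => l; have := H l; rewrite tnth_mktuple /= => /or4P[->|->|->|]; rewrite ?orbT; [by left|by left|by left|by right].
move=> ->.
pose F (q : (V * V) * V) := ((near_gamma C r q.1.1 q.1.2 q.2)%:R * miss mu C q.1.1 q.1.2 q.2 ^+ (n - 3))%:E.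
have mF : measurable_fun setT F by exact: measurable_star_weight.
have F0 q : (0 <= F q)%E by exact: star_weight_ge0.
pose mumu : probability (V * V)%type R := (mu \x mu)%E.
pose G := fubini_F mu F.
have mG : measurable_fun setT G by exact: (@measurable_fun_fubini_tonelli_F _ _ _ _ R mu _ mF F0).
have G0 q : (0 <= G q)%E by apply: integral_ge0 => z _.
transitivity (\int[mumu \x mu]_q F q)%E.
  rewrite integral_mkcond; apply: eq_integral => q _; rewrite patchE /F.
  have [Aq|Aq] := boolP (near_gamma _ _ _ _ _).
    rewrite mem_set//= mul1r; congr (_ ^+ _)%:E; congr (fine (mu _)).
    by apply/seteqP; split => w; rewrite /xsection /= inE.
  by rewrite memNset ?mul0r//; exact/negP.
rewrite (@fubini_tonelli1 _ _ _ _ _ mumu mu _ mF F0).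
by rewrite (@fubini_tonelli1 _ _ _ _ _ mu mu _ mG G0).
Qed.

Definition center_star C r x n (p : n.-tuple V) (i j : 'I_n) : bool :=
  [&& i != j, near_gamma C r x (tnth p i) (tnth p j) &
    [forall l, [|| l == i, l == j | ~~ hits C x (tnth p i) (tnth p j) (tnth p l)]]].

(** Here the centre is a fixed point outside the sample, so that [n - 2] points remain. *)
Lemma center_star_probability C r x n (i j : 'I_n) : i != j ->
  P [set w | center_star C r x (sample n w) i j] = star_mass mu C (n - 2) r x.
Proof.
move=> ij.
pose s := others (pred2 i j).
have us : uniq [:: val i, val j & s].
  have sn (l : 'I_n) : pred2 i j l -> val l \notin s by rewrite mem_others negbK.
  rewrite /= !inE !negb_or others_uniq !sn ?inE ?eqxx ?orbT// !andbT.
  exact: ij.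
have ss : size s = (n - 2)%N.
  rewrite size_others; congr (_ - _)%N.
  transitivity #|[set i; j]%SET|; last by rewrite cards2 ij.
  by apply: eq_card => l; rewrite !inE.
have I1 := independent_of_sample law indep us.
have /= /andP[_ us1] := us.
have I2 := independent_of_cons us1 I1.
have /= /andP[_ us2] := us1.
pose A := [set q : V * V | near_gamma C r x q.1 q.2].
pose B := [set q : (V * V) * V | ~~ hits C x q.1.1 q.1.2 q.2].
have m1 : measurable_fun setT (fun q : (V * V) * V => q.1.1) by exact: measurableT_comp measurable_fst measurable_fst.
have m2 : measurable_fun setT (fun q : (V * V) * V => q.1.2) by exact: measurableT_comp measurable_snd measurable_fst.
have mA : measurable A by apply: measurable_setb; exact: measurable_near_gamma.
have mB : measurable B by apply: measurable_setb; apply: measurable_neg; exact: measurable_hits.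
have := independent_of_formula us2 I2 mA mB.
rewrite ss (_ : _ `&` _ = [set w | center_star C r x (sample n w) i j]); last first.
  apply/seteqP; split => w.
    move=> [Aw /othersP H]; rewrite /center_star /= ij !tnth_mktuple /=.
    move: Aw; rewrite /A /= => -> /=.
    apply/forallP => l; rewrite tnth_mktuple; case: (H l) => /=.
      by case/orP => ->; rewrite ?orbT.
    by rewrite /B /hits /= => ->; rewrite !orbT.
  rewrite /= /center_star !tnth_mktuple => /and3P[_ Aw /forallP H]; split => //.
  apply/othersP => l; have := H l; rewrite tnth_mktuple /= => /or3P[->|->|]; rewrite ?orbT; [by left|by left|by right].
move=> ->; rewrite star_massE integral_mkcond; apply: eq_integral => q _; rewrite patchE.
have [Aq|Aq] := boolP (near_gamma _ _ _ _ _).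
  rewrite mem_set//= mul1r; congr (_ ^+ _)%:E; congr (fine (mu _)).
  by apply/seteqP; split => w; rewrite /xsection /= inE.
by rewrite memNset ?mul0r//; exact/negP.
Qed.

Lemma isolated_probability r n (i : 'I_n) :
  P [set w | isolated r (sample n w) i] = (\int[mu]_x (far_mass mu r x ^+ n.-1)%:E)%E.
Proof.
pose s := others (pred1 i).
have us : uniq (val i :: s).
  by rewrite /= others_uniq mem_others negbK inE eqxx.
have ss : size s = n.-1 by rewrite size_others card1 subn1.
have I1 := independent_of_sample law indep us.
have /= /andP[_ us1] := us.
pose B := [set q : V * V | ~~ (enorm (q.2 - q.1) <= r)].
have mB : measurable B by apply: measurable_setb; exact: measurable_far.
have := independent_of_formula us1 I1 measurableT mB.
rewrite ss preimage_setT setTI (_ : [set w | _] = [set w | isolated r (sample n w) i]); last first.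
  apply/seteqP; split => w.
    move=> /othersP H; apply/forallP => l; rewrite !tnth_mktuple.
    by case: (H l) => [/= ->|] //; rewrite /B /= => ->; rewrite orbT.
  move=> /= /forallP H; apply/othersP => l; have := H l; rewrite !tnth_mktuple.
  by move=> /orP[]; [left|right].
move=> ->; apply: eq_integral => x _; congr (_ ^+ _)%:E; congr (fine (mu _)).
by apply/seteqP; split => w; rewrite /xsection /= inE.
Qed.

Lemma measurable_sample n : measurable_fun setT (sample n).
Proof.
apply/measurable_fun_tnthP => i.
rewrite (_ : _ \o _ = X i) //; last by apply/funext => w /=; rewrite tnth_mktuple.
Qed.

Lemma measurable_forallb (I : finType) dT (T : measurableType dT) (b : I -> T -> bool) :
  (forall l, measurable_fun setT (b l)) -> measurable_fun setT (fun w => [forall l, b l w]).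
Proof.
move=> mb; apply: (@measurable_fun_bool _ _ setT _ true); rewrite setTI.
rewrite (_ : _ @^-1` _ = \big[setI/setT]_(l : I) [set w | b l w]).
  by apply: bigsetI_measurable => l _; exact: measurable_setb.
rewrite -bigcap_seq; apply/seteqP; split => [w /= /forallP H l _|w /= H]; first exact: H.
by apply/forallP => l; apply: H => /=; rewrite mem_index_enum.
Qed.

Lemma measurable_star C r n i j k : measurable_fun setT (fun w => star C r (sample n w) i j k).
Proof.
have mX l : measurable_fun setT (fun w => tnth (sample n w) l).
  by move/measurable_fun_tnthP : (@measurable_sample n); apply.
apply: measurable_and; first exact: measurable_cst.
apply: measurable_and; first exact: (measurable_near_gamma (mX k) (mX i) (mX j)).
apply: measurable_forallb => l; apply: measurable_or; first exact: measurable_cst.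
apply: measurable_or; first exact: measurable_cst.
apply: measurable_or; first exact: measurable_cst.
exact: measurable_neg (measurable_hits (mX k) (mX i) (mX j) (mX l) C).
Qed.

Lemma measurable_center_star C r x n i j :
  measurable_fun setT (fun w => center_star C r x (sample n w) i j).
Proof.
have mX l : measurable_fun setT (fun w => tnth (sample n w) l).
  by move/measurable_fun_tnthP : (@measurable_sample n); apply.
apply: measurable_and; first exact: measurable_cst.
apply: measurable_and; first exact: (measurable_near_gamma (measurable_cst x) (mX i) (mX j)).
apply: measurable_forallb => l; apply: measurable_or; first exact: measurable_cst.
apply: measurable_or; first exact: measurable_cst.
exact: measurable_neg (measurable_hits (measurable_cst x) (mX i) (mX j) (mX l) C).
Qed.

Lemma measurable_isolated r n i : measurable_fun setT (fun w => isolated r (sample n w) i).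
Proof.
have mX l : measurable_fun setT (fun w => tnth (sample n w) l).
  by move/measurable_fun_tnthP : (@measurable_sample n); apply.
apply: measurable_forallb => l; apply: measurable_or; first exact: measurable_cst.
exact: measurable_far.
Qed.

Lemma measurable_natsum (I : finType) (b : I -> Omega -> bool) :
  (forall t, measurable_fun setT (b t)) ->
  measurable_fun setT (fun w => ((\sum_t b t w)%N%:R)%:E : \bar R).
Proof.
move=> mb; apply/measurable_EFinP; under eq_fun do rewrite natr_sum.
by apply: measurable_sum => t; exact: measurable_boolR.
Qed.

Lemma integral_natsum (I : finType) (b : I -> Omega -> bool) :
  (forall t, measurable_fun setT (b t)) ->
  (\int[P]_w ((\sum_t b t w)%N%:R)%:E = \sum_t P [set w | b t w])%E.
Proof.
move=> mb; under eq_integral do rewrite natr_sum -sumEFin.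
rewrite ge0_integral_sum//; last first.
- by move=> t; apply/measurable_EFinP; exact: measurable_boolR.
apply: eq_bigr => t _; rewrite -[X in P X]setIT -integral_indic//; last exact: measurable_setb.
apply: eq_integral => w _; rewrite indicE; congr (_%:R%:E); congr nat_of_bool.
by apply/idP/idP; rewrite inE.
Qed.

Lemma card_triples n :
  #|[pred t : 'I_n * 'I_n * 'I_n | [&& t.1.1 != t.1.2, t.1.1 != t.2 & t.1.2 != t.2]]| =
  (n * n.-1 * n.-2)%N.
Proof.
rewrite -sum1_card big_mkcond/=.
transitivity (\sum_(i < n) \sum_(j < n) \sum_(k < n) [&& i != j, i != k & j != k])%N.
  by rewrite pair_big/= pair_big/=; apply: eq_bigr => -[[i j] k] _ /=; rewrite inE /=; case: ifP.
transitivity (\sum_(i < n) \sum_(j < n) (j != i) * n.-2)%N.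
  apply: eq_bigr => i _; apply: eq_bigr => j _.
  have [->|ij] := eqVneq i j; first by rewrite big1.
  rewrite mul1n; have := cardsC [set i; j]%SET.
  rewrite cards2 ij card_ord /=.
  have -> : (\sum_(k < n) [&& true, i != k & j != k] = #|~: [set i; j]%SET|)%N.
    rewrite -sum1_card [RHS]big_mkcond; apply: eq_bigr => k _ /=.
    by rewrite !inE negb_or !(eq_sym k); case: (_ && _).
  by move: #|~: _| => q; lia.
transitivity (\sum_(i < n) n.-1 * n.-2)%N.
  apply: eq_bigr => i _; rewrite -big_distrl/=; congr (_ * _)%N.
  rewrite (bigD1 i)//= eqxx add0n (eq_bigr (fun=> 1%N)) => [|j ->//].
  rewrite sum1_card; have := cardC1 i; rewrite card_ord => <-.
  by apply: eq_card => j; rewrite !inE.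
by rewrite sum_nat_const card_ord mulnA.
Qed.

Hypothesis atomless : forall x, mu [set x] = 0%E.

Lemma measurable_point (x : V) : measurable [set x].
Proof.
rewrite (_ : [set x] = [set v | enorm (v - x) <= 0]); last first.
  apply/seteqP; split => [v -> /=|v /= H]; first by rewrite subrr enorm0.
  by apply/eqP; rewrite -subr_eq0 -enorm_eq0 eq_le H enorm_ge0.
have := measurableC (measurable_setb (measurable_far (measurable_cst x) (@measurable_id _ V setT) 0)).
by congr measurable; apply/seteqP; split => v /=; [move/negP; rewrite negbK|move=> ->].
Qed.

Lemma sample_ae_neq n i (x : V) : {ae P, forall w, tnth (sample n w) i != x}.
Proof.
exists [set w | X i w = x]; split.
- by rewrite -[X in measurable X]setTI; exact: (@measurable_funPT _ _ _ _ (X i)) (measurable_point x).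
- by have := law i (measurable_point x); rewrite atomless.
- by move=> w /= /negP; rewrite negbK tnth_mktuple => /eqP.
Qed.

(** For two independent points, the diagonal is integrated by its sections, which are single points
    of mass 0. Distinctness is what the kissing bound requires. *)
Lemma sample_ae_injective n :
  {ae P, forall w, forall i j, i != j -> tnth (sample n w) i != tnth (sample n w) j}.
Proof.
apply: filter_forall => i; apply: filter_forall => j.
have [->|ij] := eqVneq i j; first by apply: aeW => w; rewrite eqxx.
pose C := [set q : V * V | q.1 = q.2].
have mC : measurable C.
  rewrite (_ : C = (fun q => q.1 - q.2) @^-1` [set 0]); last first.
    by apply/seteqP; split => q; rewrite /C /= => /eqP; [rewrite -subr_eq0 => /eqP|rewrite subr_eq0 => /eqP].
  have md : measurable_fun setT (fun q : V * V => q.1 - q.2) by apply: measurable_subrV => //; exact: measurable_snd.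
  by rewrite -[X in measurable X]setTI; apply: md => //; exact: measurable_point.
have us : uniq [:: val i; val j] by rewrite /= inE andbT.
have I1 := independent_of_sample law indep us.
have := @independent_of_formula _ _ _ _ _ _ _ _ [:: val j] _ _ _ _ _ _ (isT : uniq [:: val j]) I1 measurableT mC.
rewrite integral0_eq => [|x _]; last first.
  rewrite expr1 (_ : xsection C x = [set x]) ?atomless//.
  by apply/seteqP; split => v; rewrite /xsection /C /= inE /=.
rewrite preimage_setT setTI => P0.
exists [set w | forall l, l \in [:: val j] -> C (X (val i) w, X l w)]; split => //.
  rewrite (_ : [set w | _] = (fun w => (X i w, X j w)) @^-1` C).
    by rewrite -[X in measurable X]setTI; apply: measurable_fun_pair => //; exact: measurable_funPT.
  by apply/seteqP; split => w /= H; [apply: H; rewrite inE|move=> l; rewrite inE => /eqP ->].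
move=> w /= /not_implyP[_ /negP]; rewrite negbK !tnth_mktuple => /eqP Xij l.
by rewrite inE => /eqP ->.
Qed.

Lemma sume_cst (I : finType) (D : pred I) (c : \bar R) : (0 <= c)%E ->
  (\sum_(t | D t) c = #|D|%:R%:E * c)%E.
Proof.
move=> c0; rewrite big_const; elim: #|D| => [|k IH] /=; first by rewrite mul0e.
by rewrite IH -nat1r EFinD ge0_muleDl ?lee_fin// mul1e.
Qed.

(* In a sample, only kissing_bound points can be as close to x as to every other
   point; pairs of such points contain all the stars centered at x. *)
Lemma center_bound n (x : V) (r : R) :
  ((n * n.-1)%:R%:E * star_mass mu true (n - 2) r x <= ((kissing_bound d) ^ 2)%:R%:E)%E.
Proof.
pose b (t : 'I_n * 'I_n) w := center_star true r x (sample n w) t.1 t.2.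
have mb t : measurable_fun setT (b t) by exact: measurable_center_star.
have -> : ((n * n.-1)%:R%:E * star_mass mu true (n - 2) r x = \sum_t P [set w | b t w])%E.
  have -> : (\sum_t P [set w | b t w] = \sum_(t : 'I_n * 'I_n | t.1 != t.2) star_mass mu true (n - 2) r x)%E.
    rewrite [RHS]big_mkcond; apply: eq_bigr => t _; case: ifPn => [tt|/negPn tt].
      exact: center_star_probability.
    rewrite (_ : [set w | _] = set0) ?measure0//; apply/seteqP; split => // w /=.
    by rewrite /b /center_star tt.
  rewrite sume_cst ?star_mass_ge0//; congr (_%:R%:E * _)%E.
  rewrite -sum1_card big_mkcond/=.
  transitivity (\sum_(i < n) \sum_(j < n) (j != i))%N.
    transitivity (\sum_(i < n) n.-1)%N; first by rewrite sum_nat_const card_ord.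
    apply: eq_bigr => i _; rewrite (bigD1 i)//= eqxx add0n (eq_bigr (fun=> 1%N)) => [|j ->//].
    rewrite sum1_card; have := cardC1 i; rewrite card_ord => <-.
    by apply: eq_card => j; rewrite !inE.
  by rewrite pair_big/=; apply: eq_bigr => -[i j] _ /=; rewrite unfold_in /= eq_sym; case: eqP.
rewrite -integral_natsum//.
have -> : (((kissing_bound d) ^ 2)%:R%:E = \int[P]_w (((kissing_bound d) ^ 2)%:R)%:E :> \bar R)%E.
  rewrite integral_cst// -[LHS]mule1; congr (_ * _)%E.
  exact/esym/probability_setT.
apply: ae_ge0_le_integral => //.
- exact: measurable_natsum.
- have : {ae P, forall w, forall i, tnth (sample n w) i != x} by apply: filter_forall => i; exact: sample_ae_neq.
  apply: filterS => w xw _; rewrite lee_fin ler_nat.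
  pose S := [set i | [forall l, (l == i) || (enorm (tnth (sample n w) i - x) <= enorm (tnth (sample n w) i - tnth (sample n w) l))]]%SET.
  have leS : (#|S| <= kissing_bound d)%N.
    apply: (@nearest_indegree R d _ S (fun i => tnth (sample n w) i) x) => // i j.
    rewrite inE => /forallP /(_ j) H _ ij; rewrite eq_sym (negbTE ij) /= in H.
    exact: H.
  apply: (@leq_trans (#|S| ^ 2)%N); last by rewrite leq_exp2r.
  have -> : (#|S| ^ 2 = \sum_(t : 'I_n * 'I_n) (t.1 \in S) * (t.2 \in S))%N.
    rewrite expnS expn1 -sum1_card big_mkcond/= big_distrlr/= pair_big/=.
    by apply: eq_bigr => t _; case: ifP; case: ifP.
  apply: leq_sum => -[i j] _; rewrite /b /=.
  have [/and3P[ij /and3P[_ _ g] /forallP H]|//] := boolP (center_star _ _ _ _ _ _).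
  have [g1 g2] : enorm (tnth (sample n w) i - x) <= enorm (tnth (sample n w) i - tnth (sample n w) j) /\
    enorm (tnth (sample n w) j - x) <= enorm (tnth (sample n w) i - tnth (sample n w) j).
    by move: g; rewrite /in_gamma /lte_if ge_max opprB addrA subrK => /andP[].
  have Hl l : l != i -> l != j -> enorm (tnth (sample n w) i - x) <= enorm (tnth (sample n w) i - tnth (sample n w) l) /\
    enorm (tnth (sample n w) j - x) <= enorm (tnth (sample n w) j - tnth (sample n w) l).
    move=> /negbTE li /negbTE lj; have := H l; rewrite li lj /=.
    rewrite /hits /in_nball /lte_if /= negb_or -!leNgt !opprB !addrA !subrK => /andP[h1 h2].
    by rewrite (enormBC (tnth _ i) (tnth _ l)) (enormBC (tnth _ j) (tnth _ l)).
  have -> : i \in S.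
    rewrite inE; apply/forallP => l; have [//|li] := eqVneq l i.
    by have [->//|lj] := eqVneq l j; have [] := Hl l li lj.
  have -> // : j \in S.
  rewrite inE; apply/forallP => l; have [//|lj] := eqVneq l j.
  have [->|li] := eqVneq l i; first by rewrite /= (enormBC (tnth _ j) (tnth _ i)).
  by have [] := Hl l li lj.
Qed.

Variables (n : nat) (nn : n.-tuple V -> 'I_n -> 'I_n).
Hypotheses (nn_rule : nearest_neighbor_rule nn) (n_gt1 : (1 < n)%N).

Definition expected_count : \bar R :=
  'E_P[fun w => (n%:R^-1 * (shared_target_count (nn_edge nn (sample n w)))%:R)%R]%E.

Definition edge_pair (t : 'I_n * 'I_n * 'I_n) w : bool :=
  [&& [&& t.1.1 != t.1.2, t.1.1 != t.2 & t.1.2 != t.2],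
    nn (sample n w) t.1.1 == t.2 & nn (sample n w) t.1.2 == t.2].

Lemma countE_sum w : shared_target_count (nn_edge nn (sample n w)) = (\sum_t edge_pair t w)%N.
Proof. by rewrite countE pair_big/= pair_big/=. Qed.

Lemma measurable_edge_pair t : measurable_fun setT (edge_pair t).
Proof.
have mnn i k : measurable_fun setT (fun w => nn (sample n w) i == k).
  apply: (@measurable_fun_bool _ _ setT _ true).
  rewrite (_ : _ @^-1` _ = sample n @^-1` [set x | nn x i = k]); last first.
    by apply/seteqP; split => w /= /eqP.
  by apply: measurable_sample => //; exact: nn_rule.1.
apply: measurable_and; first exact: measurable_cst.
exact: measurable_and.
Qed.

Lemma expected_countE : expected_count =
  (n%:R^-1%:E * \int[P]_w ((\sum_t edge_pair t w)%N%:R)%:E)%E.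
Proof.
rewrite /expected_count unlock -ge0_integralZl//; last first.
- exact: measurable_natsum measurable_edge_pair.
by apply: eq_integral => w _; rewrite countE_sum EFinM.
Qed.

Lemma expected_stars C r : (\int[P]_w ((\sum_(t : 'I_n * 'I_n * 'I_n) star C r (sample n w) t.1.1 t.1.2 t.2)%N%:R)%:E =
  (n * n.-1 * n.-2)%:R%:E * \int[mu]_x star_mass mu C (n - 3) r x)%E.
Proof.
rewrite integral_natsum; last by move=> t; exact: measurable_star.
rewrite -card_triples -sume_cst; last by apply: integral_ge0 => x _; exact: star_mass_ge0.
rewrite [RHS]big_mkcond; apply: eq_bigr => -[[i j] k] _ /=; case: ifPn => [/and3P[ij ik jk]|/negbTE ijk].
  exact: star_probability.
rewrite (_ : [set w | _] = set0) ?measure0//; apply/seteqP; split => // w /=.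
by rewrite /star ijk.
Qed.

Lemma expected_count_ge r :
  ((n.-1 * n.-2)%:R%:E * \int[mu]_x star_mass mu false (n - 3) r x <= expected_count)%E.
Proof.
have n0 : n%:R != 0 :> R by rewrite pnatr_eq0 -lt0n (ltn_trans _ n_gt1).
rewrite expected_countE.
have -> : ((n.-1 * n.-2)%:R%:E = n%:R^-1%:E * (n * n.-1 * n.-2)%:R%:E :> \bar R)%E.
  by rewrite -EFinM -mulnA (natrM _ n) mulKf.
rewrite -muleA -expected_stars lee_pmul2l// ?lte_fin ?invr_gt0 ?lt0r ?n0//=.
apply: ge0_le_integral => //.
- by apply: measurable_natsum => t; exact: measurable_star.
- exact: measurable_natsum measurable_edge_pair.
- move=> w _; rewrite lee_fin ler_nat -countE_sum.
  by rewrite (leq_trans _ (count_ge nn_rule n_gt1 _ r))// pair_big/= pair_big/=.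
Qed.

(** All points are isolated with the same probability, so the sum over [i] cancels the normalization
    by [n]. *)
Lemma expected_count_le r :
  (expected_count <= (n.-1 * n.-2)%:R%:E * \int[mu]_x star_mass mu true (n - 3) r x +
    (2 * kissing_bound d)%:R%:E * \int[mu]_x (far_mass mu r x ^+ n.-1)%:E)%E.
Proof.
have n0 : n%:R != 0 :> R by rewrite pnatr_eq0 -lt0n (ltn_trans _ n_gt1).
have nV0 : (0 <= n%:R^-1%:E :> \bar R)%E by rewrite lee_fin.
rewrite expected_countE.
have -> : ((n.-1 * n.-2)%:R%:E = n%:R^-1%:E * (n * n.-1 * n.-2)%:R%:E :> \bar R)%E.
  by rewrite -EFinM -mulnA (natrM _ n) mulKf.
rewrite -muleA -expected_stars.
have -> : ((2 * kissing_bound d)%:R%:E * \int[mu]_x (far_mass mu r x ^+ n.-1)%:E =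
   n%:R^-1%:E * ((2 * kissing_bound d)%:R%:E *
     \int[P]_w ((\sum_i isolated r (sample n w) i)%N%:R)%:E))%E.
  rewrite integral_natsum; last by move=> i; exact: measurable_isolated.
  under eq_bigr do rewrite isolated_probability.
  rewrite sume_cst; last by apply: integral_ge0 => x _; rewrite lee_fin exprn_ge0 ?far_mass_ge0.
  rewrite card_ord muleCA; congr (_ * _)%E.
  by rewrite muleA -EFinM mulVf// mul1e.
have miso : measurable_fun setT (fun w => ((\sum_i isolated r (sample n w) i)%N%:R)%:E : \bar R).
  by apply: measurable_natsum => i; exact: measurable_isolated.
rewrite -[X in (_ + _ * X)%E](ge0_integralZl _ measurableT miso)//.
rewrite -ge0_muleDr//; first last.
- by apply: integral_ge0 => w _; rewrite mule_ge0.
- by apply: integral_ge0 => w _.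
rewrite -ge0_integralD//; first last.
- exact: measurable_funeM.
- by apply: measurable_natsum => t; exact: measurable_star.
apply: lee_wpmul2l => //; apply: ae_ge0_le_integral => //.
- exact: measurable_natsum measurable_edge_pair.
- by move=> w _; rewrite adde_ge0// mule_ge0.
- apply: emeasurable_funD; first by apply: measurable_natsum => t; exact: measurable_star.
  exact: measurable_funeM.
- have := sample_ae_injective n; apply: filterS => w xinj _.
  rewrite -EFinM -EFinD lee_fin -natrM -natrD ler_nat -countE_sum.
  by rewrite (leq_trans (count_le nn_rule n_gt1 r xinj))// pair_big/= pair_big/=.
Qed.

End sampled_stars.

(** * Charts and densities *)

Section finite_copy.
Context d (T : measurableType d) (R : realType).
Variables (mu : {measure set T -> \bar R}) (h : fin_num_fun mu).

Definition finite_copy of fin_num_fun mu : set T -> \bar R := mu.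

HB.instance Definition _ := Measure.copy (finite_copy h) mu.

HB.instance Definition _ := Measure_isFinite.Build _ _ _ (finite_copy h) h.

End finite_copy.

(** The measure [nu] is the sum of its restrictions to [D] and to the complement, and the second one
    does not see a function extended by 0 from [D]. *)
Lemma integral_mrestr d (T : measurableType d) (R : realType) (nu : {measure set T -> \bar R}) (D : set T)
    (mD : measurable D) (h : T -> \bar R) : measurable_fun setT h -> (forall y, 0 <= h y)%E ->
  (\int[mrestr nu mD]_y h y = \int[nu]_(y in D) h y)%E.
Proof.
move=> mh h0; have mDc := measurableC mD.
have mhD : measurable_fun setT (h \_ D) by apply/(measurable_restrictT _ mD); exact: measurable_funTS.
have hD0 y : (0 <= (h \_ D) y)%E by rewrite patchE; case: ifP.
rewrite [RHS]integral_mkcond.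
transitivity (\int[measure_add (mrestr nu mD) (mrestr nu mDc)]_y (h \_ D) y)%E; last first.
  apply: eq_measure_integral => A mA _; transitivity (nu (A `&` D) + nu (A `&` ~` D))%E.
    exact: measure_addE.
  rewrite -measureU; [|exact: measurableI|exact: measurableI|by rewrite setIACA setICr setI0].
  by rewrite -setIUr setUv setIT.
rewrite ge0_integral_measure_add// [X in (_ + X)%E](_ : _ = 0%E) ?adde0.
  apply: ge0_ae_eq_integral => //; exists (~` D); split => //.
    by transitivity (nu (~` D `&` D)); rewrite // setICl measure0.
  by move=> y /= H Dy; apply: H => _; rewrite patchE mem_set.
transitivity (\int[mrestr nu mDc]_y (cst 0 y))%E; last by rewrite integral0.
apply: ge0_ae_eq_integral => //; exists D; split => //.
  by transitivity (nu (D `&` ~` D)); rewrite // setICr measure0.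
move=> y /= H; apply: contrapT => Dy; apply: H => _.
by rewrite patchE memNset.
Qed.

Section regular_charts.
Context {R : realType} (m d : nat).
Local Notation Vd := 'rV[R]_d.
Local Notation Vm := 'rV[R]_m.
Local Notation lam := (@lebesgue_rV R m).
Variables (M : set Vd) (mu : probability Vd R).

(* F restricted to M `&` O is a chart with inverse phi. Unlike the map of a
   chart, F is smooth on a neighborhood of its domain, so that M `&` O is Borel. *)
Definition regular_chart (O : set Vd) (F : Vd -> Vm) (phi : Vm -> Vd) (V : set Vm) :=
  [/\ open O /\ open V, class_C 1 O F, class_C 1 V phi,
      (forall y, M y -> O y -> V (F y) /\ phi (F y) = y) /\
      (forall v, V v -> [/\ M (phi v), O (phi v) & F (phi v) = v]) &
      forall A, measurable A -> lam (A `&` V) = 0%E ->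
        mu ((M `&` O) `&` F @^-1` A) = 0%E].

Lemma class_C_sub a b k (O O' : set 'rV[R]_a) (f : 'rV[R]_a -> 'rV[R]_b) :
  O' `<=` O -> class_C k O f -> class_C k O' f.
Proof.
elim: k f => [|k IH] f OO /= [cf df]; split => //.
- by move=> x /OO; exact: cf.
- by move=> x /OO; exact: cf.
- by move=> i; have [d1 d2] := df i; split; [move=> x /OO; exact: d1|exact: IH].
Qed.

Lemma open_preimage_on a b (O : set 'rV[R]_a) (W : set 'rV[R]_b) (f : 'rV[R]_a -> 'rV[R]_b) :
  open O -> open W -> (forall x, O x -> {for x, continuous f}) -> open (O `&` f @^-1` W).
Proof.
move=> oO oW cf; rewrite openE => x [Ox Wfx]; apply: filterI; first exact: open_nbhs_nbhs.
by apply: cf => //; exact: open_nbhs_nbhs.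
Qed.

Lemma class_C0_continuous a b k (O : set 'rV[R]_a) (f : 'rV[R]_a -> 'rV[R]_b) :
  class_C k O f -> forall x, O x -> {for x, continuous f}.
Proof. by case: k => [|k] []. Qed.

Hypothesis manifold : smooth_submanifold m M.
Hypothesis law_ac : forall x, M x ->
    forall (U : set Vd) (psi : Vd -> Vm),
      chart M U psi -> U x ->
      pushforward (restriction mu U) psi `<< restriction lam (psi @` U).

(** Near [x] the map of a chart has a smooth extension [F]; the domain is shrunk to the open set
    where this extension is available. *)
Lemma regular_chart_exists x : M x ->
  exists O F phi V, regular_chart O F phi V /\ O x.
Proof.
move=> Mx; have [U [psi [ [D1 oO1 UE] oV1 spsi [phi phiK sphi]] Ux]] := manifold Mx.
have [W [F [oW Wx sF FE]]] := spsi _ Ux.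
pose O := D1 `&` W; pose V := psi @` (M `&` O).
have OU y : M y -> O y -> U y /\ W y by rewrite UE => My [].
have phiK' y : U y -> phi (psi y) = y by move=> Uy; apply: phiK; rewrite inE.
(* Shows that the image of the shrunk domain is still open. *)
have VE : V = (psi @` U) `&` phi @^-1` W.
  apply/seteqP; split => [_ [y [My Oy] <-]|_ [[y Uy <-]]].
    have [Uy Wy] := OU _ My Oy; split; first by exists y.
    by rewrite /= phiK'.
  rewrite /= phiK' // => Wy; exists y => //; rewrite UE in Uy; case: Uy => My Oy.
  by split.
have oV : open V by rewrite VE; apply: open_preimage_on => //; exact: class_C0_continuous (sphi 0%N).
have oO : open O by exact: openI.
have FE' y : M y -> O y -> F y = psi y.
  by move=> My Oy; apply: FE; rewrite inE; exact: OU.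
exists O, F, phi, V; split; last by split => //; rewrite UE in Ux; case: Ux.
apply: And5; first by split.
- by apply: class_C_sub (sF 1%N) => y [].
- by apply: class_C_sub (sphi 1%N); rewrite VE => y [].
- split=> [y My Oy|v].
    rewrite FE'//; have [Uy _] := OU _ My Oy; rewrite phiK'//; split => //.
    by exists y.
  move=> [y [My Oy] <-]; have [Uy _] := OU _ My Oy; rewrite phiK'//; split => //.
  exact: FE'.
- move=> A mA lA0.
  (* Absolute continuity is applied to the shrunk chart, on which [psi] and [F] coincide. *)
  have ch : chart M (M `&` O) psi.
    split => //.
    - by exists O.
    - move=> y [My Oy]; have [Uy _] := OU _ My Oy.
      have [W' [F' [oW' W'y sF' FE2]]] := spsi _ Uy.
      exists W', F'; split => // z; rewrite inE => -[[Mz Oz] W'z]; apply: FE2; rewrite inE; split => //.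
      by have [] := OU _ Mz Oz.
    - exists phi.
        by move=> y; rewrite inE => -[My Oy]; apply: phiK'; have [] := OU _ My Oy.
      by move=> k; apply: class_C_sub (sphi k); rewrite -/V VE => y [].
  have MOx : (M `&` O) x by split => //; split => //; rewrite UE in Ux; case: Ux.
  have := law_ac Mx ch MOx; move=> /(_ A) H.
  have : (pushforward (restriction mu (M `&` O)) psi).-null_set A.
    apply: H => B mB BA; rewrite /restriction.
    have mV : measurable V by exact: open_measurable_rV.
    apply/eqP; rewrite eq_le measure_ge0 andbT -lA0; apply: le_measure; rewrite ?inE.
    - exact: measurableI.
    - exact: measurableI.
    - by move=> v [Bv Vv]; split => //; exact: BA.
  move=> /(_ A mA (@subset_refl _ _)); rewrite /pushforward /restriction => <-; congr (mu _).
  apply/seteqP; split => [y [[My Oy] /=]|y [/= Ay [My Oy]]]; first by rewrite FE'.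
  by split => //=; rewrite FE'.
Qed.

(** A placeholder for the indices that encode no useful ball, so that the atlas is indexed by all
    integers. *)
Lemma regular_chart0 : regular_chart set0 (fun=> 0) (fun=> 0) set0.
Proof.
have C0 a b : class_C 1 set0 (fun _ : 'rV[R]_a => 0 : 'rV[R]_b).
  by split => [x []|i]; split=> [x []|]; split => // x [].
apply: And5; [by split; exact: open0|exact: C0|exact: C0|by split => // v []|].
by move=> A mA _; rewrite setI0 set0I measure0.
Qed.

(** Lindelof's argument: for each rational ball contained in the domain of some regular chart, one
    such chart is chosen. *)
Lemma regular_atlas : exists (O : nat -> set Vd) (F : nat -> Vd -> Vm)
    (phi : nat -> Vm -> Vd) (V : nat -> set Vm),
  (forall l, regular_chart (O l) (F l) (phi l) (V l)) /\
  (forall x, M x -> exists l, O l x).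
Proof.
pose rball (q : 'rV[rat]_d * nat) : set Vd := ball (map_mx ratr q.1 : Vd) (q.2.+1%:R^-1).
have H (l : nat) : exists c : set Vd * (Vd -> Vm) * (Vm -> Vd) * set Vm,
    regular_chart c.1.1.1 c.1.1.2 c.1.2 c.2 /\
    (forall q : 'rV[rat]_d * nat, choice.unpickle l = Some q ->
      (exists O F phi V, regular_chart O F phi V /\ rball q `<=` O) -> rball q `<=` c.1.1.1).
  case El : (choice.unpickle l) => [q|]; last first.
    by exists (set0, fun=> 0, fun=> 0, set0); split; [exact: regular_chart0|move=> q].
  have [[D [F [phi [V [c qO]]]]]|nc] := pselect (exists O F phi V, regular_chart O F phi V /\ rball q `<=` O).
    by exists (D, F, phi, V); split => // q' [<-].
  by exists (set0, fun=> 0, fun=> 0, set0); split; [exact: regular_chart0|move=> q' [<-]].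
have [c cP] := choice H.
exists (fun l => (c l).1.1.1), (fun l => (c l).1.1.2), (fun l => (c l).1.2), (fun l => (c l).2).
split=> [l|x Mx]; first by have [] := cP l.
have [D [F [phi [V [ch Ox]]]]] := regular_chart_exists Mx.
have [oO _] : open D /\ open V by case: ch.
have [q [qx qO]] := rat_ball_rV oO Ox.
exists (choice.pickle q); have [_ /(_ q (choice.pickleK q))] := cP (choice.pickle q).
by apply => //; exists D, F, phi, V.
Qed.

Section density.
Variables (O : set Vd) (F : Vd -> Vm) (phi : Vm -> Vd) (V : set Vm).
Hypothesis ch : regular_chart O F phi V.

(** A point [y] of [O] lies in [M] exactly when [F y] is in [V] and [phi (F y) = y]: an equation
    between continuous functions on an open set. *)
Lemma measurable_chart_piece : measurable (M `&` O).
Proof.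
case: ch => -[oO oV] CF Cphi [FM Fphi] _.
have cF := class_C0_continuous CF; have cphi := class_C0_continuous Cphi.
pose U := O `&` F @^-1` V.
have oU : open U by exact: open_preimage_on.
pose g y := phi (F y) - y.
have cg y : U y -> {for y, continuous g}.
  move=> [Oy Vy]; apply: continuousB; last exact: cvg_id.
  by apply: continuous_comp; [exact: cF|exact: cphi].
have -> : M `&` O = U `&` \big[setI/setT]_(i < d) (U `&` (fun y => g y ord0 i) @^-1` [set 0]).
  rewrite -bigcap_seq; apply/seteqP; split => [y [My Oy]|y [[Oy Vy] H]].
    have [Vy yE] := FM _ My Oy; split => // i _; split => //.
    by rewrite /= /g yE subrr mxE.
  have yE : phi (F y) = y.
    by apply/subr0_eq/rowP => i; have [|_ ->] := H i; rewrite ?mxE//= mem_index_enum.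
  by have [My _ _] := Fphi _ Vy; split => //; rewrite -yE.
apply: measurableI; first exact: open_measurable_rV.
apply: bigsetI_measurable => i _.
by apply: (continuous_on_measurable_rV oU cg i) => //; exact: open_measurable_rV.
Qed.

(** Extension by 0 makes a map that is controlled only on its domain measurable on the whole
    space. *)
Definition chart_map := patch (fun=> 0) (M `&` O) F.
Definition chart_inv := patch (fun=> 0) V phi.

Lemma measurable_patch_rV a b (D : set 'rV[R]_a) (f : 'rV[R]_a -> 'rV[R]_b) : measurable D ->
  (forall i, measurable_fun D (fun x => f x ord0 i)) -> measurable_fun setT (patch (fun=> 0) D f).
Proof.
move=> mD mf; apply/measurable_fun_rVP => i.
have := (measurable_restrictT _ mD).1 (mf i); apply: eq_measurable_fun => x _.
by rewrite /patch; case: ifP => //; rewrite mxE.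
Qed.

Lemma measurable_chart_map : measurable_fun setT chart_map.
Proof.
apply: measurable_patch_rV; first exact: measurable_chart_piece.
case: ch => -[oO _] CF _ _ _ i.
apply: (@measurable_funS _ _ _ _ O); first exact: open_measurable_rV.
  by move=> y [].
by apply: continuous_on_measurable_rV => //; exact: class_C0_continuous CF.
Qed.

Lemma measurable_chart_inv : measurable_fun setT chart_inv.
Proof.
case: ch => -[_ oV] _ Cphi _ _.
apply: measurable_patch_rV; first exact: open_measurable_rV.
by apply: continuous_on_measurable_rV => //; exact: class_C0_continuous Cphi.
Qed.

Lemma chart_mapE y : (M `&` O) y -> chart_map y = F y.
Proof. by move=> Qy; rewrite /chart_map /patch mem_set. Qed.

Lemma chart_invE v : V v -> chart_inv v = phi v.
Proof. by move=> Vv; rewrite /chart_inv /patch mem_set. Qed.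

Lemma chart_mapK y : (M `&` O) y -> V (chart_map y) /\ chart_inv (chart_map y) = y.
Proof.
move=> Qy; rewrite chart_mapE//.
by case: ch Qy => _ _ _ [FM _] _ [My Oy]; have [Vy yE] := FM _ My Oy; rewrite chart_invE.
Qed.

Lemma chart_invK v : V v -> (M `&` O) (chart_inv v) /\ chart_map (chart_inv v) = v.
Proof.
move=> Vv; rewrite chart_invE//.
by case: ch => _ _ _ [_ Fphi] _; have [M1 O1 E] := Fphi _ Vv; rewrite chart_mapE.
Qed.

(** Radon-Nikodym for the image under the chart of [mu] restricted to [M] and [O]. *)
Lemma chart_density : exists f : Vm -> R,
  [/\ forall v, 0 <= f v, lam.-integrable setT (EFin \o f), (forall v, ~ V v -> f v = 0) &
    forall h : Vd -> \bar R, measurable_fun setT h -> (forall y, 0 <= h y)%E ->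
      (\int[mu]_(y in M `&` O) h y = \int[lam]_v (h (chart_inv v) * (f v)%:E))%E].
Proof.
have mQ := measurable_chart_piece; have mF := measurable_chart_map; have mI := measurable_chart_inv.
have [_ oV] : open O /\ open V by case: ch.
have mV : measurable V by exact: open_measurable_rV.
pose nu0 := image_measure (mrestr mu mQ) mF.
have fin0 : fin_num_fun nu0.
  move=> A mA; rewrite ge0_fin_numE//; apply: (@le_lt_trans _ _ 1%E); last exact: ltry.
  by apply: probability_le1; apply: measurableI => //; rewrite -[X in measurable X]setTI; exact: measurable_chart_map.
pose nu : {finite_measure set Vm -> \bar R} := finite_copy fin0.
have nulam : nu `<< lam.
  apply/null_content_dominatesP => A mA lA0.
  have -> : nu A = mu ((M `&` O) `&` F @^-1` A).
    transitivity (mu (chart_map @^-1` A `&` (M `&` O))); first by [].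
    congr (mu _).
    apply/seteqP; split => y /= [a b]; split => //.
      by rewrite -chart_mapE.
    by rewrite chart_mapE.
  case: ch => _ _ _ _; apply => //; apply/eqP; rewrite eq_le measure_ge0 andbT -lA0.
  by apply: le_measure; rewrite ?inE//; exact: measurableI.
pose g := Radon_Nikodym_SigmaFinite.f nu lam.
have g0 := Radon_Nikodym_SigmaFinite.f_ge0 nulam.
have gfin := Radon_Nikodym_SigmaFinite.f_fin_num nulam.
have ig := Radon_Nikodym_SigmaFinite.f_integrable nulam.
(* The cut by [V] makes [f] vanish at every point where [chart_inv] has its default value. *)
pose f v := (v \in V)%:R * fine (g v).
have fE v : (f v)%:E = ((\1_V v)%:E * g v)%E.
  by rewrite /f EFinM fineK//; exact: gfin.
exists f; split.
- by move=> v; rewrite mulr_ge0// fine_ge0.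
- apply: (le_integrable measurableT _ _ ig).
    rewrite (_ : EFin \o f = (fun v => (\1_V v)%:E * g v)%E); last exact/funext.
    apply: emeasurable_funM; last exact: measurable_int ig.
    by apply/measurable_EFinP; exact: measurable_indic.
  move=> v _; rewrite [X in (`|X| <= _)%E]fE abseM indicE.
  by case: (_ \in _); rewrite ?abse1 ?abse0 ?mul1e ?mul0e.
- by move=> v Vv; rewrite /f memNset ?mul0r.
move=> h mh h0.
pose H v := (h (chart_inv v) * (\1_V v)%:E)%E.
have mH : measurable_fun setT H.
  by apply: emeasurable_funM; [exact: measurableT_comp mh mI|apply/measurable_EFinP; exact: measurable_indic].
have H0 v : (0 <= H v)%E by rewrite mule_ge0.
transitivity (\int[nu]_v H v)%E.
  transitivity (\int[nu0]_v H v)%E; last exact: eq_measure_integral.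
  rewrite (ge0_integral_image_measure (mrestr mu mQ) mF mH H0).
  rewrite integral_mrestr//; last exact: measurableT_comp mH mF.
  apply: eq_integral => y; rewrite inE => Qy; have [Vy yE] := chart_mapK Qy.
  by rewrite /H yE indicE mem_set// mule1.
rewrite -(Radon_Nikodym_SigmaFinite.change_of_variables nulam H0 measurableT mH).
by apply: eq_integral => v _; rewrite /H fE muleA.
Qed.

End density.

End regular_charts.

(** * Blowing up the manifold at a point *)

Section scaling.
Context {R : realType}.

Lemma integral_affine n (s : R) (c : 'rV[R]_n) (h : 'rV[R]_n -> \bar R) : 0 < s ->
  measurable_fun setT h -> (forall v, 0 <= h v)%E ->
  (\int[lebesgue_rV n]_v h v = (s ^+ n)%:E * \int[lebesgue_rV n]_v h (s *: v + c)%R)%E.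
Proof.
move=> s0 mh h0; have mA := measurable_affine_rV s c.
pose sn : {nonneg R} := NngNum (exprn_ge0 n (ltW s0)).
rewrite -(ge0_integral_image_measure (lebesgue_rV n) mA mh h0).
rewrite -[s ^+ n]/(sn%:num) -ge0_integral_mscale//.
by apply: eq_measure_integral => A mA' _; apply/esym; exact: lebesgue_rV_affine.
Qed.

Lemma nth_root m (a : R) : (0 < m)%N -> 0 < a -> exists2 s : R, 0 < s & s ^+ m = a.
Proof.
move=> m_gt0 a0; exists (a `^ m%:R^-1); first exact: powR_gt0.
rewrite -powR_mulrn ?powR_ge0// -powRrM mulVf ?powRr1 ?ltW// pnatr_eq0 -lt0n//.
Qed.

Variable d : nat.
Implicit Types (t r : R) (x y z w : 'rV[R]_d).

Lemma lte_if_scale c t (a b : R) : 0 < t -> lte_if c (t * a) (t * b) = lte_if c a b.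
Proof. by move=> t0; case: c; rewrite /lte_if ?ler_pM2l ?ltr_pM2l. Qed.

Lemma enorm_scale t x : 0 < t -> enorm (t *: x) = t * enorm x.
Proof. by move=> t0; rewrite enormZ gtr0_norm. Qed.

Lemma hits_scale C t x y z w : 0 < t ->
  hits C x (x + t *: y) (x + t *: z) (x + t *: w) = in_nball (~~ C) w y || in_nball (~~ C) w z.
Proof.
move=> t0; rewrite /hits /in_nball !(addrC x) !addrK -!scalerBr !enorm_scale//.
by rewrite !lte_if_scale.
Qed.

Lemma near_gamma_scale C t r x y z : 0 < t ->
  near_gamma C (r * t) x (x + t *: y) (x + t *: z) =
  [&& enorm y <= r, enorm z <= r & in_gamma C y z].
Proof.
move=> t0; rewrite /near_gamma /in_gamma !(addrC x) !addrK -!scalerBr !enorm_scale//.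
by rewrite (mulrC r) !ler_pM2l// -maxr_pMr ?(ltW t0)// lte_if_scale.
Qed.

End scaling.

Section blowup.
Context {R : realType} (m d : nat).
Local Notation Vd := 'rV[R]_d.
Local Notation Vm := 'rV[R]_m.
Local Notation lam := (@lebesgue_rV R m).
Variables (M : set Vd) (mu : probability Vd R).
Hypotheses (m_gt0 : (0 < m)%N) (mM : measurable M) (muM : mu (~` M) = 0%E).
Variables (O : set Vd) (F : Vd -> Vm) (phi : Vm -> Vd) (V : set Vm).
Hypothesis ch : regular_chart M mu O F phi V.
Variable f : Vm -> R.
Hypotheses (f0 : forall v, 0 <= f v) (intf : lam.-integrable setT (EFin \o f)).
Hypothesis fV : forall v, ~ V v -> f v = 0.
Hypothesis fE : forall h : Vd -> \bar R, measurable_fun setT h -> (forall y, 0 <= h y)%E ->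
  (\int[mu]_(y in M `&` O) h y = \int[lam]_v (h (chart_inv phi V v) * (f v)%:E))%E.
Variables (v0 : Vm) (n : nat -> nat) (t : nat -> R).
Hypotheses (Vv0 : V v0) (fv0 : 0 < f v0).
Hypothesis t_gt0 : forall k, 0 < t k.
Hypothesis t0 : t k @[k --> \oo] --> 0.
Hypothesis noo : n k @[k --> \oo] --> \oo.
Hypothesis nt : forall k, (n k)%:R * t k ^+ m = 1.
Hypothesis conv : forall N : nat,
  (\int[lam]_(w in eball N) `|f (v0 + t k *: w)%R - f v0|%:E @[k --> \oo] --> 0)%E.

Let x := phi v0.
(** The manifold seen from [x] at scale [t k]. Outside the chart the value is meaningless, but
    [blown_density] vanishes there. *)
Definition blown_chart k w : Vd := (t k)^-1 *: (chart_inv phi V (v0 + t k *: w) - x).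
Definition blown_density k w : R := f (v0 + t k *: w).
Local Notation phik := blown_chart.
Local Notation g := blown_density.

Lemma blown_chartE k w : x + t k *: phik k w = chart_inv phi V (v0 + t k *: w).
Proof. by rewrite /blown_chart scalerA mulfV ?scale1r ?gt_eqF// addrC subrK. Qed.

Lemma chart_x : M x /\ O x /\ F x = v0.
Proof. by case: ch => _ _ _ [_ /(_ _ Vv0)[]]. Qed.

Lemma chart_radius : exists2 r : R, 0 < r & forall y, enorm (y - x) <= r -> O y.
Proof.
case: ch => -[oO _] _ _ _ _; have [_ [Ox _]] := chart_x.
have /nbhs_ballP[r /= r0 rO] : nbhs x O by exact: open_nbhs_nbhs.
exists (r / 2); first by rewrite divr_gt0.
move=> y yr; apply: rO; rewrite -ball_normE /= distrC (le_lt_trans (norm_le_enorm _))//.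
by rewrite (le_lt_trans yr)// ltr_pdivrMr// ltr_pMr// ltr1n.
Qed.

(** Differentiability of [F] at [x] with error 1: [C] bounds the linear part, and [m] compares the
    norms. This stands in for an inverse to the derivative of [phi]. *)
Lemma chart_lipschitz : exists L r : R, [/\ 0 < L, 0 < r &
  forall y, enorm (y - x) <= r -> enorm (F y - v0) <= L * enorm (y - x)].
Proof.
case: ch => -[oO _] CF _ _ _; have [_ [Ox Fx]] := chart_x.
have [B HB] := class_C1_diff oO CF Ox.
have [r r0 rH] := HB 1 ltr01; have [C C0 CB] := mulmx_norm_bound B.
exists (m%:R * (C + 1)), (r / 2); split; [by rewrite mulr_gt0 ?ltr0n ?ltr_wpDl|by rewrite divr_gt0|].
move=> y yr; have yr' : `|y - x| < r.
  by rewrite (le_lt_trans (norm_le_enorm _))// (le_lt_trans yr)// ltr_pdivrMr// ltr_pMr// ltr1n.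
have := rH _ yr'; rewrite (addrC x) subrK Fx mul1r => H.
rewrite (le_trans (enorm_le_norm _))// -mulrA ler_wpM2l//.
rewrite (@le_trans _ _ ((C + 1) * `|y - x|))//; last by rewrite ler_wpM2l ?norm_le_enorm// addr_ge0.
rewrite mulrDl -[F y - v0](subrK ((y - x) *m B)) (le_trans (ler_normD _ _))//.
by rewrite [leLHS]addrC lerD ?mul1r// CB.
Qed.

Let Q := M `&` O.

(** The support of [h] lies in [O], and [mu] is carried by [M], so only one chart contributes; the
    substitution [v = v0 + t w] gives the factor [t^m]. *)
Lemma blowup_integral r k (h : Vd -> \bar R) : (forall y, enorm (y - x) <= r -> O y) ->
  measurable_fun setT h -> (forall y, 0 <= h y)%E -> (forall y, r < enorm (y - x) -> h y = 0%E) ->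
  (\int[mu]_y h y = (t k ^+ m)%:E * \int[lam]_w (h (x + t k *: phik k w)%R * (g k w)%:E))%E.
Proof.
move=> rO mh h0 hr; have mQ := measurable_chart_piece ch; have mI := measurable_chart_inv ch.
have mf : measurable_fun setT f by apply/measurable_EFinP; exact: measurable_int intf.
transitivity (\int[mu]_(y in Q) h y)%E.
  rewrite integral_mkcond [RHS]integral_mkcond; apply: ge0_ae_eq_integral => //.
  - by rewrite patch_setT.
  - by apply/(measurable_restrictT _ mQ); exact: measurable_funTS.
  - by move=> y _; rewrite patchE; case: ifP.
  - by move=> y _; rewrite patchE; case: ifP.
  exists (~` M); split => //; first exact: measurableC.
  move=> y /= H My; apply: H => _; rewrite !patchE mem_set//.
  have [Qy|Qy] := pselect (Q y); first by rewrite mem_set.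
  rewrite memNset// hr// ltNge; apply/negP => yr; apply: Qy; split => //; exact: rO.
rewrite fE// (integral_affine v0 (t_gt0 k)); last 2 first.
- apply: emeasurable_funM; first exact: measurableT_comp mh mI.
  exact/measurable_EFinP.
- by move=> v; rewrite mule_ge0// lee_fin.
by congr (_ * _)%E; apply: eq_integral => w _; rewrite blown_chartE /g addrC.
Qed.

Lemma measurable_blown_chart k : measurable_fun setT (phik k).
Proof.
have mI := measurable_chart_inv ch.
have mA : measurable_fun setT (fun w : Vm => v0 + t k *: w).
  by have := measurable_affine_rV (t k) v0; apply: eq_measurable_fun => w _; rewrite addrC.
have := measurableT_comp (measurable_affine_rV (t k)^-1 (- ((t k)^-1 *: x))) (measurableT_comp mI mA).
by apply: eq_measurable_fun => w _; rewrite /blown_chart scalerBr.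
Qed.

Lemma measurable_blown_density k : measurable_fun setT (g k).
Proof.
have mf : measurable_fun setT f by apply/measurable_EFinP; exact: measurable_int intf.
have mA : measurable_fun setT (fun w : Vm => v0 + t k *: w).
  by have := measurable_affine_rV (t k) v0; apply: eq_measurable_fun => w _; rewrite addrC.
exact: measurableT_comp mf mA.
Qed.

Lemma integrable_blown_density k : lam.-integrable setT (EFin \o g k).
Proof.
apply/integrableP; split; first by apply/measurable_EFinP; exact: measurable_blown_density.
have /integrableP[mf] := intf.
rewrite (integral_affine v0 (t_gt0 k)); last 2 first.
- exact: measurableT_comp.
- by move=> v; exact: abse_ge0.
move=> H; rewrite ltey; apply/eqP => E; move: H.
rewrite [X in (_ * X)%E](_ : _ = +oo%E) ?gt0_muley ?lte_fin ?exprn_gt0//.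
by rewrite -E; apply: eq_integral => w _; rewrite /= /g addrC.
Qed.

Lemma near_scaled (e C : R) : 0 < e -> \forall k \near \oo, t k * C < e.
Proof.
move=> e0; have : t k * C @[k --> \oo] --> 0 * C by apply: cvgMl.
by rewrite mul0r => /cvgr_lt; apply.
Qed.

(** Inside the chart [t w = F (x + t phik w) - v0], so the Lipschitz bound gives [|w| <= L |phik w|]
    after division by [t]. *)
Lemma blown_chart_confined r : exists N : nat, \forall k \near \oo,
  forall w, g k w != 0 -> enorm (phik k w) <= r -> enorm w <= N%:R.
Proof.
have [L [r1 [L0 r10 HL]]] := chart_lipschitz.
exists (Num.bound (L * `|r|)); near=> k => w gw wr.
have Vw : V (v0 + t k *: w).
  by apply: contrapT => nV; move/eqP : gw; apply; exact: fV.
have E := blown_chartE k w; rewrite (chart_invE _ Vw) in E.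
have [My Oy Fy] : [/\ M (x + t k *: phik k w), O (x + t k *: phik k w) & F (x + t k *: phik k w) = v0 + t k *: w].
  by rewrite E; case: ch => _ _ _ [_ /(_ _ Vw)].
have := HL (x + t k *: phik k w); rewrite Fy !(addrC _ (t k *: _)) !addrK (enorm_scale w (t_gt0 k)) (enorm_scale (phik k w) (t_gt0 k)).
have tr : t k * enorm (phik k w) <= r1.
  rewrite (@le_trans _ _ (t k * `|r|))//; last by rewrite ltW//; near: k; exact: near_scaled.
  by rewrite ler_pM2l// (le_trans wr)// ler_norm.
move=> /(_ tr); rewrite mulrCA ler_pM2l// => /le_trans; apply.
rewrite (@le_trans _ _ (L * `|r|))//; last by rewrite ltW// archi_boundP// mulr_ge0// ltW.
by rewrite ler_pM2l// (le_trans wr)// ler_norm.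
Unshelve. all: by end_near. Qed.

(** [A] is the derivative of [phi] at [v0]. If [u A = 0], then [phi (v0 + t u) - x] is negligible
    before [t]; applying [F], which is Lipschitz at [x], [t u] would be so too. *)
Lemma blown_chart_cvg : exists A : 'M[R]_(m, d),
  (forall u : Vm, phik k u @[k --> \oo] --> u *m A) /\ (forall u : Vm, u *m A = 0 -> u = 0).
Proof.
case: (ch) => -[_ oV] _ Cphi _ _.
have [A HA] := class_C1_diff oV Cphi Vv0.
have /nbhs_ballP[rv /= rv0 rvV] : nbhs v0 V by exact: open_nbhs_nbhs.
have nearV u : \forall k \near \oo, V (v0 + t k *: u).
  near=> k; apply: rvV; rewrite -ball_normE /= opprD addrA subrr add0r normrN normrZ gtr0_norm//.
  by near: k; exact: near_scaled.
have err u e : 0 < e -> \forall k \near \oo, `|phik k u - u *m A| <= e * `|u|.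
  move=> e0; have [r r0 Hr] := HA _ e0; near=> k.
  have Vu : V (v0 + t k *: u) by near: k; exact: nearV.
  rewrite /blown_chart (chart_invE _ Vu).
  have := Hr (t k *: u); rewrite normrZ gtr0_norm// => /(_ _).
  have tu : t k * `|u| < r by near: k; exact: near_scaled.
  move=> /(_ tu); rewrite mulrCA -ler_pdivrMl// => H.
  apply: le_trans H; rewrite -[X in _ <= X * _]gtr0_norm ?invr_gt0// -normrZ.
  by rewrite [in leRHS]scalerBr -[in leRHS]scalemxAl [in leRHS]scalerA mulVf ?gt_eqF// scale1r.
exists A; split=> u.
  apply/cvgrPdist_le => e e0.
  have e'0 : 0 < e / (`|u| + 1) by rewrite divr_gt0// ltr_wpDl.
  near=> k; rewrite distrC.
  have : `|phik k u - u *m A| <= e / (`|u| + 1) * `|u| by near: k; exact: err.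
  move=> /le_trans; apply; rewrite mulrAC ler_pdivrMr ?ltr_wpDl// ler_pM2l//.
  by rewrite lerDl.
move=> uA; have [L [r1 [L0 r10 HL]]] := chart_lipschitz.
apply/eqP; rewrite -enorm_eq0; apply/eqP/le_anti; rewrite enorm_ge0 andbT.
have [->|u0] := eqVneq u 0; first by rewrite enorm0.
(* Chosen so that [L (d + 1) e = 1/2], whence [|u| <= |u| / 2] below. *)
pose e := (2 * L * (d%:R + 1))^-1.
have dR : 0 < d%:R + 1 :> R by rewrite ltr_wpDl.
have e0 : 0 < e by rewrite invr_gt0 !mulr_gt0.
have : \forall k \near \oo, enorm u <= 2^-1 * enorm u.
  near=> k; have Vu : V (v0 + t k *: u) by near: k; exact: nearV.
  have E := blown_chartE k u; rewrite (chart_invE _ Vu) in E.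
  have [_ _ Fy] : [/\ M (x + t k *: phik k u), O (x + t k *: phik k u) & F (x + t k *: phik k u) = v0 + t k *: u].
    by rewrite E; case: ch => _ _ _ [_ /(_ _ Vu)].
  have pe : `|phik k u| <= e * `|u|.
    by rewrite -[phik k u]subr0 -uA; near: k; exact: err.
  have pe' : enorm (phik k u) <= d%:R * (e * `|u|) by rewrite (le_trans (enorm_le_norm _))// ler_wpM2l.
  have := HL (x + t k *: phik k u); rewrite Fy !(addrC _ (t k *: _)) !addrK (enorm_scale u (t_gt0 k)) (enorm_scale (phik k u) (t_gt0 k)).
  have tr : t k * enorm (phik k u) <= r1.
    rewrite (@le_trans _ _ (t k * (d%:R * (e * `|u|))))//; first by rewrite ler_pM2l.
    by rewrite ltW//; near: k; exact: near_scaled.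
  move=> /(_ tr); rewrite mulrCA ler_pM2l// => /le_trans; apply.
  rewrite (@le_trans _ _ (L * (d%:R * (e * `|u|))))//; first by rewrite ler_pM2l.
  rewrite (@le_trans _ _ (L * ((d%:R + 1) * (e * enorm u))))//.
    rewrite ler_pM2l// ler_pM ?mulr_ge0 ?(ltW e0) ?lerDl//.
    by rewrite ler_pM2l// norm_le_enorm.
  rewrite le_eqVlt /e; apply/orP; left; apply/eqP; field.
  by rewrite !gt_eqF.
move=> [k _ /(_ k (leqnn k))]; have := enorm_ge0 u; lra.
Unshelve. all: by end_near. Qed.

Lemma measurable_blown_point k : measurable_fun setT (fun w => x + t k *: phik k w).
Proof.
have := measurable_chart_inv ch; move=> mI.
have mA : measurable_fun setT (fun w : Vm => v0 + t k *: w).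
  by have := measurable_affine_rV (t k) v0; apply: eq_measurable_fun => w _; rewrite addrC.
by have := measurableT_comp mI mA; apply: eq_measurable_fun => w _; rewrite blown_chartE.
Qed.

Lemma missE C (a b c : Vd) : miss mu C a b c = 1 - fine (mu [set w | hits C a b c w]).
Proof.
have mH : measurable [set w | hits C a b c w].
  by apply: measurable_setb; apply: measurable_hits.
rewrite /miss -[1]/(fine 1%:E) -fineB ?fin_num_measure//; congr fine.
rewrite -probability_setC//; congr (mu _); apply/seteqP; split => w /=; first by move/negP.
by move=> H; apply/negP.
Qed.

Lemma scaled_mass (b : Vd -> bool) r k : (forall y, enorm (y - x) <= r -> O y) ->
  measurable_fun setT b -> (forall y, b y -> enorm (y - x) <= r) ->
  (n k)%:R * fine (mu [set y | b y]) =
  fine (\int[lam]_w ((b (x + t k *: phik k w)%R)%:R * g k w)%:E)%E.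
Proof.
move=> rO mb br; have mB := measurable_setb mb.
have -> : (mu [set y | b y] = (t k ^+ m)%:E * \int[lam]_w ((b (x + t k *: phik k w)%R)%:R * g k w)%:E)%E.
  transitivity (\int[mu]_y (b y)%:R%:E)%E; last first.
    rewrite (@blowup_integral r k (fun y => (b y)%:R%:E))//.
    - by apply/measurable_EFinP; exact: measurable_boolR.
    - by move=> y ry; case: (boolP (b y)) => // /br; rewrite leNgt ry.
  rewrite -[X in mu X]setIT -integral_indic//; apply: eq_integral => y _.
  rewrite indicE; congr (_%:R%:E); congr nat_of_bool.
  by apply/idP/idP; rewrite inE.
have tm0 : 0 < t k ^+ m by rewrite exprn_gt0.
have : (0 <= \int[lam]_w ((b (x + t k *: phik k w)%R)%:R * g k w)%:E)%E.
  by apply: integral_ge0 => w _; rewrite lee_fin; apply: mulr_ge0 => //; exact: f0.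
(* The relation [n t^m = 1] settles the finite case; for an infinite integral both sides are 0, the
   value of [fine] at infinity. *)
move: (\int[lam]_w _)%E => [I| |] //=.
  by move=> _; rewrite mulrA nt mul1r.
by move=> _; rewrite gt0_muley ?lte_fin//= mulr0.
Qed.

Definition hit_probability C k (q : Vm * Vm) : R :=
  1 - miss mu C x (x + t k *: phik k q.1) (x + t k *: phik k q.2).

Lemma measurable_hit_probability C k : measurable_fun setT (hit_probability C k).
Proof.
apply: measurable_funB => //; apply: measurable_miss => //.
  exact: measurableT_comp (measurable_blown_point k) measurable_fst.
exact: measurableT_comp (measurable_blown_point k) measurable_snd.
Qed.

Lemma hit_probability01 C k q : 0 <= hit_probability C k q <= 1.
Proof.
rewrite /hit_probability missE opprB addrCA subrr addr0 fine_ge0//=.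
rewrite -lee_fin fineK ?fin_num_measure//; first apply: probability_le1.
all: by apply: measurable_setb; apply: measurable_hits.
Qed.

(** A ball through [x] centred at distance at most [t r] from it stays within [2 t r] of [x], hence
    eventually inside the domain of the chart. *)
Lemma hit_probability_scaled C r : \forall k \near \oo, forall u v,
  enorm (phik k u) <= r -> enorm (phik k v) <= r ->
  (n k)%:R * hit_probability C k (u, v) = fine (\int[lam]_w
    ((in_nball (~~ C) (phik k w) (phik k u) || in_nball (~~ C) (phik k w) (phik k v))%:R * g k w)%:E)%E.
Proof.
have [r0 r00 rO] := chart_radius.
near=> k => u v ur vr; rewrite /hit_probability missE opprB addrCA subrr addr0.
rewrite (@scaled_mass _ r0 k rO).
- by congr fine; apply: eq_integral => w _; rewrite hits_scale.
- exact: measurable_hits.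
have rt : t k * (2 * `|r|) <= r0 by rewrite ltW//; near: k; exact: near_scaled.
have H (y a : Vd) : enorm a <= r -> in_nball (~~ C) (y - x) (t k *: a) -> enorm (y - x) <= r0.
  move=> ar Hy; apply: le_trans rt.
  have E := enorm_scale a (t_gt0 k).
  have la : t k * enorm a <= t k * `|r| by rewrite ler_pM2l// (le_trans ar)// ler_norm.
  have : enorm (y - x - t k *: a) <= enorm (t k *: a).
    by move: Hy; rewrite /in_nball /lte_if; case: C => //= /ltW.
  have := ler_enormD (y - x - t k *: a) (t k *: a); rewrite subrK E; lra.
by move=> y; rewrite /hits (addrC x) addrK (addrC x) addrK => /orP[]; exact: H.
Unshelve. all: by end_near. Qed.

(** Each of the two integrals contributes [t^m], and [n^2 t^m t^m = 1]. The shape of a star is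
    invariant under dilation. *)
Lemma star_mass_blowup C r r0 j k : (forall y, enorm (y - x) <= r0 -> O y) -> r * t k <= r0 ->
  (((n k)%:R ^+ 2)%:E * star_mass mu C (n k - j) (r * t k) x =
  \int[lam \x lam]_q (pair_weight phik n (hit_probability C) r C j k q *
     (g k q.1 * g k q.2))%:E)%E.
Proof.
move=> rO rt.
pose W y z := ((near_gamma C (r * t k) x y z)%:R * miss mu C x y z ^+ (n k - j))%:E.
have W0 y z : (0 <= W y z)%E by exact: star_weight_ge0.
have mW : measurable_fun setT (fun q : Vd * Vd => W q.1 q.2) by apply: measurable_star_weight.
have near_le y z : W y z != 0%E -> enorm (y - x) <= r0 /\ enorm (z - x) <= r0.
  rewrite /W; case: (boolP (near_gamma _ _ _ _ _)) => [/and3P[h1 h2 _] _|]; last by rewrite mul0r eqxx.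
  by split; apply: le_trans rt.
pose G := fubini_F mu (fun q : Vd * Vd => W q.1 q.2).
have mG : measurable_fun setT G by exact: (@measurable_fun_fubini_tonelli_F _ _ _ _ R mu _ mW).
have G0 y : (0 <= G y)%E by apply: integral_ge0 => z _.
have GE y : G y = ((t k ^+ m)%:E * \int[lam]_w (W y (x + t k *: phik k w)%R * (g k w)%:E))%E.
  apply: (@blowup_integral r0 k (W y)) => //.
    by apply: measurable_star_weight.
  by move=> z rz; apply/eqP; apply/negPn/negP => /near_le[_]; rewrite leNgt rz.
have -> : star_mass mu C (n k - j) (r * t k) x = (\int[mu]_y G y)%E by [].
rewrite (@blowup_integral r0 k G)//; last first.
  move=> y ry; apply: integral0_eq => z _.
  by apply/eqP; apply/negPn/negP => /near_le[]; rewrite leNgt ry.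
pose pw := pair_weight phik n (hit_probability C) r C j k.
have WE u w : W (x + t k *: phik k u) (x + t k *: phik k w) = (pw (u, w))%:E.
  by rewrite /W /pw /pair_weight near_gamma_scale// /hit_probability opprB addrCA subrr addr0.
have g0 w : 0 <= g k w by exact: f0.
have pw0 q : 0 <= pw q.
  rewrite mulr_ge0// exprn_ge0// subr_ge0.
  by have /andP[] := hit_probability01 C k q.
have mpw : measurable_fun setT pw.
  by apply: measurable_pair_weight => [k'|k']; [exact: measurable_blown_chart|exact: measurable_hit_probability].
pose K q := (pw q * (g k q.1 * g k q.2))%:E.
have mg := measurable_blown_density k.
have mK : measurable_fun setT K.
  apply/measurable_EFinP; apply: measurable_funM => //; apply: measurable_funM.
    exact: measurableT_comp mg measurable_fst.
  exact: measurableT_comp mg measurable_snd.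
have K0 q : (0 <= K q)%E by rewrite lee_fin; apply: mulr_ge0 => //; exact: mulr_ge0.
rewrite -/(K _) (@fubini_tonelli1 _ _ _ _ _ lam lam _ mK K0).
have mFK : measurable_fun setT (fubini_F lam K) by exact: (@measurable_fun_fubini_tonelli_F _ _ _ _ R lam _ mK K0).
have FK0 u : (0 <= fubini_F lam K u)%E by apply: integral_ge0.
transitivity (((n k)%:R ^+ 2)%:E * ((t k ^+ m)%:E * \int[lam]_u ((t k ^+ m)%:E * fubini_F lam K u)))%E.
  congr (_ * (_ * _))%E; apply: eq_integral => u _; rewrite GE -muleA; congr (_ * _)%E.
  rewrite -ge0_integralZr//; first last.
  - exact: f0.
  - by move=> w _; rewrite mule_ge0// lee_fin; exact: f0.
  - apply: emeasurable_funM; last exact/measurable_EFinP.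
    by apply: measurable_star_weight => //; exact: measurable_blown_point.
  by apply: eq_integral => w _; rewrite WE /K /= -!EFinM -mulrA (mulrC (g k w)).
rewrite ge0_integralZl//; last by rewrite lee_fin exprn_ge0// ltW.
rewrite !muleA -!EFinM expr2 (_ : _ * _ * _ * _ = 1) ?mul1e//.
by rewrite -mulrA mulrACA nt mul1r.
Qed.

(** With [T0] isometric to [A] and [e] its volume factor, take [T = s T0] where [s^m = c e]. The
    density [c] becomes 1 at the price of the scale [s] on lengths. *)
Lemma normalized_chart (A : 'M[R]_(m, d)) (c : R) : 0 < c -> (forall u : Vm, u *m A = 0 -> u = 0) ->
  exists (T : 'M[R]_m) (s : R), [/\ T \in unitmx, 0 < s,
    forall B : set Vm, measurable B -> (c%:E * lam ((fun v => v *m T) @^-1` B) = lam B)%E &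
    forall u : Vm, enorm (u *m A) = enorm (u *m T) / s].
Proof.
move=> c0 injA; have [T0 uT0 TA] := isometric_square injA.
have [e e0 He] := lebesgue_rV_linear uT0.
have [s s0 sE] := nth_root m_gt0 (mulr_gt0 c0 e0).
exists (s *: T0), s; split => //.
- by rewrite unitmxZ// unitfE gt_eqF.
- move=> B mB; pose B' := (fun v => s *: v + 0) @^-1` B.
  have mB' : measurable B' by rewrite -[X in measurable X]setTI; exact: measurable_affine_rV.
  have -> : (fun v : Vm => v *m (s *: T0)) @^-1` B = (fun v => v *m T0) @^-1` B'.
    by apply/seteqP; split => v; rewrite /B' /= addr0 scalemxAr.
  by rewrite He// muleA -EFinM -sE lebesgue_rV_affine.
- move=> u; rewrite -scalemxAr enormZ gtr0_norm// mulrC mulKf ?gt_eqF//; exact/esym/TA.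
Qed.

(** The factor [s] depends neither on [r] nor on [C]: this lets the radius tend to infinity
    afterwards, with the same [s] for both versions of stars. *)
Theorem blowup_limits : exists2 s : R, 0 < s & forall (r : R) (C : bool),
  (((n k)%:R ^+ 2)%:E * star_mass mu C (n k - 3) (r * t k) x @[k --> \oo] --> pair_integral m (r * s))%E /\
  far_mass mu (r * t k) x ^+ (n k).-1 @[k --> \oo] --> expR (- fine (lam (cball (r * s)))).
Proof.
have [A [phiA injA]] := blown_chart_cvg.
have [T [s [uT s0 lamT AT]]] := normalized_chart fv0 injA.
exists s => // r C; have [r0 r00 rO] := chart_radius.
have mphi := measurable_blown_chart; have mg := measurable_blown_density.
have g0 k w : 0 <= g k w by exact: f0.
have ec := @enorm_continuous R d.
have phi1 u : enorm (phik k u) @[k --> \oo] --> enorm (u *m T) / s.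
  by rewrite -AT; apply: continuous_cvg; [exact: ec|exact: phiA].
have phiB u v : enorm (phik k u - phik k v) @[k --> \oo] --> enorm ((u - v) *m T) / s.
  rewrite -AT mulmxBl; apply: continuous_cvg; [exact: ec|].
  by apply: cvgB; exact: phiA.
have rt : \forall k \near \oo, r * t k <= r0.
  near=> k; rewrite mulrC ltW//; near: k; exact: near_scaled.
split.
  have := pair_limit m_gt0 uT s0 fv0 lamT mphi mg g0 integrable_blown_density noo conv phiB phi1
    blown_chart_confined 3 (@measurable_hit_probability C) (hit_probability01 C)
    (hit_probability_scaled C r).
  apply: cvg_trans; apply: near_eq_cvg; near=> k.
  by rewrite (@star_mass_blowup C r r0)//; near: k; exact: rt.
have H : (\int[lam]_w ((enorm (phik k w) <= r)%R%:R * g k w)%:E @[k --> \oo] --> lam (cball (r * s)))%E.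
  exact: (volume_cvg m_gt0 uT s0 fv0 lamT mphi integrable_blown_density conv phi1
    blown_chart_confined).
pose q k := fine (mu [set w | enorm (w - x) <= r * t k]).
have mB k : measurable [set w : Vd | enorm (w - x) <= r * t k].
  apply: measurable_setb; apply: measurable_fun_ler => //.
  by apply: measurable_enorm; exact: measurable_subrV.
have -> : (fun k => far_mass mu (r * t k) x ^+ (n k).-1) = (fun k => (1 - q k) ^+ (n k - 1)).
  apply/funext => k; rewrite subn1 /far_mass /q -[1]/(fine 1%:E) -fineB ?fin_num_measure//.
  rewrite -probability_setC//; congr (fine (mu _) ^+ _); apply/seteqP; split => w /=; first by move/negP.
  by move=> ?; apply/negP.
apply: pow_onem_cvg => //.
  move=> k; rewrite fine_ge0//= -lee_fin fineK ?fin_num_measure//.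
  exact: probability_le1.
have : fine (\int[lam]_w ((enorm (phik k w) <= r)%R%:R * g k w)%:E)%E @[k --> \oo] --> fine (lam (cball (r * s))).
  apply: fine_cvg; rewrite fineK//.
  by rewrite ge0_fin_numE// cball_lty.
apply: cvg_trans; apply: near_eq_cvg; near=> k.
rewrite /q (@scaled_mass (fun w => enorm (w - x) <= r * t k) r0 k rO).
- congr fine; apply: eq_integral => w _.
  by rewrite (addrC x) addrK (enorm_scale (phik k w) (t_gt0 k)) (mulrC r) ler_pM2l.
- apply: measurable_fun_ler => //.
  by apply: measurable_enorm; exact: measurable_subrV.
- move=> y /le_trans; apply; near: k; exact: rt.
Unshelve. all: by end_near. Qed.

End blowup.

(** * Convergence of the expectation *)

Section limits.
Context {R : realType}.

(** Iterated limits: for fixed [r] the bounds converge in [k], and their limits meet when [r] grows.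
    No uniformity in [r] is required. *)
Lemma double_squeeze (u : nat -> \bar R) (lo hi : nat -> nat -> \bar R) (a b : nat -> \bar R) (c : \bar R) :
  c \is a fin_num ->
  (forall r, \forall k \near \oo, (lo r k <= u k <= hi r k)%E) ->
  (forall r, lo r k @[k --> \oo] --> a r)%E -> (forall r, hi r k @[k --> \oo] --> b r)%E ->
  (a r @[r --> \oo] --> c)%E -> (b r @[r --> \oo] --> c)%E -> (u k @[k --> \oo] --> c)%E.
Proof.
move=> cfin lu loa hib ac bc.
have H (e : R) : 0 < e -> \forall k \near \oo, u k \is a fin_num /\ `|fine c - fine (u k)| <= e.
  move=> e0; have e20 : 0 < e / 2 by rewrite divr_gt0.
  rewrite -(fineK cfin) in ac bc.
  move/fine_cvgP : ac => [fa /cvgrPdist_le /(_ _ e20) da].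
  move/fine_cvgP : bc => [fb /cvgrPdist_le /(_ _ e20) db].
  have [r [ra rb rda rdb]] : exists r, [/\ a r \is a fin_num, b r \is a fin_num,
      `|fine c - fine (a r)| <= e / 2 & `|fine c - fine (b r)| <= e / 2].
    near \oo => r; exists r; split; near: r => //.
  have {}loa := loa r; have {}hib := hib r.
  rewrite -(fineK ra) in loa; rewrite -(fineK rb) in hib.
  move/fine_cvgP : loa => [fl /cvgrPdist_le /(_ _ e20) dl].
  move/fine_cvgP : hib => [fh /cvgrPdist_le /(_ _ e20) dh].
  near=> k.
  have /andP[l1 l2] : (lo r k <= u k <= hi r k)%E by near: k; exact: lu.
  have flk : lo r k \is a fin_num by near: k; exact: fl.
  have fhk : hi r k \is a fin_num by near: k; exact: fh.
  have fu : u k \is a fin_num.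
    by rewrite fin_numE -ltNye -ltey (lt_le_trans _ l1) ?(le_lt_trans l2) ?ltNye_eq ?ltey_eq ?flk ?fhk.
  split => //.
  rewrite -(fineK flk) -(fineK fu) lee_fin in l1; rewrite -(fineK fhk) -(fineK fu) lee_fin in l2.
  have : `|fine (a r) - fine (lo r k)| <= e / 2 by near: k; exact: dl.
  have : `|fine (b r) - fine (hi r k)| <= e / 2 by near: k; exact: dh.
  move: rda rdb; rewrite !ler_norml => /andP[? ?] /andP[? ?] /andP[? ?] /andP[? ?].
  by apply/andP; split; lra.
rewrite -(fineK cfin); apply/fine_cvgP; split.
  by apply: filterS (H 1 ltr01) => k [].
by apply/cvgrPdist_le => e e0; apply: filterS (H e e0) => k [].
Unshelve. all: by end_near. Qed.

(** If a neighborhood of [c] is missed infinitely often, [sigma] enumerates misses only. The lower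
    bound [N] lets the argument ignore small samples. *)
Lemma subsequence_principle (T : topologicalType) (u : nat -> T) (c : T) (N : nat) :
  (forall sigma : nat -> nat, (forall k, N <= sigma k)%N -> (forall k, sigma k < sigma k.+1)%N ->
    exists2 rho : nat -> nat, (forall k, rho k < rho k.+1)%N & u (sigma (rho k)) @[k --> \oo] --> c) ->
  u k @[k --> \oo] --> c.
Proof.
move=> H A Ac; apply: contrapT => nA.
have G (j : nat) : exists k, (j <= k)%N /\ ~ A (u k).
  apply: contrapT => nk; apply: nA; exists j => // k /= jk.
  by apply: contrapT => nAk; apply: nk; exists k.
have [g gP] := choice G.
pose sigma := fix s k := if k is k'.+1 then g (s k').+1 else g N.
have sS k : (sigma k < sigma k.+1)%N by have [] := gP (sigma k).+1.
have sN k : (N <= sigma k)%N.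
  elim: k => [|k IH]; first by have [] := gP N.
  by rewrite (leq_trans IH)// ltnW.
have nAs k : ~ A (u (sigma k)) by case: k => [|k]; exact: (gP _).2.
have [rho _ /(_ A Ac)] := H sigma sN sS.
by case=> k _ /(_ k (leqnn k)) /nAs.
Qed.

Lemma increasing_cvg (s : nat -> nat) : (forall k, s k < s k.+1)%N -> s k @[k --> \oo] --> \oo.
Proof.
move=> sS; have sk k : (k <= s k)%N by elim: k => // k IH; rewrite (leq_ltn_trans IH).
by apply/cvgnyPge => A; exists A => // k /= Ak; rewrite (leq_trans Ak).
Qed.

Lemma bounded_ae_cvg dT (T : measurableType dT) (mu : probability T R) (u : nat -> T -> \bar R)
    (h : T -> \bar R) (B : R) :
  (forall k, measurable_fun setT (u k)) -> measurable_fun setT h ->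
  {ae mu, forall x, u k x @[k --> \oo] --> h x} ->
  {ae mu, forall x k, (0 <= u k x <= B%:E)%E} ->
  (\int[mu]_x u k x @[k --> \oo] --> \int[mu]_x h x)%E.
Proof.
move=> mu_ mh uh uB.
have [] := @dominated_convergence _ _ _ mu setT measurableT u h (cst B%:E) mu_ mh.
- by apply: filterS uh => x + _.
- exact: finite_measure_integrable_cst.
- by apply: filterS uB => x H k _; have /andP[u0 u1] := H k; rewrite gee0_abs.
- by [].
Qed.

Lemma cvg_ratio_pred (n : nat -> nat) : (forall k, 0 < n k)%N -> n k @[k --> \oo] --> \oo ->
  ((n k).-1 * (n k).-2)%:R / (n k)%:R ^+ 2 @[k --> \oo] --> (1 : R).
Proof.
move=> n0 noo.
have ninv : (n k)%:R^-1 @[k --> \oo] --> (0 : R).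
  apply/gtr0_cvgV0; first by apply: nearW => k; rewrite ltr0n.
  exact/cvgrnyP.
have H : (1 - (n k)%:R^-1) * (1 - 2 * (n k)%:R^-1) @[k --> \oo] --> ((1 - 0) * (1 - 2 * 0) : R).
  by apply: cvgM; apply: cvgB => //; [exact: cvg_cst|exact: cvg_cst|exact: cvgMr].
rewrite !(mulr0, subr0, mul1r) in H; apply: cvg_trans H; apply: near_eq_cvg; near=> k.
have n2 : (2 <= n k)%N by near: k; move/cvgnyPge : noo => /(_ 2%N).
have -> : ((n k).-1 * (n k).-2)%:R = ((n k)%:R - 1) * ((n k)%:R - 2) :> R.
  have -> : (n k).-2 = (n k - 2)%N by lia.
  have -> : (n k).-1 = (n k - 1)%N by lia.
  by rewrite natrM !natrB// ltnW.
have nz : (n k)%:R != 0 :> R by rewrite pnatr_eq0 -lt0n.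
by field.
Unshelve. all: by end_near. Qed.

End limits.

Section atlas_limits.
Context {R : realType} (m d : nat).
Local Notation Vd := 'rV[R]_d.
Local Notation Vm := 'rV[R]_m.
Local Notation lam := (@lebesgue_rV R m).
Variables (M : set Vd) (mu : probability Vd R).
Hypothesis m_gt0 : (0 < m)%N.
Hypothesis manifold : smooth_submanifold m M.
Hypothesis law_ac : forall x, M x ->
    forall (U : set Vd) (psi : Vd -> Vm),
      chart M U psi -> U x ->
      pushforward (restriction mu U) psi `<< restriction lam (psi @` U).

Lemma measurable_manifold : measurable M.
Proof.
have [D [F [phi [V [ch cover]]]]] := regular_atlas manifold law_ac.
have -> : M = \bigcup_l (M `&` D l).
  apply/seteqP; split => [x Mx|x [l _ []]//]; have [l Ol] := cover x Mx.
  by exists l.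
by apply: bigcup_measurable => l _; exact: measurable_chart_piece (ch l).
Qed.

Hypothesis muM : mu (~` M) = 0%E.

(** In a chart a point is a sphere of radius 0, of Lebesgue measure 0 since [0 < m]. *)
Lemma manifold_atomless x : mu [set x] = 0%E.
Proof.
have mx := measurable_point x.
have [Mx|nMx] := pselect (M x); last first.
  apply/eqP; rewrite eq_le measure_ge0 andbT -muM; apply: le_measure; rewrite ?inE//.
    exact: measurableC measurable_manifold.
  by move=> y ->.
have [D [F [phi [V [ch Dx]]]]] := regular_chart_exists manifold law_ac Mx.
have mpt : measurable [set F x] by exact: measurable_point.
have pt0 : lam [set F x] = 0%E.
  rewrite -(lebesgue_rV_sphere (F x) 0 m_gt0); congr (lebesgue_rV m _).
  apply/seteqP; split => [v -> /=|v /= /eqP]; first by rewrite subrr enorm0.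
  by rewrite enorm_eq0 subr_eq0 => /eqP.
have := ch; case=> _ _ _ _ /(_ _ mpt) H.
have H0 : mu ((M `&` D) `&` F @^-1` [set F x]) = 0%E.
  apply: H; apply/eqP; rewrite eq_le measure_ge0 andbT -pt0; apply: le_measure; rewrite ?inE//.
  by apply: measurableI => //; apply: open_measurable_rV; case: ch => -[].
apply/eqP; rewrite eq_le measure_ge0 andbT -H0; apply: le_measure; rewrite ?inE//.
  rewrite (_ : _ `&` _ = (M `&` D) `&` chart_map M D F @^-1` [set F x]).
    apply: measurableI; first exact: measurable_chart_piece ch.
    by rewrite -[X in measurable X]setTI; exact: measurable_chart_map ch _ _ mpt.
  by apply/seteqP; split => y [Qy] /= E; split => //=; [rewrite chart_mapE|rewrite -(chart_mapE F Qy)].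
by move=> y ->.
Qed.

Theorem local_limits (n : nat -> nat) (t : nat -> R) :
  n k @[k --> \oo] --> \oo -> (forall k, 0 < t k) -> t k @[k --> \oo] --> 0 ->
  (forall k, (n k)%:R * t k ^+ m = 1) ->
  exists2 rho : nat -> nat, (forall k, rho k < rho k.+1)%N &
  {ae mu, forall x, exists2 s : R, 0 < s & forall (r : R) (C : bool),
    (((n (rho k))%:R ^+ 2)%:E * star_mass mu C (n (rho k) - 3) (r * t (rho k)) x @[k --> \oo] -->
      pair_integral m (r * s))%E /\
    far_mass mu (r * t (rho k)) x ^+ (n (rho k)).-1 @[k --> \oo] --> expR (- fine (lam (cball (r * s))))}.
Proof.
move=> noo t_gt0 t0 nt.
have [D [F [phi [V [ch cover]]]]] := regular_atlas manifold law_ac.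
have [f fP] := choice (fun l => chart_density (ch l)).
have fint l : lam.-integrable setT (EFin \o f l) by have [] := fP l.
(* One subsequence for all charts, so that it does not depend on the centre. *)
have [rho rhoS bl] := blowup_subsequence fint t0.
exists rho => //.
have rhooo := increasing_cvg rhoS.
(* The exceptional null set lives in the parameter space; absolute continuity of the law carries it
   back to the manifold. *)
have good1 l : {ae mu, forall x, (M `&` D l) x -> forall N : nat,
   (\int[lam]_(w in eball N) `|f l (F l x + t (rho k) *: w)%R - f l (F l x)|%:E @[k --> \oo] --> 0)%E}.
  have [Z [mZ Z0 ZP]] := bl l.
  exists ((M `&` D l) `&` chart_map M (D l) (F l) @^-1` Z); split.
  - apply: measurableI; first exact: measurable_chart_piece (ch l).
    by rewrite -[X in measurable X]setTI; exact: measurable_chart_map (ch l) _ _ mZ.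
  - rewrite (_ : _ `&` _ = (M `&` D l) `&` F l @^-1` Z); last first.
      by apply/seteqP; split => y [Qy] /= E; split => //=; [rewrite -(chart_mapE (F l) Qy)|rewrite chart_mapE].
    case: (ch l) => -[_ oV] _ _ _; apply => //.
    apply/eqP; rewrite eq_le measure_ge0 andbT -Z0; apply: le_measure; rewrite ?inE//.
    by apply: measurableI => //; exact: open_measurable_rV.
  - move=> x /= /not_implyP[Qx nx]; split => //=; rewrite chart_mapE//.
    exact: ZP.
(* Positivity of the density is needed for the normalization; the set where [f] vanishes has
   [mu]-mass equal to the integral of [f] over it, that is 0. *)
have good2 l : {ae mu, forall x, (M `&` D l) x -> 0 < f l (F l x)}.
  have [f0 _ fV fE] := fP l; have mc := measurable_chart_map (ch l).
  have mQ := measurable_chart_piece (ch l).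
  have mf : measurable_fun setT (f l) by apply/measurable_EFinP; exact: measurable_int (fint l).
  pose b y : bool := f l (chart_map M (D l) (F l) y) <= 0.
  have mb : measurable_fun setT b by apply: measurable_fun_ler => //; exact: measurableT_comp mf mc.
  exists ((M `&` D l) `&` [set y | b y]); split.
  - by apply: measurableI => //; exact: measurable_setb.
  - transitivity (\int[mu]_(y in M `&` D l) (b y)%:R%:E)%E.
      rewrite setIC -integral_indic//; last exact: measurable_setb.
      apply: eq_integral => y _; rewrite indicE; congr (_%:R%:E); congr nat_of_bool.
      by apply/idP/idP; rewrite inE.
    rewrite fE//; last by apply/measurable_EFinP; exact: measurable_boolR.
    apply: integral0_eq => v _; have [Vv|Vv] := pselect (V l v); last by rewrite fV// mule0.
    have [_ E] := chart_invK (ch l) Vv; rewrite /b E.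
    case: leP => [fv|_]; last by rewrite mul0e.
    by rewrite mul1e; congr EFin; apply/le_anti; rewrite fv f0.
  - move=> x /= /not_implyP[Qx /negP]; rewrite -leNgt => fx; split => //.
    by rewrite /b /= chart_mapE.
have aeM : {ae mu, forall x, M x}.
  by exists (~` M); split => //; exact: measurableC measurable_manifold.
apply: filterS3 aeM (ae_foralln good1) (ae_foralln good2) => x Mx g1 g2; have [l Dx] := cover x Mx.
have [Vx xE] : V l (F l x) /\ phi l (F l x) = x by case: (ch l) => _ _ _ [/(_ _ Mx Dx)].
have [f0 _ fV fE] := fP l.
rewrite -xE.
apply: (blowup_limits m_gt0 measurable_manifold muM (ch l) f0 (fint l) fV fE Vx (g2 l (conj Mx Dx))
  (fun k => t_gt0 (rho k)) _ _ (fun k => nt (rho k)) (g1 l (conj Mx Dx))).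
- exact: (cvg_comp _ _ rhooo t0).
- exact: (cvg_comp _ _ rhooo noo).
Qed.

End atlas_limits.

Section expected_count_limit.
Context {R : realType} (m d : nat).
Local Notation Vd := 'rV[R]_d.
Local Notation Vm := 'rV[R]_m.
Local Notation lam := (@lebesgue_rV R m).
Variables (M : set Vd) (mu : probability Vd R).
Hypothesis m_gt0 : (0 < m)%N.
Hypothesis manifold : smooth_submanifold m M.
Hypothesis law_ac : forall x, M x ->
    forall (U : set Vd) (psi : Vd -> Vm),
      chart M U psi -> U x ->
      pushforward (restriction mu U) psi `<< restriction lam (psi @` U).
Hypothesis muM : mu (~` M) = 0%E.
Context dO (Omega : measurableType dO) (P : probability Omega R).
Variable X : nat -> {mfun Omega >-> Vd}.
Hypothesis law : forall i A, measurable A -> P (X i @^-1` A) = mu A.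
Hypothesis indep : mutually_independent P (fun i => X i : Omega -> Vd).
Variable nn : forall n, n.-tuple Vd -> 'I_n -> 'I_n.
Hypothesis nn_rule : forall n, nearest_neighbor_rule (@nn n).

(** Passing to [C = true] enlarges the region of pairs and shrinks the balls to be avoided; the
    uniform bound for large stars thus covers strict ones. *)
Lemma star_mass_mono N r x : (star_mass mu false N r x <= star_mass mu true N r x)%E.
Proof.
rewrite !star_massE; apply: ge0_le_integral => //.
- by move=> q _; exact: star_weight_ge0.
- by apply: measurable_star_weight => //; exact: measurable_snd.
- by apply: measurable_star_weight => //; exact: measurable_snd.
move=> q _; rewrite lee_fin.
have m0 : 0 <= miss mu false x q.1 q.2 by exact: fine_ge0.
have le_miss : miss mu false x q.1 q.2 <= miss mu true x q.1 q.2.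
  rewrite /miss fine_le ?fin_num_measure//.
  - by apply: measurable_setb; apply: measurable_neg; apply: measurable_hits.
  - by apply: measurable_setb; apply: measurable_neg; apply: measurable_hits.
  apply: le_measure; rewrite ?inE.
  - by apply: measurable_setb; apply: measurable_neg; apply: measurable_hits.
  - by apply: measurable_setb; apply: measurable_neg; apply: measurable_hits.
  move=> w /=; apply: contra; rewrite /hits /in_nball /lte_if /=.
  by move=> /orP[/ltW ->|/ltW ->]; rewrite ?orbT.
have le_near : (near_gamma false r x q.1 q.2 <= near_gamma true r x q.1 q.2)%N.
  rewrite /near_gamma /in_gamma /lte_if; case: (_ <= r) => //=; case: (_ <= r) => //=.
  by case: ltP => // /ltW ->.
by rewrite ler_pM ?exprn_ge0 ?ler_nat// lerXn2r ?nnegrE// (le_trans m0).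
Qed.

Lemma far_mass_le1 r x : far_mass mu r x <= 1.
Proof.
have mF : measurable [set w : Vd | ~~ (enorm (w - x) <= r)].
  by apply: measurable_setb; exact: measurable_far.
by rewrite -lee_fin /far_mass fineK ?fin_num_measure//; exact: probability_le1.
Qed.

Theorem expected_count_cvg :
  (expected_count P X (@nn n) @[n --> \oo] --> limit_constant R m)%E.
Proof.
apply: (@subsequence_principle _ _ _ 3) => sigma sigma3 sigmaS.
have sigmaoo := increasing_cvg sigmaS.
have atomless := manifold_atomless m_gt0 manifold law_ac muM.
have sigma0 k : 0 < (sigma k)%:R :> R by rewrite ltr0n (leq_trans _ (sigma3 k)).
(* The scale [t = n^(-1/m)]. *)
have Ht k : exists s : R, 0 < s /\ s ^+ m = (sigma k)%:R^-1.
  have := sigma0 k; rewrite -invr_gt0 => /(nth_root m_gt0)[s s0 sE].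
  by exists s.
have [t tP] := choice Ht.
have t_gt0 k : 0 < t k by have [] := tP k.
have nt k : (sigma k)%:R * t k ^+ m = 1 by have [_ ->] := tP k; rewrite mulfV// gt_eqF.
have t0 : t k @[k --> \oo] --> 0.
  have ninv : (sigma k)%:R^-1 @[k --> \oo] --> (0 : R).
    by apply/gtr0_cvgV0; [exact: nearW|exact/cvgrnyP].
  apply/cvgrPdist_lt => e e0; near=> k; rewrite sub0r normrN gtr0_norm//.
  have : (sigma k)%:R^-1 < e ^+ m.
    by near: k; move/cvgr_lt : ninv; apply; rewrite exprn_gt0.
  have [_ <-] := tP k; rewrite ltr_pXn2r ?nnegrE ?(ltW e0) ?(ltW (t_gt0 k))//.
have [rho rhoS lim] := local_limits m_gt0 manifold law_ac muM sigmaoo t_gt0 t0 nt.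
exists rho => //; have rhooo := increasing_cvg rhoS.
pose N k := sigma (rho k); pose tau k := t (rho k).
have N3 k : (2 < N k)%N by exact: sigma3.
have Noo : N k @[k --> \oo] --> \oo by exact: (cvg_comp _ _ rhooo sigmaoo).
pose K := kissing_bound d.
pose Z C r k x := (((N k).-1 * (N k).-2)%:R%:E * star_mass mu C (N k - 3) (r%:R * tau k)%R x)%E.
have mZ C r k : measurable_fun setT (Z C r k).
  by apply: measurable_funeM; exact: measurable_star_mass.
have Z0 C r k x : (0 <= Z C r k x)%E by rewrite mule_ge0// star_mass_ge0.
(* The bound for a sample of [n - 1] points and the extra point [x]: it has exactly the factor
   [(n-1)(n-2)] and the exponent [(n-1) - 2 = n - 3]. *)
have Ztrue r k x : (Z true r k x <= (K ^ 2)%:R%:E)%E.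
  have := center_bound law indep atomless (N k).-1 x (r%:R * tau k).
  by rewrite /Z (_ : ((N k).-1 - 2 = N k - 3)%N)//; lia.
have ZB C r k x : (0 <= Z C r k x <= (K ^ 2)%:R%:E)%E.
  rewrite Z0 /=; case: C => //; apply: le_trans (Ztrue r k x).
  by apply: lee_wpmul2l; [rewrite lee_fin|exact: star_mass_mono].
pose Far r k x := (far_mass mu (r%:R * tau k)%R x ^+ (N k).-1)%:E : \bar R.
have mFar (r k : nat) : measurable_fun setT (Far r k).
  by apply/measurable_EFinP; apply: measurable_funX; exact: measurable_far_mass.
have Far01 (r k : nat) x : (0 <= Far r k x <= 1%:E)%E.
  by rewrite !lee_fin exprn_ge0 ?far_mass_ge0//= exprn_ile1 ?far_mass_ge0 ?far_mass_le1.
have Zlim : {ae mu, forall x, exists2 s : R, 0 < s & forall r : nat,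
    (forall C, (Z C r k x @[k --> \oo] --> pair_integral m (r%:R * s))%E) /\
    (Far r k x @[k --> \oo] --> (expR (- fine (lam (cball (r%:R * s)))))%:E)%E}.
  apply: filterS lim => x [s s0 H]; exists s => // r; split=> [C|]; last first.
    by apply: cvg_EFin; [exact: nearW|have [_] := H r%:R true].
  have [H1 _] := H r%:R C.
  (* The blow-up is normalized by [n^2], the count by [(n-1)(n-2)]; the ratio tends to 1. *)
  pose q k : R := ((N k).-1 * (N k).-2)%:R / (N k)%:R ^+ 2.
  have q1 : q k @[k --> \oo] --> (1 : R) by exact: cvg_ratio_pred (fun k => ltnW (ltnW (N3 k))) Noo.
  have qE : ((q k)%:E @[k --> \oo] --> 1%:E)%E by apply: cvg_EFin => //; exact: nearW.
  have qdef : (1%:E *? pair_integral m (r%:R * s))%E.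
    by rewrite mule_defE; case: (pair_integral m _) => [y| |]; rewrite ?eqe ?oner_eq0 ?andbF/=.
  have H2 := cvgeM qdef qE H1; rewrite mul1e in H2.
  suff -> : Z C r ^~ x = (fun k => ((q k)%:E *
      (((N k)%:R ^+ 2)%:E * star_mass mu C (N k - 3) (r%:R * tau k)%R x))%E) by exact: H2.
  apply/funext => k; rewrite muleA -EFinM divfK// expf_neq0// gt_eqF// ltr0n.
  by rewrite ltnW// ltnW.
(* The limit is [pair_integral m (r * s)] with an [s] that exists for almost every [x] and carries
   no measurability; the upper limit is a measurable function equal to it almost everywhere. *)
pose h r x := limn_esup (fun k => Z true r k x).
pose hF r x := limn_esup (fun k => Far r k x).
have mh r : measurable_fun setT (h r) by exact: measurable_fun_limn_esup.
have mhF r : measurable_fun setT (hF r) by exact: measurable_fun_limn_esup.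
have hlim : {ae mu, forall x, exists2 s : R, 0 < s & forall r : nat,
    [/\ (forall C, (Z C r k x @[k --> \oo] --> h r x)%E), (Far r k x @[k --> \oo] --> hF r x)%E,
     h r x = pair_integral m (r%:R * s) & hF r x = (expR (- fine (lam (cball (r%:R * s)))))%:E]}.
  apply: filterS Zlim => x [s s0 H]; exists s => // r; have [H1 H2] := H r.
  have E1 : h r x = pair_integral m (r%:R * s) by have [_] := cvg_limn_einf_sup (H1 true).
  have E2 : hF r x = (expR (- fine (lam (cball (r%:R * s)))))%:E by have [_] := cvg_limn_einf_sup H2.
  by rewrite E1 E2.
pose a r := (\int[mu]_x h r x)%E; pose b r := (\int[mu]_x hF r x)%E.
have Za C r : (\int[mu]_x Z C r k x @[k --> \oo] --> a r)%E.
  apply: (bounded_ae_cvg (B := (K ^ 2)%:R)) => //.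
    by apply: filterS hlim => x [s _ /(_ r)[]].
  exact: aeW.
have Fb r : (\int[mu]_x Far r k x @[k --> \oo] --> b r)%E.
  apply: (bounded_ae_cvg (B := 1)) => //.
    by apply: filterS hlim => x [s _ /(_ r)[]].
  exact: aeW.
have intZ C r k : (0 <= \int[mu]_x Z C r k x <= (K ^ 2)%:R%:E)%E.
  rewrite integral_ge0//= (@le_trans _ _ (\int[mu]_x (K ^ 2)%:R%:E)%E)//.
    by apply: ge0_le_integral => // x _; have /andP[] := ZB C r k x.
  by rewrite integral_cst// -[leRHS]mule1 lee_wpmul2l//; exact: probability_le1.
have ac : (a r @[r --> \oo] --> limit_constant R m)%E.
  rewrite (_ : limit_constant R m = \int[mu]_x (cst (limit_constant R m) x))%E; last first.
    rewrite integral_cst// -[LHS]mule1; congr (_ * _)%E; exact/esym/probability_setT.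
  apply: (bounded_ae_cvg (B := (K ^ 2)%:R)) => //.
    apply: filterS hlim => x [s s0 H] /=.
    rewrite (_ : h ^~ x = fun r : nat => pair_integral m (r%:R * s)); first exact: pair_integral_cvg.
    by apply/funext => r; have [] := H r.
  apply: filterS hlim => x [s s0 H] r; have [/(_ true) H1 _ _ _] := H r.
  apply/andP; split.
    by apply: (cvge_to_ge H1); apply: nearW.
  by apply: (cvge_to_le H1); apply: nearW.
(* As the radius grows, a ball of this radius in the limit has infinite volume: asymptotically no
   point stays isolated. *)
have b0 : (b r @[r --> \oo] --> 0)%E.
  rewrite (_ : 0%E = \int[mu]_x (cst 0%E x : \bar R))%E; last by rewrite integral0.
  apply: (bounded_ae_cvg (B := 1)) => //.
    apply: filterS hlim => x [s s0 H] /=.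
    rewrite (_ : hF ^~ x = fun r : nat => (expR (- fine (lam (cball (r%:R * s)))))%:E).
      by apply: cvg_EFin; [exact: nearW|exact: closed_ball_volume_pinfty].
    by apply/funext => r; have [] := H r.
  apply: filterS hlim => x [s s0 H] r; have [_ H1 _ _] := H r.
  apply/andP; split.
    by apply: (cvge_to_ge H1); apply: nearW => k; have /andP[] := Far01 r k x.
  by apply: (cvge_to_le H1); apply: nearW => k; have /andP[] := Far01 r k x.
(* The constant is a limit of averages that never exceed the squared kissing bound. *)
have cfin : limit_constant R m \is a fin_num.
  have ale r : (0 <= a r <= (K ^ 2)%:R%:E)%E.
    apply/andP; split.
      by apply: (cvge_to_ge (Za true r)); apply: nearW => k; have /andP[] := intZ true r k.
    by apply: (cvge_to_le (Za true r)); apply: nearW => k; have /andP[] := intZ true r k.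
  rewrite ge0_fin_numE.
    rewrite (@le_lt_trans _ _ (K ^ 2)%:R%:E) ?ltry//.
    by apply: (cvge_to_le ac); apply: nearW => r; have /andP[] := ale r.
  by apply: (cvge_to_ge ac); apply: nearW => r; have /andP[] := ale r.
have intE C r k : (((N k).-1 * (N k).-2)%:R%:E * \int[mu]_x star_mass mu C (N k - 3) (r%:R * tau k)%R x =
    \int[mu]_x Z C r k x)%E.
  rewrite ge0_integralZl//; first exact: measurable_star_mass.
  by move=> x _; exact: star_mass_ge0.
apply: (@double_squeeze R _ (fun r k => \int[mu]_x Z false r k x)%E
  (fun r k => \int[mu]_x Z true r k x + (2 * K)%:R%:E * \int[mu]_x Far r k x)%E
  a (fun r => a r + (2 * K)%:R%:E * b r)%E) => //.
- move=> r; apply: nearW => k; apply/andP; split.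
    by rewrite -intE; apply: expected_count_ge => //; exact: ltnW.
  by rewrite -intE; apply: expected_count_le => //; exact: ltnW.
- move=> r; apply: cvgeD => //; last exact: cvgeZl.
  apply: ge0_adde_def; rewrite inE.
    by apply: (cvge_to_ge (Za true r)); apply: nearW => k; have /andP[] := intZ true r k.
  rewrite mule_ge0//; apply: (cvge_to_ge (Fb r)); apply: nearW => k.
  by apply: integral_ge0 => x _; have /andP[] := Far01 r k x.
- rewrite -[X in _ --> X]adde0 -[X in (_ + X)%E](mule0 (2 * K)%:R%:E).
  apply: cvgeD => //; last exact: cvgeZl.
  by rewrite mule0 fin_num_adde_defl.
Unshelve. all: by end_near. Qed.

End expected_count_limit.

Unset Implicit Arguments.

Theorem lemma1p5 (R : realType) (m d : nat) (m_ge1 : (1 <= m)%N)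
  (m_le_d : (m <= d)%N)
  (M : set 'rV[R]_d) (M_manifold : smooth_submanifold m M)
  (dOmega : measure_display) (Omega : measurableType dOmega)
  (P : probability Omega R)
  (X : {mfun Omega >-> 'rV[R]_d})
  (X_in_M : {ae P, forall w, M (X w)})
  (law_ac : forall x, M x ->
    forall (U : set 'rV[R]_d) (psi : 'rV[R]_d -> 'rV[R]_m),
      chart M U psi -> U x ->
      pushforward (restriction (distribution P X) U) psi
        `<< restriction (lebesgue_rV m) (psi @` U))
  (Xs : nat -> {mfun Omega >-> 'rV[R]_d})
  (Xs_copies : forall i (A : set 'rV[R]_d), measurable A ->
    distribution P (Xs i) A = distribution P X A)
  (Xs_indep : mutually_independent P (fun i => Xs i : Omega -> 'rV[R]_d))
  (nn : forall n, n.-tuple 'rV[R]_d -> 'I_n -> 'I_n)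
  (nn_rule : forall n, nearest_neighbor_rule (nn n)) :
  ('E_P[fun w => (n%:R^-1 *
    (shared_target_count (nn_edge (nn n) [tuple Xs i w | i < n]))%:R)%R])%E
    @[n --> \oo] --> limit_constant R m.
Proof.
pose mu : probability 'rV[R]_d R := distribution P X.
have mM : measurable M := measurable_manifold M_manifold law_ac.
(* Since [M] is Borel, its complement is itself an event, contained in the negligible set given by
   [X_in_M]. *)
have muM : mu (~` M) = 0%E.
  have [Z [mZ Z0 ZP]] := X_in_M.
  have mXM : measurable (X @^-1` (~` M)).
    by rewrite -[X in measurable X]setTI; apply: measurable_funPT => //; exact: measurableC.
  apply/eqP; rewrite eq_le measure_ge0 andbT -Z0.
  suff : (P (X @^-1` (~` M)) <= P Z)%E by [].
  by apply: le_measure; rewrite ?inE.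
have law i (A : set 'rV[R]_d) : measurable A -> P (Xs i @^-1` A) = mu A.
  exact: Xs_copies.
exact: (expected_count_cvg m_ge1 M_manifold law_ac muM law Xs_indep nn_rule).
Qed.
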